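(* Let $V:\mathbb{R}\to\mathbb{R}$ be such that $V(x)-\rho x^2$ is convex for some $\rho>0$, and let $[a,b]=\mathrm{supp}(\mu_V)$ be the support of its equilibrium measure. Then for any smooth function $\phi$, $$\int\phi'(x)^2\,\mu_V(dx)\ge\frac{\rho}{2\pi^2}\int_a^b\int_a^b\left(\frac{\phi(x)-\phi(y)}{x-y}\right)^2\frac{-2ab+(a+b)(x+y)-2xy}{2\sqrt{(x-a)(b-x)}\sqrt{(y-a)(b-y)}}\,dx\,dy.$$ Equality is attained for $V(x)=\rho(x-\alpha)^2+\beta$ and $\phi(x)=c_1+c_2x$ for constants $c_1,c_2$.
   Context: The equilibrium measure $\mu_V$ of $V$ is the unique minimizer, among all probability measures $\mu$ on $\mathbb{R}$, of $$E_V(\mu)=\int V(x)\,\mu(dx)-\iint\log|x-y|\,\mu(dx)\mu(dy).$$ It is known that, for convex $V$ with $\lim_{|x|\to\infty}(V(x)-2\log|x|)=\infty$, this minimizer exists, is unique and is compactly supported, and its support is a single interval $[a,b]$. *)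

(* Defs.v *)
From HB Require Import structures.
From mathcomp Require Import all_boot all_order all_algebra.
From mathcomp Require Import all_classical all_reals all_analysis.

Set Implicit Arguments.
Unset Strict Implicit.
Unset Printing Implicit Defensive.

Import Order.TTheory GRing.Theory Num.Theory.
Import numFieldNormedType.Exports.

Local Open Scope classical_set_scope.
Local Open Scope ring_scope.

(* The logarithm is [lne], with [lne 0 = -oo] on the diagonal, rather than [ln],
   for which [ln 0 = 0].  The double integral is taken against the product
   measure.  The difference is the dual one, for which [+oo - +oo = +oo] (the
   subtraction of [\bar R] gives [-oo]): a measure for which both terms are
   infinite must not count as a minimizer.  For [V] convex with
   [V x - 2 log |x|] tending to infinity, this agrees with the integral of
   [(V x + V y) / 2 - log |x - y|] against the product measure.  When the
   positive and negative parts of the logarithm both have infinite integral,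
   [\int] returns [-oo], which again yields the energy [+oo]. *)
Definition energy (R : realType) (V : R -> R)
    (mu : probability (measurableTypeR R) R) : \bar R :=
  ((\int[mu]_x (V x)%:E)%E
   - (\int[(mu \x mu)%E]_z lne (`|z.1 - z.2|)%:E)%E)%dE.

Definition energy_minimizer (R : realType) (V : R -> R)
    (mu : probability (measurableTypeR R) R) : Prop :=
  forall nu : probability (measurableTypeR R) R,
    (energy V mu <= energy V nu)%E.

(* Uniqueness is equality on measurable sets: a measure is a function on all
   sets, whose values at non-measurable sets are unconstrained. *)
Definition equilibrium_measure (R : realType) (V : R -> R)
    (mu : probability (measurableTypeR R) R) : Prop :=
  energy_minimizer V mu /\
  forall nu : probability (measurableTypeR R) R, energy_minimizer V nu ->
    forall A : set (measurableTypeR R), measurable A -> nu A = mu A.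

Definition measure_support (R : realType)
    (mu : probability (measurableTypeR R) R) : set R :=
  [set x | forall U : set R, open U -> U x -> (0 < mu U)%E].

Definition smooth (R : realType) (phi : R -> R) : Prop :=
  forall (n : nat) (x : R), derivable (derive1n n phi) x 1.

(* The values on the diagonal and on the boundary of the square, where division
   by zero returns 0, do not matter: these are null sets. *)
Definition poincare_integrand (R : realType) (a b : R) (phi : R -> R)
    (x y : R) : R :=
  ((phi x - phi y) / (x - y)) ^+ 2
  * ((- 2 * a * b + (a + b) * (x + y) - 2 * x * y)
     / (2 * Num.sqrt ((x - a) * (b - x)) * Num.sqrt ((y - a) * (b - y)))).

Definition poincare_lower_bound (R : realType) (rho a b : R) (phi : R -> R)
    : \bar R :=
  ((rho / (2 * pi ^+ 2))%:E *
   \int[lebesgue_measure]_(y in `[a, b])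
     \int[lebesgue_measure]_(x in `[a, b])
       (poincare_integrand a b phi x y)%:E)%E.

(* Main.v *)
Require Import Defs.
From HB Require Import structures.
From mathcomp Require Import all_boot all_order all_algebra.
From mathcomp Require Import all_classical all_reals all_analysis.
From mathcomp Require Import measurable_realfun.
From mathcomp Require Import ring lra.

Import Order.TTheory GRing.Theory Num.Theory.
Import numFieldNormedType.Exports.

Local Open Scope classical_set_scope.
Local Open Scope ring_scope.

(** Write [a = m - r], [b = m + r] and [chi x = sqrt ((x - a) (b - x))].  Both
    sides of the inequality are compared with the integral of
    [(rho / pi) chi phi'^2] over [[a, b]].

    Right-hand side.  By Cauchy-Schwarz, [(phi y - phi x)^2] is at most
    [(y - x)] times the integral of [phi'^2] between [x] and [y].  After
    Tonelli, the weight in front of [phi' u ^2] is twice the integral of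
    [(r^2 - (x - m)(y - m)) / ((y - x) chi x chi y)] over [x < u < y].  This
    integral is elementary and equals [pi chi u] ([inner_wker], [outer_wker]),
    which gives [poincare_upper].

    Left-hand side.  It suffices that the measure [mu] is at least
    [(rho / pi) chi dx] on [[a, b]] ([integral_semicircle_le]).  The
    Euler-Lagrange conditions say that the potential of [mu] for the kernel
    [- ln |x - y|] is [(const - V x) / 2] almost everywhere on the support
    ([effpot_le_support], [effpot_ge_ae]).  As [V - rho x^2] is convex, smoothing with a cubic
    B-spline of step [d] turns this into a differential inequality without
    derivatives: for the smoothed density [f] of [mu], the integral of
    [(f (c + h) + f (c - h) - 2 f c) / h^2] over [0 < h < L], minus [2 f c / L],
    is at most [- rho] ([spline_fractional]; there [f] carries an unnormalized
    factor [d^4]).  Up to the factor [pi], this expression is minus the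
    half-Laplacian of [f] at [c]; the term [2 f c / L] comes from [h > L], where
    [f] vanishes.  For a semicircle density [(rho / pi) chi] of slightly smaller
    radius the same expression equals [- rho] ([chi_fractional]).  Hence, at a
    minimum [c] of [f - (rho / pi) chi] over the line, where the second
    differences of [f] dominate those of the semicircle, [f c] is at least
    [(rho / pi) chi c]: this minimum principle is [spline_ge_semicircle].
    Letting [d] tend to [0] gives the bound on [mu].

    Equality.  For an affine [phi] of slope [c2] the double integral is
    explicit and the right-hand side is [c2^2 rho (b - a)^2 / 8]
    ([poincare_lower_bound_affine]).  The inequality for [phi x = x] gives
    [rho (b - a)^2 <= 8].  For the converse, moving the mass of [mu] along
    [x + t / (z - x)] with [z] outside [[a, b]] changes the energy to first
    order by a quadratic expression in [G], the integral of [1 / (z - x)].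
    Minimality makes it vanish, and the discriminant of the quadratic equation
    is nonnegative only if [rho (z - alpha)^2 >= 2]; letting [z] tend to the
    endpoints yields [8 <= rho (b - a)^2] ([quadratic_support_radius]). *)

(** * Improper integrals of nonnegative functions *)

(** Translation invariance of the Lebesgue measure, through its uniqueness on
    half-open intervals. *)
Lemma integral_shift (R : realType) (g : R -> \bar R) (c : R) :
  measurable_fun [set: R] g -> (forall x, 0 <= g x)%E ->
  (\int[lebesgue_measure]_x g (x + c)%R = \int[lebesgue_measure]_x g x)%E.
Proof.
move=> mg g0.
pose T := (fun x : measurableTypeR R => (x + c)%R : measurableTypeR R).
have mT : measurable_fun setT T by exact: measurable_funD.
have -> : (\int[lebesgue_measure]_x g x = \int[pushforward lebesgue_measure T]_x g x)%E.
  apply: eq_measure_integral => A mA _.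
  apply: (@lebesgue_measure_unique R (pushforward lebesgue_measure T)) => //.
  move=> _ [[a b]] _ <-.
  transitivity (@lebesgue_measure R `]a - c, b - c]%classic); last first.
    congr lebesgue_measure; apply/seteqP; split => x /=; rewrite !in_itv/= /T; lra.
  rewrite !lebesgue_measure_itv/= !lte_fin ltrD2r.
  by case: ifP => // _; rewrite -!EFinB; congr (_%:E); ring.
by rewrite ge0_integral_pushforward.
Qed.

(** The interval is exhausted by compact subintervals, on which the
    fundamental theorem holds; the integrals converge monotonically, so that
    integrability up to the endpoints is a conclusion. The integrands met
    below have poles or square-root singularities at the endpoints. *)
Lemma ge0_FTC2_open (R : realType) (f F : R -> R) (a b la lb : R) :
  a < b ->
  (forall x, a < x < b -> 0 <= f x) ->
  (forall x, a < x < b -> {for x, continuous f}) ->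
  (forall x, a < x < b -> is_derive x 1 F (f x)) ->
  F x @[x --> a^'+] --> la -> F x @[x --> b^'-] --> lb ->
  (\int[lebesgue_measure]_(x in `]a, b[) (f x)%:E = (lb - la)%:E)%E.
Proof.
move=> ab f0 cf dF Fa Fb.
pose e n : R := (b - a) / n.+3%:R.
have e0 n : 0 < e n by rewrite /e divr_gt0// subr_gt0.
have e2 n : e n < (b - a) / 2.
  by rewrite /e ltr_pM2l ?subr_gt0// ltf_pV2 ?posrE// ltr_nat.
have ecvg : e n @[n --> \oo] --> (0 : R).
  rewrite /e -[X in _ --> X](mulr0 (b - a)); apply: cvgMr.
  have := @cvg_harmonic R; rewrite -(cvg_shiftn 2)/=.
  by under eq_fun do rewrite /harmonic/= addn2.
have e_ninc m n : (m <= n)%N -> e n <= e m.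
  by move=> mn; rewrite /e ler_pM2l ?subr_gt0// lef_pV2 ?posrE// ler_nat.
pose S n : set R := `[a + e n, b - e n]%classic.
have SU : \bigcup_n S n = `]a, b[%classic.
  apply/seteqP; split => x /=.
    move=> [n _]; rewrite /S /= !in_itv/=; have := e0 n; lra.
  rewrite in_itv/= => /andP[ax xb].
  have : \forall n \near \oo, e n < Num.min (x - a) (b - x).
    apply: (cvgr_lt 0 ecvg); rewrite lt_min; apply/andP; split; lra.
  move=> [N _ /(_ N (leqnn N))]; rewrite /= lt_min => /andP[? ?].
  exists N => //; rewrite /S /= in_itv/=; lra.
have cI : (\int[lebesgue_measure]_(x in S n) (f x)%:E)%E @[n --> \oo]
    --> (\int[lebesgue_measure]_(x in `]a, b[) (f x)%:E)%E.
  rewrite -SU; apply: ge0_nondecreasing_set_cvg_integral.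
  - move=> m n mn; rewrite subsetEset => x; rewrite /S/= !in_itv/=.
    have := e_ninc _ _ mn; lra.
  - by move=> i; exact: measurable_itv.
  - move=> n; apply/measurable_EFinP.
    apply: (@measurable_funS _ _ _ _ `]a, b[%classic) => //.
      move=> x; rewrite /S/= !in_itv/=; have := e0 n; lra.
    apply: open_continuous_measurable_fun => // x.
    by rewrite inE/= in_itv/=; exact: cf.
  - move=> n x; rewrite /S/= in_itv/= => h; rewrite lee_fin f0//.
    have := e0 n; lra.
have cF x : a < x < b -> {for x, continuous F}.
  move=> h; apply: differentiable_continuous; apply/derivable1_diffP.
  by have [] := dF _ h.
have vI n : (\int[lebesgue_measure]_(x in S n) (f x)%:E
    = (F (b - e n) - F (a + e n))%:E)%E.
  rewrite EFinB; apply: continuous_FTC2.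
  - have := e2 n; lra.
  - apply: continuous_in_subspaceT => x; rewrite inE/= in_itv/= => h.
    apply: cf; have := e0 n; lra.
  - have := e2 n; have := e0 n => en0 en2.
    split => [x| |].
    + rewrite in_itv/= => h; have [] // := dF x _; lra.
    + by apply: cvg_at_right_filter; apply: cF; lra.
    + by apply: cvg_at_left_filter; apply: cF; lra.
  - move=> x; rewrite in_itv/= => h; rewrite derive1E.
    have [|_ ->//] := dF x _; have := e0 n; lra.
have cL : (\int[lebesgue_measure]_(x in S n) (f x)%:E)%E @[n --> \oo] --> (lb - la)%:E.
  under eq_fun do rewrite vI.
  apply: cvg_EFin; first exact: nearW.
  apply: cvgB.
    move/cvg_at_leftP: Fb; apply; split => [n|]; first by have := e0 n; lra.
    by rewrite -[X in _ --> X]subr0; apply: cvgB => //; exact: cvg_cst.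
  move/cvg_at_rightP: Fa; apply; split => [n|]; first by have := e0 n; lra.
  by rewrite -[X in _ --> X]addr0; apply: cvgD => //; exact: cvg_cst.
exact: cvg_unique cI cL.
Qed.

(** Two integrals over open intervals: the point [c] is negligible. *)
Lemma ge0_integral_split (R : realType) (f : R -> R) (a b c : R) :
  a <= c <= b -> measurable_fun [set: R] f -> (forall x, a < x < b -> 0 <= f x) ->
  (\int[lebesgue_measure]_(x in `]a, b[) (f x)%:E
   = \int[lebesgue_measure]_(x in `]a, c[) (f x)%:E
     + \int[lebesgue_measure]_(x in `]c, b[) (f x)%:E)%E.
Proof.
move=> /andP[]; rewrite le_eqVlt => /orP[/eqP -> _ _ _|ac cb mf f0].
  by rewrite set_itvoo0 integral_set0 add0e.
have -> : `]a, b[%classic = `]a, c[ `|` `[c, b[ :> set R.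
  apply/seteqP; split => t /=; rewrite !in_itv/=.
    by move=> /andP[at_ tb]; have [ts|st] := ltP t c; [left|right]; rewrite ?at_ ?tb ?st ?ts.
  by move=> [/andP[at_ ts]|/andP[st tb]]; apply/andP; split => //; lra.
rewrite ge0_integral_setU//=; last 3 first.
- by apply: measurable_funTS; apply/measurable_EFinP.
- by move=> t; rewrite !in_itv/= => ht; rewrite lee_fin f0//; case: ht; lra.
- by apply/disj_set2P; rewrite -subset0 => t [/=]; rewrite !in_itv/=; lra.
rewrite -[X in (_ + X)%E]integral_itv_obnd_cbnd//; last first.
  by apply: measurable_funTS; apply/measurable_EFinP.
Qed.

(** Finitely many exceptional points, at which only the continuity of the
    antiderivative is required; they are split off one by one. *)
Lemma ge0_FTC2_except (R : realType) (s : seq R) (f F : R -> R) (a b : R) :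
  a <= b -> measurable_fun [set: R] f ->
  (forall x, a < x < b -> 0 <= f x) ->
  (forall x, a <= x <= b -> {for x, continuous F}) ->
  (forall x, a < x < b -> x \notin s -> {for x, continuous f}) ->
  (forall x, a < x < b -> x \notin s -> is_derive x 1 F (f x)) ->
  (\int[lebesgue_measure]_(x in `]a, b[) (f x)%:E = (F b - F a)%:E)%E.
Proof.
elim: s a b => [|c s IH] a b ab mf f0 cF cf dF.
  move: ab; rewrite le_eqVlt => /orP[/eqP ab|ab].
    rewrite ab set_itvoo0 integral_set0 subrr//.
  apply: ge0_FTC2_open => //.
  - by move=> x h; exact: cf.
  - by move=> x h; exact: dF.
  - by apply: cvg_at_right_filter; apply: cF; lra.
  - by apply: cvg_at_left_filter; apply: cF; lra.
have [/andP[ac cb]|nc] := boolP (a < c < b); last first.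
  apply: IH => //.
    move=> x h xs; apply: cf => //; rewrite inE negb_or xs andbT.
    by apply: contra nc => /eqP <-.
  move=> x h xs; apply: dF => //; rewrite inE negb_or xs andbT.
  by apply: contra nc => /eqP <-.
rewrite (ge0_integral_split R f a b c) ?(ltW ac) ?(ltW cb)//.
have -> : (\int[lebesgue_measure]_(x in `]a, c[) (f x)%:E = (F c - F a)%:E)%E.
  apply: IH => //; first exact: ltW.
  - by move=> x h; apply: f0; lra.
  - by move=> x h; apply: cF; lra.
  - by move=> x h xs; apply: cf; [lra|rewrite inE negb_or xs andbT lt_eqF//; lra].
  - by move=> x h xs; apply: dF; [lra|rewrite inE negb_or xs andbT lt_eqF//; lra].
have -> : (\int[lebesgue_measure]_(x in `]c, b[) (f x)%:E = (F b - F c)%:E)%E.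
  apply: IH => //; first exact: ltW.
  - by move=> x h; apply: f0; lra.
  - by move=> x h; apply: cF; lra.
  - by move=> x h xs; apply: cf; [lra|rewrite inE negb_or xs andbT gt_eqF//; lra].
  - by move=> x h xs; apply: dF; [lra|rewrite inE negb_or xs andbT gt_eqF//; lra].
by rewrite -EFinD; congr (_%:E); ring.
Qed.

(** * Differentiation and continuity by structural rules *)

Section deriv_rules.
Context {R : realType}.
Implicit Types f g : R -> R.

Lemma dcst (c x : R) : is_derive x 1 (fun _ : R => c) 0.
Proof. exact: is_derive_cst. Qed.
Lemma did (x : R) : is_derive x 1 (fun y : R => y) 1.
Proof. exact: is_derive_id. Qed.
Lemma dadd f g (x df dg : R) : is_derive x 1 f df -> is_derive x 1 g dg ->
  is_derive x 1 (fun y => f y + g y) (df + dg).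
Proof. by move=> ? ?; exact: is_deriveD. Qed.
Lemma dopp f (x df : R) : is_derive x 1 f df ->
  is_derive x 1 (fun y => - f y) (- df).
Proof. by move=> ?; exact: is_deriveN. Qed.
Lemma dmul f g (x df dg : R) : is_derive x 1 f df -> is_derive x 1 g dg ->
  is_derive x 1 (fun y => f y * g y) (f x * dg + g x * df).
Proof. by move=> ? ?; exact: is_deriveM. Qed.
Lemma dsqr f (x df : R) : is_derive x 1 f df ->
  is_derive x 1 (fun y => f y ^+ 2) (2 * f x * df).
Proof.
move=> ?; have := @is_deriveM R R f f x 1 df df _ _.
by move=> h; apply: is_derive_eq; rewrite /= /GRing.scale/= ; ring.
Qed.
Lemma dinv f (x df : R) : f x != 0 -> is_derive x 1 f df ->
  is_derive x 1 (fun y => (f y)^-1) (- (f x) ^- 2 * df).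
Proof. by move=> ? ?; exact: is_deriveV. Qed.
Lemma dcomp (h f : R -> R) (x dh df : R) : is_derive (f x) 1 h dh ->
  is_derive x 1 f df -> is_derive x 1 (fun y => h (f y)) (dh * df).
Proof. by move=> H1 H2; exact: is_derive1_comp. Qed.
Lemma dsqrt f (x df : R) : 0 < f x -> is_derive x 1 f df ->
  is_derive x 1 (fun y => Num.sqrt (f y)) ((2 * Num.sqrt (f x))^-1 * df).
Proof. by move=> f0 ?; exact: (@dcomp Num.sqrt f x _ _ (is_derive1_sqrt f0)). Qed.
Lemma dln f (x df : R) : 0 < f x -> is_derive x 1 f df ->
  is_derive x 1 (fun y => ln (f y)) ((f x)^-1 * df).
Proof. by move=> f0 ?; exact: (@dcomp (@ln R) f x _ _ (is_derive1_ln f0)). Qed.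
Lemma datan f (x df : R) : is_derive x 1 f df ->
  is_derive x 1 (fun y => atan (f y)) ((1 + f x ^+ 2)^-1 * df).
Proof. by move=> ?; exact: (@dcomp (@atan R) f x _ _ (is_derive1_atan _)). Qed.
Lemma der_eq f (x df df' : R) : is_derive x 1 f df' -> df' = df -> is_derive x 1 f df.
Proof. by move=> ? <-. Qed.
End deriv_rules.
(** [dstart] leaves the derivative to be found by [der] and then an equation
    between the derivative found and the expected one. *)
Ltac dstart := notypeclasses refine (der_eq _ _ _ _ _ _).
Ltac der1 :=
  first [ notypeclasses refine (dcst _ _) |
  lazymatch goal with
  | |- is_derive ?x _ (fun y => y) _ => notypeclasses refine (did x)
  | |- is_derive ?x _ (fun y => GRing.add (@?f y) (@?g y)) _ =>
      notypeclasses refine (dadd f g x _ _ _ _)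
  | |- is_derive ?x _ (fun y => GRing.opp (@?f y)) _ =>
      notypeclasses refine (dopp f x _ _)
  | |- is_derive ?x _ (fun y => GRing.mul (@?f y) (@?g y)) _ =>
      notypeclasses refine (dmul f g x _ _ _ _)
  | |- is_derive ?x _ (fun y => GRing.exp (@?f y) 2%N) _ =>
      notypeclasses refine (dsqr f x _ _)
  | |- is_derive ?x _ (fun y => GRing.inv (@?f y)) _ =>
      notypeclasses refine (dinv f x _ _ _)
  | |- is_derive ?x _ (fun y => Num.sqrt (@?f y)) _ =>
      notypeclasses refine (dsqrt f x _ _ _)
  | |- is_derive ?x _ (fun y => ln (@?f y)) _ =>
      first [ eassumption | notypeclasses refine (dln f x _ _ _)]
  | |- is_derive ?x _ (fun y => atan (@?f y)) _ =>
      notypeclasses refine (datan f x _ _)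
  | |- is_derive ?x _ _ _ => eassumption
  end ].
Ltac der := repeat (der1; cbv beta).

Section cont_rules.
Context {R : realType}.
Implicit Types f g : R -> R.

Lemma ccst (c x : R) : {for x, continuous (fun _ : R => c)}.
Proof. exact: cst_continuous. Qed.
Lemma cid (x : R) : {for x, continuous (fun y : R => y)}.
Proof. exact: cvg_id. Qed.
Lemma cadd f g (x : R) : {for x, continuous f} -> {for x, continuous g} ->
  {for x, continuous (fun y => f y + g y)}.
Proof. by move=> ? ?; exact: continuousD. Qed.
Lemma copp f (x : R) : {for x, continuous f} -> {for x, continuous (fun y => - f y)}.
Proof. by move=> ?; exact: continuousN. Qed.
Lemma cmul f g (x : R) : {for x, continuous f} -> {for x, continuous g} ->
  {for x, continuous (fun y => f y * g y)}.
Proof. by move=> ? ?; exact: continuousM. Qed.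
Lemma csqr f (x : R) : {for x, continuous f} ->
  {for x, continuous (fun y => f y ^+ 2)}.
Proof. by move=> ?; exact: (cmul f f). Qed.
Lemma cinv f (x : R) : f x != 0 -> {for x, continuous f} ->
  {for x, continuous (fun y => (f y)^-1)}.
Proof. by move=> ? ?; exact: continuousV. Qed.
Lemma ccomp (h f : R -> R) (x : R) : {for f x, continuous h} ->
  {for x, continuous f} -> {for x, continuous (fun y => h (f y))}.
Proof. by move=> ? ?; exact: continuous_comp. Qed.
Lemma csqrt f (x : R) : {for x, continuous f} ->
  {for x, continuous (fun y => Num.sqrt (f y))}.
Proof. by move=> ?; apply: (ccomp Num.sqrt) => //; exact: sqrt_continuous. Qed.
Lemma cln f (x : R) : 0 < f x -> {for x, continuous f} ->
  {for x, continuous (fun y => ln (f y))}.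
Proof. by move=> f0 ?; apply: (ccomp (@ln R)) => //; exact: continuous_ln. Qed.
Lemma cnorm f (x : R) : {for x, continuous f} ->
  {for x, continuous (fun y => `|f y|)}.
Proof. by move=> ?; apply: (ccomp Num.norm) => //; exact: norm_continuous. Qed.
Lemma catan f (x : R) : {for x, continuous f} ->
  {for x, continuous (fun y => atan (f y))}.
Proof. by move=> ?; apply: (ccomp (@atan R)) => //; exact: continuous_atan. Qed.
End cont_rules.
(** A hook for the continuity of further functions, redefined below. *)
Ltac cont_atom := fail.
Ltac cont1 :=
  first [ refine (ccst _ _) |
  lazymatch goal with
  | |- prop_for ?x (inPhantom (continuous (fun y => y))) => refine (cid x)
  | |- prop_for ?x (inPhantom (continuous (fun y => GRing.add (@?f y) (@?g y)))) =>
      refine (cadd f g x _ _)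
  | |- prop_for ?x (inPhantom (continuous (fun y => GRing.opp (@?f y)))) =>
      refine (copp f x _)
  | |- prop_for ?x (inPhantom (continuous (fun y => GRing.mul (@?f y) (@?g y)))) =>
      refine (cmul f g x _ _)
  | |- prop_for ?x (inPhantom (continuous (fun y => GRing.exp (@?f y) 2%N))) =>
      refine (csqr f x _)
  | |- prop_for ?x (inPhantom (continuous (fun y => GRing.inv (@?f y)))) =>
      refine (cinv f x _ _)
  | |- prop_for ?x (inPhantom (continuous (fun y => Num.sqrt (@?f y)))) =>
      refine (csqrt f x _)
  | |- prop_for ?x (inPhantom (continuous (fun y => ln (@?f y)))) =>
      refine (cln f x _ _)
  | |- prop_for ?x (inPhantom (continuous (fun y => Num.norm (@?f y)))) =>
      refine (cnorm f x _)
  | |- prop_for ?x (inPhantom (continuous (fun y => atan (@?f y)))) =>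
      refine (catan f x _)
  | |- prop_for ?x _ => first [eassumption | cont_atom]
  end ].
Ltac cont := repeat (cbv beta; cont1); cbv beta; try eassumption.

(** * The semicircle function and its antiderivatives *)

Section semicircle.
Context {R : realType}.
Implicit Types m r x y u : R.
Definition chi m r x := Num.sqrt (r ^+ 2 - (x - m) ^+ 2).

Lemma chi_arg_gt0 m r x : m - r < x < m + r -> 0 < r ^+ 2 - (x - m) ^+ 2.
Proof. nra. Qed.
Lemma chi_arg_ge0 m r x : m - r <= x <= m + r -> 0 <= r ^+ 2 - (x - m) ^+ 2.
Proof. nra. Qed.
Lemma chi_ge0 m r x : 0 <= chi m r x. Proof. exact: sqrtr_ge0. Qed.
Lemma chi_gt0 m r x : m - r < x < m + r -> 0 < chi m r x.
Proof. by move=> h; rewrite sqrtr_gt0 chi_arg_gt0. Qed.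
Lemma chi_sqr m r x : m - r <= x <= m + r -> chi m r x ^+ 2 = r ^+ 2 - (x - m) ^+ 2.
Proof. by move=> h; rewrite sqr_sqrtr// chi_arg_ge0. Qed.

Lemma dchi m r x : m - r < x < m + r ->
  is_derive x 1 (chi m r) (- (x - m) / chi m r x).
Proof.
move=> h; have h0 := chi_gt0 _ _ _ h.
dstart; first by rewrite /chi; der; exact: chi_arg_gt0.
rewrite -/(chi m r x) /GRing.scale/=; field; lra.
Qed.

(** The arcsine of [(x - m) / r], written with the half-angle formula so that
    it is continuous up to the endpoints [m - r] and [m + r], where [chi]
    vanishes. *)
Definition asn m r x := 2 * atan ((x - m) / (r + chi m r x)).

Lemma dasn m r x : 0 < r -> m - r < x < m + r ->
  is_derive x 1 (asn m r) (chi m r x)^-1.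
Proof.
move=> r0 h; have h0 := chi_gt0 _ _ _ h.
have dc := dchi _ _ _ h.
have h2 : chi m r x ^+ 2 = r ^+ 2 - (x - m) ^+ 2 by rewrite chi_sqr//; lra.
have rc : r + chi m r x != 0 by rewrite gt_eqF//; lra.
dstart; first by rewrite /asn; der.
move: (chi m r x) h0 h2 {dc rc} => c c0 c2.
have -> : 1 + ((x - m) / (r + c)) ^+ 2 = 2 * r / (r + c).
  have -> : ((x - m) / (r + c)) ^+ 2 = (r ^+ 2 - c ^+ 2) / (r + c) ^+ 2.
    by rewrite exprMn exprVn; congr (_ / _); lra.
  by field; lra.
have -> : (x - m) * (- (r + c) ^- 2 * (0 + - (x - m) / c))
   = (r ^+ 2 - c ^+ 2) / (c * (r + c) ^+ 2).
  have -> : r ^+ 2 - c ^+ 2 = (x - m) ^+ 2 by lra.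
  by field; lra.
by field; lra.
Qed.

End semicircle.

Section semicircle_cont.
Context {R : realType}.
Implicit Types m r x y u : R.

Lemma cchi m r x : {for x, continuous (chi m r)}.
Proof. by rewrite /chi; cont. Qed.
Ltac cont_atom ::= refine (cchi _ _ _).

Lemma casn m r x : 0 < r -> {for x, continuous (asn m r)}.
Proof.
move=> r0; have := chi_ge0 m r x; rewrite /asn => c0; cont.
by rewrite gt_eqF//; lra.
Qed.

Lemma asn_right m r : 0 < r -> asn m r (m + r) = pi / 2.
Proof.
move=> r0; rewrite /asn /chi.
have -> : r ^+ 2 - (m + r - m) ^+ 2 = 0 by ring.
rewrite sqrtr0 addr0 (_ : (m + r - m) / r = 1) ?atan1; last by field; lra.
by field.
Qed.

Lemma asn_left m r : 0 < r -> asn m r (m - r) = - (pi / 2).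
Proof.
move=> r0; rewrite /asn /chi.
have -> : r ^+ 2 - (m - r - m) ^+ 2 = 0 by ring.
rewrite sqrtr0 addr0 (_ : (m - r - m) / r = - 1) ?atanN ?atan1; last by field; lra.
by field.
Qed.

Lemma chi_right m r : chi m r (m + r) = 0.
Proof. by rewrite /chi (_ : _ - _ = 0) ?sqrtr0//; ring. Qed.
Lemma chi_left m r : chi m r (m - r) = 0.
Proof. by rewrite /chi (_ : _ - _ = 0) ?sqrtr0//; ring. Qed.

Lemma dlnabs (x : R) : x != 0 -> is_derive x 1 (fun y => ln `|y|) x^-1.
Proof.
move=> x0; have [xp|xn] := ltP 0 x.
  apply: (near_eq_is_derive _ (is_derive1_ln xp)).
  near=> y; rewrite gtr0_norm//.
  by near: y; exact: lt_nbhsr.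
have {x0 xn}xn : x < 0 by rewrite lt_neqAle x0.
apply: (@near_eq_is_derive _ _ _ (fun y => ln (- y))).
  near=> y; rewrite ltr0_norm//.
  by near: y; exact: lt_nbhsl.
by dstart; [der; lra|rewrite mulrN1 invrN opprK].
Unshelve. all: by end_near. Qed.

Definition ell (t : R) := t * ln `|t|.

(** Near [0], [|t ln |t||] is at most [2 sqrt |t| + t^2], by [ln u < u] at
    [|t|] and at [1 / sqrt |t|]. *)
Lemma cell (x : R) : {for x, continuous ell}.
Proof.
have [->|x0] := eqVneq x 0; last first.
  by rewrite /ell; cont; rewrite normr_gt0.
rewrite /prop_for /continuous_at {2}/ell mul0r.

pose B (t : R) := 2 * Num.sqrt `|t| + t ^+ 2.
have bd (t : R) : `|t * ln `|t| | <= B t.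
  rewrite normrM /B -(real_normK (num_real t)); have := normr_ge0 t.
  move: `|t| => a; rewrite le_eqVlt => /orP[/eqP <-|a0].
    by rewrite mul0r sqrtr0 mulr0 expr0n/= addr0.
  have s0 : 0 < Num.sqrt a by rewrite sqrtr_gt0.
  have sa : Num.sqrt a ^+ 2 = a by rewrite sqr_sqrtr// ltW.
  have h1 := ln_sublinear a0.
  have : 0 < (Num.sqrt a)^-1 by rewrite invr_gt0.
  move/ln_sublinear; rewrite lnV ?posrE// => h2.
  have h3 : ln a = 2 * ln (Num.sqrt a).
    by rewrite -{1}sa lnXn// mulr2n; ring.
  have h4 : (Num.sqrt a)^-1 * a = Num.sqrt a.
    by rewrite -{2}sa expr2 mulKf ?gt_eqF.
  have [l0|l0] := leP 0 (ln a).
    rewrite ger0_norm//; nra.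
  rewrite ltr0_norm//.
  have : - ln a * a <= 2 * (Num.sqrt a)^-1 * a by apply: ler_wpM2r; lra.
  nra.
have cB : {for 0, continuous B} by rewrite /B; cont.
have B0 : B 0 = 0 by rewrite /B normr0 sqrtr0 expr0n/=; ring.
rewrite /prop_for /continuous_at B0 in cB.
apply: (@squeeze_cvgr _ _ _ _ (fun t => - B t) B).
- by near=> t; have := bd t; rewrite ler_norml.
- have := cvgN cB; rewrite oppr0; apply.
- exact: cB.
Unshelve. all: by end_near. Qed.

Definition num m r y x := r ^+ 2 - (x - m) * (y - m) + chi m r x * chi m r y.
(** Up to the factor [pi], the Green function of the half-Laplacian on
    [m - r, m + r]; it is the antiderivative of [chi x / ((x - y) chi y)]
    that vanishes at both endpoints. *)
Definition Lg m r y x := ln (num m r y x) - ln r - ln `|y - x|.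

Lemma num_gt0 m r y x : m - r < x < m + r -> m - r <= y <= m + r -> 0 < num m r y x.
Proof.
move=> hx hy; rewrite ltr_pwDl ?mulr_ge0 ?chi_ge0//.
have h1 : 0 <= (m + r - x) * (y - m + r) by apply: mulr_ge0; lra.
have h2 : 0 <= (x - m + r) * (m + r - y) by apply: mulr_ge0; lra.
have [v0|v0] := leP m y.
  have : 0 < (m + r - x) * (y - m + r) by apply: mulr_gt0; lra.
  lra.
have : 0 < (x - m + r) * (m + r - y) by apply: mulr_gt0; lra.
lra.
Qed.

Lemma LgC m r y x : Lg m r y x = Lg m r x y.
Proof. by rewrite /Lg distrC /num mulrC [chi _ _ _ * _]mulrC. Qed.

Lemma Lg_right m r x : m - r < x < m + r -> Lg m r (m + r) x = 0.
Proof.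
move=> h; rewrite /Lg /num chi_right mulr0 addr0 gtr0_norm; last lra.
have -> : r ^+ 2 - (x - m) * (m + r - m) = r * (m + r - x) by ring.
rewrite lnM ?posrE; lra.
Qed.

Lemma Lg_left m r x : m - r < x < m + r -> Lg m r (m - r) x = 0.
Proof.
move=> h; rewrite /Lg /num chi_left mulr0 addr0 ltr0_norm; last lra.
have -> : r ^+ 2 - (x - m) * (m - r - m) = r * (x - m + r) by ring.
rewrite lnM ?posrE; try lra.
by rewrite (_ : - (m - r - x) = x - m + r); [lra|ring].
Qed.

Lemma cLg m r y x : m - r < x < m + r -> m - r <= y <= m + r -> y != x ->
  {for y, continuous (fun y => Lg m r y x)}.
Proof.
move=> hx hy yx; rewrite /Lg /num; cont => //.
- exact: num_gt0.
- by rewrite normr_gt0 subr_eq0.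
Qed.

Lemma dLg m r y x : m - r < x < m + r -> m - r < y < m + r -> y != x ->
  is_derive y 1 (fun y => Lg m r y x) (chi m r x / ((x - y) * chi m r y)).
Proof.
move=> hx hy yx.
have n0 : 0 < num m r y x by apply: num_gt0 => //; lra.
have cy := dchi _ _ _ hy.
have dl : is_derive y 1 (fun y => ln `|y - x|) ((y - x)^-1 * 1).
  have d1 : is_derive y 1 (fun y => y - x) 1.
    by have := dadd _ _ _ _ _ (did y) (dcst (- x) y); rewrite addr0.
  have d0 : is_derive (y - x) 1 (fun y => ln `|y|) (y - x)^-1.
    by apply: dlnabs; rewrite subr_eq0.
  exact: (@dcomp R (fun z => ln `|z|) (fun z => z - x) y _ _ d0 d1).
dstart; first by rewrite /Lg /num; der.
have cx2 : chi m r x ^+ 2 = r ^+ 2 - (x - m) ^+ 2 by apply: chi_sqr; lra.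
have cy2 : chi m r y ^+ 2 = r ^+ 2 - (y - m) ^+ 2 by apply: chi_sqr; lra.
have cy0 := chi_gt0 _ _ _ hy.
move: n0; rewrite -/(num m r y x) {}/num; move: (chi m r x) (chi m r y) cx2 cy2 cy0 => c d c2 d2 d0 n0.
rewrite /GRing.scale/=.
have xy0 : x - y != 0 by rewrite subr_eq0 eq_sym.
have yx0 : y - x != 0 by rewrite subr_eq0.
set N := _ + c * d in n0 *.
have key : (- (x - m) * d - c * (y - m)) * (y - x) = N * (d - c).
  have e1 : (r ^+ 2 - (y - m) ^+ 2) * c = d ^+ 2 * c by rewrite d2.
  have e2 : (r ^+ 2 - (x - m) ^+ 2) * d = c ^+ 2 * d by rewrite c2.
  rewrite /N; lra.
have -> : 0 - ((x - m) * (1 + 0) + (y - m) * 0) + (c * (- (y - m) / d) + d * 0)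
   = N * (d - c) / (d * (y - x)).
  by rewrite -key; field; rewrite yx0 gt_eqF.
by field; rewrite xy0 yx0 !gt_eqF.
Qed.

Ltac cont_atom ::= first [refine (cchi _ _ _)|refine (casn _ _ _ _)|refine (cLg _ _ _ _ _ _ _)].
Local Notation mu := (@lebesgue_measure R).

(** The value of the integral of [wker m r x] over [u < y < m + r]; see
    [inner_wker]. *)
Definition wker_tail m r u x := - (x - m) / chi m r x * (pi / 2 - asn m r u) + Lg m r u x.

(** The weight of the double integral divided by the distance [|y - x|], the
    form in which it meets the Cauchy-Schwarz bound of the increment. *)
Definition wker m r x y := (r ^+ 2 - (x - m) * (y - m)) / (`|y - x| * (chi m r x * chi m r y)).

Lemma num0_gt0 m r x y : m - r < x < m + r -> m - r < y < m + r ->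
  0 < r ^+ 2 - (x - m) * (y - m).
Proof.
move=> hx hy.
have h1 : 0 < (m + r - x) * (y - m + r) by apply: mulr_gt0; lra.
have h2 : 0 < (x - m + r) * (m + r - y) by apply: mulr_gt0; lra.
lra.
Qed.

Lemma wker_ge0 m r x y : m - r < x < m + r -> m - r < y < m + r -> 0 <= wker m r x y.
Proof.
move=> hx hy; rewrite /wker divr_ge0//; first exact/ltW/num0_gt0.
by rewrite !mulr_ge0// chi_ge0.
Qed.

Lemma inner_wker m r u x : 0 < r -> m - r < u < m + r -> m - r < x < u ->
  (\int[mu]_(y in `]u, (m + r)%R[) (wker m r x y)%:E = (wker_tail m r u x)%:E)%E.
Proof.
move=> r0 hu hx.
have hx' : m - r < x < m + r by lra.
pose F (y : R) : R := - (x - m) / chi m r x * asn m r y - Lg m r y x.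
have cx0 := chi_gt0 _ _ _ hx'.
have cF y : u <= y <= m + r -> {for y, continuous F}.
  move=> hy; rewrite /F; cont.
  - lra.
  - by rewrite gt_eqF//; lra.
have -> : wker_tail m r u x = F (m + r) - F u.
  by rewrite /F asn_right// Lg_right// /wker_tail; ring.
apply: (ge0_FTC2_open _ (wker m r x) F u (m + r) (F u) (F (m + r))).
- lra.
- by move=> y hy; apply: wker_ge0; lra.
- move=> y hy; rewrite /wker; cont.
  have cy0 : 0 < chi m r y by apply: chi_gt0; lra.
  by rewrite !mulf_neq0 ?gt_eqF// normr_gt0 subr_eq0 gt_eqF//; lra.
- move=> y hy; have hy' : m - r < y < m + r by lra.
  have yx : y != x by rewrite gt_eqF//; lra.
  have d1 := dasn _ _ _ r0 hy'.
  have d2 := dLg _ _ _ _ hx' hy' yx.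
  have cy0 := chi_gt0 _ _ _ hy'.
  dstart; first by rewrite /F; der.
  have cx2 : chi m r x ^+ 2 = r ^+ 2 - (x - m) ^+ 2 by apply: chi_sqr; lra.
  rewrite /wker gtr0_norm; last lra.
  rewrite /GRing.scale/= mulr0 addr0.
  have -> : r ^+ 2 = chi m r x ^+ 2 + (x - m) ^+ 2 by lra.
  have yx' : y - x != 0 by rewrite subr_eq0.
  have xy' : x - y != 0 by rewrite subr_eq0 eq_sym.
  by field; apply/and4P; split => //; rewrite gt_eqF.
- by apply: cvg_at_right_filter; apply: cF; lra.
- by apply: cvg_at_left_filter; apply: cF; lra.
Qed.

Lemma wker_tail_ge0 m r u x : 0 < r -> m - r < u < m + r -> m - r < x < u ->
  0 <= wker_tail m r u x.
Proof.
move=> r0 hu hx; rewrite -lee_fin -(inner_wker _ _ _ _ r0 hu hx).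
apply: integral_ge0 => y /=; rewrite in_itv/= lee_fin => hy.
by apply: wker_ge0; lra.
Qed.

(** The antiderivative [G] comes from integrating [wker_tail] by parts, [Lg]
    being symmetric; only the term [chi u * asn] contributes, which gives
    [pi chi u]. *)
Lemma outer_wker m r u : 0 < r -> m - r < u < m + r ->
  (\int[mu]_(x in `](m - r)%R, u[) (wker_tail m r u x)%:E = (pi * chi m r u)%R%:E)%E.
Proof.
move=> r0 hu; pose G (x : R) : R := chi m r x * (pi / 2 - asn m r u)
  + ((x - u) * (ln (num m r x u) - ln r) - ell (x - u)) + chi m r u * asn m r x.
have cu0 := chi_gt0 _ _ _ hu.
have GE : G = fun x => chi m r x * (pi / 2 - asn m r u)
    + (x - u) * Lg m r x u + chi m r u * asn m r x.
  by apply/funext => x; rewrite /G /ell /Lg; ring.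
have cG x : m - r <= x <= u -> {for x, continuous G}.
  move=> hx.
  have cl : {for x, continuous (fun x => ell (x - u))}.
    by apply: (ccomp ell); [exact: cell|cont].
  have cn : {for x, continuous (fun x => num m r x u)} by rewrite /num; cont.
  have n0 : 0 < num m r x u by apply: num_gt0 => //; lra.
  by rewrite /G; cont.
have -> : pi * chi m r u = G u - G (m - r).
  rewrite {2}GE chi_left asn_left// (Lg_left _ _ _ hu).
  by rewrite /G /ell subrr mul0r; field.
apply: (ge0_FTC2_open _ (wker_tail m r u) G (m - r) u (G (m - r)) (G u)).
- lra.
- by move=> x hx; exact: wker_tail_ge0.
- move=> x hx; rewrite /wker_tail.
  have cL : {for x, continuous (Lg m r u)}.
    have -> : Lg m r u = (fun x => Lg m r x u) by apply/funext => z; rewrite LgC.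
    by apply: cLg; [lra|lra|rewrite lt_eqF//; lra].
  have cx0 : 0 < chi m r x by apply: chi_gt0; lra.
  by cont; rewrite gt_eqF.
- move=> x hx; rewrite GE.
  have hx' : m - r < x < m + r by lra.
  have xu : x != u by rewrite lt_eqF//; lra.
  have d1 := dasn _ _ _ r0 hx'.
  have d2 := dLg _ _ _ _ hu hx' xu.
  have d3 := dchi _ _ _ hx'.
  have cx0 := chi_gt0 _ _ _ hx'.
  dstart; first by der.
  rewrite /wker_tail [Lg _ _ _ x]LgC /GRing.scale/=.
  have xu' : x - u != 0 by rewrite subr_eq0.
  have ux' : u - x != 0 by rewrite subr_eq0 eq_sym.
  by field; rewrite ux' gt_eqF.
- by apply: cvg_at_right_filter; apply: cG; lra.
- by apply: cvg_at_left_filter; apply: cG; lra.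
Qed.
End semicircle_cont.

(** * Monotonicity, measurability and increments *)

Import HBNNSimple.
(** The integral of a nonnegative function is a supremum over the simple
    functions below it, so monotonicity needs no measurability. *)
Lemma ge0_le_integral_pointwise d (T : measurableType d) (R : realType)
    (mu : {measure set T -> \bar R}) (D : set T) (f1 f2 : T -> \bar R) :
  (forall x, D x -> 0 <= f1 x)%E -> (forall x, D x -> f1 x <= f2 x)%E ->
  (\int[mu]_(x in D) f1 x <= \int[mu]_(x in D) f2 x)%E.
Proof.
move=> f0 f12.
have f20 x : D x -> (0 <= f2 x)%E by move=> Dx; rewrite (le_trans (f0 _ Dx))// f12.
rewrite integral_mkcond [leRHS]integral_mkcond.
have g0 x : (0 <= (f1 \_ D) x)%E by apply: erestrict_ge0.
have g20 x : (0 <= (f2 \_ D) x)%E by apply: erestrict_ge0.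
rewrite !ge0_integralTE//.
apply: ereal_sup_le => _ [h /= hf <-]; exists h => //= x.
rewrite (le_trans (hf x))// /patch; case: ifPn => // /set_mem; exact: f12.
Qed.

(** Measurability is that of the power with exponent [-1], which also has the
    value [0] at [0]. *)
Lemma invr_ge0_measurable d (T : measurableType d) (R : realType) (f : T -> R) :
  measurable_fun setT f -> (forall x, 0 <= f x) ->
  measurable_fun setT (fun x => (f x)^-1).
Proof.
move=> mf f0; rewrite (_ : (fun x => _) = (fun x => f x `^ (-1))).
  exact: (measurableT_comp (measurable_powR _)).
by apply/funext => x; rewrite powR_inv1.
Qed.

(** Instead of a quotient of norms: for the slope [l] of the chord,
    [2 l f - l^2 <= f^2] pointwise, and the left-hand side integrates to
    [(phi y - phi x)^2 / (y - x)]. *)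
Lemma cauchy_schwarz_increment (R : realType) (phi f : R -> R) (x y : R) :
  x < y -> (forall z : R, is_derive z 1 phi (f z)) -> continuous f ->
  (((phi y - phi x) ^+ 2)%:E <= (y - x)%:E * \int[lebesgue_measure]_(u in `[x, y]) (f u ^+ 2)%:E)%E.
Proof.
move=> xy df cf.
pose l : R := (phi y - phi x) / (y - x).
pose G (u : R) : R := 2 * l * phi u - l ^+ 2 * u.
have cphi : continuous phi.
  move=> z; apply: differentiable_continuous; apply/derivable1_diffP.
  by have [] := df z.
have dG (z : R) : is_derive z 1 G (2 * l * f z - l ^+ 2).
  have dz := df z.
  dstart; [rewrite /G; der|].
  by rewrite /=; ring.
have iG : (\int[lebesgue_measure]_(u in `[x, y]) (2 * l * f u - l ^+ 2)%:E = (G y)%:E - (G x)%:E)%E.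
  apply: continuous_FTC2 => //.
  - apply: continuous_subspaceT => z.
    have cfz : {for z, continuous f} := cf z.
    have : {for z, continuous (fun u => 2 * l * f u - l ^+ 2)} by cont.
    by [].
  - have cG z : {for z, continuous G}.
      by have cz : {for z, continuous phi} := cphi z; rewrite /G; cont.
    split => [z _||]; [by case: (dG z)|apply: cvg_at_right_filter; exact: cG|apply: cvg_at_left_filter; exact: cG].
  - move=> z _; rewrite derive1E.
    by have [_ ->] := dG z.
have lE : (phi y - phi x) ^+ 2 = (y - x) * (G y - G x).
  by rewrite /G /l; field; rewrite subr_eq0 gt_eqF.
rewrite lE EFinM lee_pmul2l ?lte_fin ?subr_gt0// EFinB -iG.
have int (g : R -> R) : continuous g -> lebesgue_measure.-integrable `[x, y] (EFin \o g).
  move=> cg; apply: continuous_compact_integrable; first exact: segment_compact.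
  exact: continuous_subspaceT.
apply: le_integral => //.
- apply: (int (fun u => 2 * l * f u - l ^+ 2)) => z.
  have cfz : {for z, continuous f} := cf z.
  have : {for z, continuous (fun u => 2 * l * f u - l ^+ 2)} by cont.
  by [].
- apply: (int (fun u => f u ^+ 2)) => z.
  have cfz : {for z, continuous f} := cf z.
  have : {for z, continuous (fun u => f u ^+ 2)} by cont.
  by [].
- by move=> u _; rewrite lee_fin; have := sqr_ge0 (f u - l); lra.
Qed.

(** * Upper bound of the double integral *)

Section wker_tonelli.
Context {R : realType}.
Implicit Types m r x y u : R.
Local Notation leb := (@lebesgue_measure R).

(** The indicator of [x < u < y] turns the inner integral of [phi'^2] over
    [[x, y]] into one over the whole line, so that Tonelli applies. *)
Definition wker_straddle m r u x y : R :=
  if [&& m - r < x, x < u, u < y & y < m + r] then wker m r x y else 0.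

Lemma wker_straddle_ge0 m r u x y : 0 <= wker_straddle m r u x y.
Proof. by rewrite /wker_straddle; case: ifP => // /and4P[? ? ? ?]; apply: wker_ge0; lra. Qed.

Lemma measurable_chi d (T : measurableType d) m r (f : T -> R) :
  measurable_fun setT f -> measurable_fun setT (fun t => chi m r (f t)).
Proof.
move=> mf; apply: (measurableT_comp (f := chi m r)) => //.
by apply: continuous_measurable_fun => x; exact: cchi.
Qed.

Lemma measurable_wker_straddle d (T : measurableType d) m r (f g h : T -> R) :
  measurable_fun setT f -> measurable_fun setT g -> measurable_fun setT h ->
  measurable_fun setT (fun t => wker_straddle m r (f t) (g t) (h t)).
Proof.
move=> mf mg mh; rewrite /wker_straddle; apply: measurable_fun_ifT => //.
  by apply: measurable_and; [|apply: measurable_and; [|apply: measurable_and]];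
    apply: measurable_fun_ltr.
rewrite /wker; apply: measurable_funM.
  apply: measurable_funB => //.
  by apply: measurable_funM; apply: measurable_funB.
apply: invr_ge0_measurable; last first.
  by move=> t; rewrite !mulr_ge0// chi_ge0.
apply: measurable_funM.
  by apply: measurableT_comp => //; apply: measurable_funB.
by apply: measurable_funM; apply: measurable_chi.
Qed.

Lemma integral_wker_straddle m r u x : 0 < r -> m - r < u < m + r ->
  (\int[leb]_y (wker_straddle m r u x y)%:E
    = ((fun x => (wker_tail m r u x)%:E) \_ `](m - r)%R, u[) x)%E.
Proof.
move=> r0 hu; rewrite patchE; case: ifPn => [/set_mem/=|/negP hx].
  rewrite in_itv/= => hx; rewrite -(inner_wker _ _ _ _ r0 hu hx).
  rewrite [RHS]integral_mkcond; apply: eq_integral => y _.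
  rewrite patchE /wker_straddle; case/andP: hx => -> -> /=.
  case: ifPn => [/andP[h1 h2]|/negP h].
    by rewrite mem_set//= in_itv/= h1.
  by rewrite memNset//= in_itv/= => /andP[h1 h2]; apply: h; rewrite h1.
apply: integral0_eq => y _; rewrite /wker_straddle; case: ifPn => // /and4P[h1 h2 _ _].
by exfalso; apply: hx; rewrite mem_set//= in_itv/= h1.
Qed.

Lemma integral2_wker_straddle m r u : 0 < r -> m - r < u < m + r ->
  (\int[leb]_x \int[leb]_y (wker_straddle m r u x y)%:E = (pi * chi m r u)%R%:E)%E.
Proof.
move=> r0 hu; rewrite -outer_wker// [RHS]integral_mkcond.
by apply: eq_integral => x _; exact: integral_wker_straddle.
Qed.

Lemma wker_straddle_out m r u x y : ~~ (m - r < u < m + r) -> wker_straddle m r u x y = 0.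
Proof.
rewrite /wker_straddle => hu; case: ifPn => // /and4P[h1 h2 h3 h4].
by move: hu; rewrite (lt_trans h1)//= (lt_trans h3).
Qed.

(** Symmetrized in [x] and [y], so that one function serves both orders of
    the two points. *)
Definition majorant m r (f : R -> R) (y u x : R) : R :=
  f u ^+ 2 * (wker_straddle m r u x y + wker_straddle m r u y x).

Lemma majorant_ge0 m r f y u x : 0 <= majorant m r f y u x.
Proof. by rewrite mulr_ge0 ?sqr_ge0// addr_ge0 ?wker_straddle_ge0. Qed.

Lemma measurable_majorant d (T : measurableType d) m r (k : R -> R) (f g h : T -> R) :
  measurable_fun setT k ->
  measurable_fun setT f -> measurable_fun setT g -> measurable_fun setT h ->
  measurable_fun setT (fun t => majorant m r k (f t) (g t) (h t)).
Proof.
move=> mk mf mg mh; apply: measurable_funM.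
  by apply: measurable_funX; exact: measurableT_comp.
by apply: measurable_funD; apply: measurable_wker_straddle.
Qed.

Lemma integral_majorant m r (f : R -> R) u : 0 < r -> measurable_fun setT f ->
  (\int[leb]_y \int[leb]_x (majorant m r f y u x)%:E =
   ((fun u => (2 * pi * (f u ^+ 2 * chi m r u))%R%:E) \_ `](m - r)%R, (m + r)%R[) u)%E.
Proof.
move=> r0 mf; rewrite patchE; case: ifPn => [/set_mem/=|/negP hu]; last first.
  apply: integral0_eq => y _; apply: integral0_eq => x _.
  have hu' : ~~ (m - r < u < m + r).
    by apply/negP => h; apply: hu; rewrite mem_set//= in_itv.
  by rewrite /majorant !wker_straddle_out// addr0 mulr0.
rewrite in_itv/= => hu.
have mker (y : R) : measurable_fun [set: measurableTypeR R] (fun x : R => (wker_straddle m r u x y)%:E).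
  by apply/measurable_EFinP; apply: measurable_wker_straddle.
have mker' (y : R) : measurable_fun [set: measurableTypeR R] (fun x : R => (wker_straddle m r u y x)%:E).
  by apply/measurable_EFinP; apply: measurable_wker_straddle.
have k0 (x y : R) : (0 <= (wker_straddle m r u x y)%:E)%E by rewrite lee_fin wker_straddle_ge0.
pose k2 (p : measurableTypeR R * measurableTypeR R) : \bar R := (wker_straddle m r u p.1 p.2)%:E.
have mk2 : measurable_fun setT k2.
  by apply/measurable_EFinP; apply: measurable_wker_straddle.
have k20 p : (0 <= k2 p)%E by exact: k0.
have inner (y : R) : (\int[leb]_x (majorant m r f y u x)%:E = (f u ^+ 2)%:E
    * (\int[leb]_x (wker_straddle m r u x y)%:E + \int[leb]_x (wker_straddle m r u y x)%:E))%E.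
  rewrite -ge0_integralD// -ge0_integralZl//.
  - by apply: emeasurable_funD.
  - by move=> x _; rewrite adde_ge0.
  - by rewrite lee_fin sqr_ge0.
under eq_integral do rewrite inner.
have mA : measurable_fun [set: measurableTypeR R] (fun y : R => \int[leb]_x (wker_straddle m r u x y)%:E)%E.
  exact: (measurable_fun_fubini_tonelli_G k2).
have mB : measurable_fun [set: measurableTypeR R] (fun y : R => \int[leb]_x (wker_straddle m r u y x)%:E)%E.
  exact: (measurable_fun_fubini_tonelli_F k2).
rewrite ge0_integralZl//; last 3 first.
- by apply: emeasurable_funD.
- by move=> x _; rewrite adde_ge0// integral_ge0.
- by rewrite lee_fin sqr_ge0.
rewrite ge0_integralD//; last 2 first.
- by move=> x _; rewrite integral_ge0.
- by move=> x _; rewrite integral_ge0.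
rewrite integral2_wker_straddle//.
have -> : (\int[leb]_y \int[leb]_x (wker_straddle m r u x y)%:E = (pi * chi m r u)%R%:E)%E.
  by rewrite -(integral2_wker_straddle m r u r0 hu) -(fubini_tonelli k2).
by rewrite -EFinD -EFinM; congr (_%:E); ring.
Qed.
End wker_tonelli.

Section double_integral_upper.
Context {R : realType}.
Implicit Types m r x y u : R.
Local Notation leb := (@lebesgue_measure R).

Lemma poincare_integrandE m r (phi : R -> R) x y :
  poincare_integrand (m - r) (m + r) phi x y =
  ((phi x - phi y) / (x - y)) ^+ 2 *
  ((r ^+ 2 - (x - m) * (y - m)) / (chi m r x * chi m r y)).
Proof.
rewrite /poincare_integrand /chi; congr (_ * _).
have E (z : R) : (z - (m - r)) * (m + r - z) = r ^+ 2 - (z - m) ^+ 2 by ring.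
rewrite !E.
rewrite (_ : - 2 * _ * _ + _ - _ = 2 * (r ^+ 2 - (x - m) * (y - m))); last ring.
have half (p q : R) : 2 * p / (2 * q) = p / q.
  by rewrite -mulf_div divff ?mul1r// pnatr_eq0.
by rewrite -[2 * Num.sqrt _ * _]mulrA half.
Qed.

Lemma poincare_integrandC m r (phi : R -> R) x y :
  poincare_integrand (m - r) (m + r) phi x y =
  poincare_integrand (m - r) (m + r) phi y x.
Proof.
rewrite !poincare_integrandE [(y - m) * _]mulrC [chi m r y * _]mulrC; congr (_ * _).
by rewrite -[phi y - _]opprB -[y - x]opprB invrN mulrNN.
Qed.

Lemma majorantC m r (f : R -> R) x y u : majorant m r f y u x = majorant m r f x u y.
Proof. by rewrite /majorant addrC. Qed.

(** Division by zero returns [0], so the integrand vanishes on the boundary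
    of the square. *)
Lemma poincare_integrand_edge m r (phi : R -> R) x y :
  m - r <= x <= m + r -> ~~ (m - r < x < m + r) ->
  poincare_integrand (m - r) (m + r) phi x y = 0.
Proof.
move=> hx hx'; rewrite poincare_integrandE.
suff -> : chi m r x = 0 by rewrite mul0r invr0 !mulr0.
have /orP[/eqP->|/eqP->] : (x == m - r) || (x == m + r).
  by rewrite !eq_le; case/andP: hx => -> ->; rewrite andbT /=; move: hx'; rewrite negb_and -!leNgt.
- exact: chi_left.
- exact: chi_right.
Qed.

Lemma poincare_integrand_ge0 m r (phi : R -> R) x y :
  m - r <= x <= m + r -> m - r <= y <= m + r ->
  0 <= poincare_integrand (m - r) (m + r) phi x y.
Proof.
move=> hx hy.
have [hx'|/(poincare_integrand_edge _ _ phi _ y hx)-> //] := boolP (m - r < x < m + r).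
have [hy'|] := boolP (m - r < y < m + r); last first.
  by move/(poincare_integrand_edge _ _ phi _ x hy); rewrite poincare_integrandC => ->.
rewrite poincare_integrandE mulr_ge0 ?sqr_ge0// divr_ge0//.
  exact/ltW/num0_gt0.
by rewrite mulr_ge0// chi_ge0.
Qed.

Lemma poincare_point_lt m r (phi f : R -> R) x y :
  (forall z : R, is_derive z 1 phi (f z)) -> continuous f ->
  x < y -> m - r < x < m + r -> m - r < y < m + r ->
  ((poincare_integrand (m - r) (m + r) phi x y)%:E <= \int[leb]_u (majorant m r f y u x)%:E)%E.
Proof.
move=> df cf xy hx hy.
have mf : measurable_fun [set: R] f by exact: continuous_measurable_fun.
have mf2 D : measurable D -> measurable_fun D (fun u : R => (f u ^+ 2)%:E).
  move=> mD; apply: (@measurable_funS _ _ _ _ setT) => //.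
  by apply/measurable_EFinP; exact: measurable_funX.
have w0 : 0 <= wker m r x y by exact: wker_ge0.
have -> : (\int[leb]_u (majorant m r f y u x)%:E = (wker m r x y)%:E *
    \int[leb]_(u in `[x, y]) (f u ^+ 2)%:E)%E.
  rewrite integral_itv_bndoo; last exact: mf2.
  rewrite -ge0_integralZl//; last 2 first.
  - exact: mf2.
  - by move=> u _; rewrite lee_fin sqr_ge0.
  rewrite [RHS]integral_mkcond; apply: eq_integral => u _.
  rewrite patchE /majorant; case: ifPn => [/set_mem/=|/negP hu].
    rewrite in_itv/= => /andP[xu uy].
    have -> : wker_straddle m r u y x = 0.
      by rewrite /wker_straddle; case: ifPn => // /and4P[_ yu _ _]; lra.
    rewrite /wker_straddle xu uy; case/andP: hx => -> _; case/andP: hy => _ -> /=.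
    by rewrite addr0 mulrC EFinM.
  have -> : wker_straddle m r u y x = 0.
    by rewrite /wker_straddle; case: ifPn => // /and4P[_ yu ux _]; lra.
  have -> : wker_straddle m r u x y = 0.
    rewrite /wker_straddle; case: ifPn => // /and4P[_ xu uy _]; exfalso; apply: hu.
    by rewrite mem_set//= in_itv/= xu.
  by rewrite addr0 mulr0.
have cs := cauchy_schwarz_increment _ _ _ _ _ xy df cf.
have cx := chi_gt0 _ _ _ hx; have cy := chi_gt0 _ _ _ hy.
have yx0 : y - x != 0 by rewrite subr_eq0 gt_eqF.
have -> : poincare_integrand (m - r) (m + r) phi x y =
    (wker m r x y / (y - x)) * (phi y - phi x) ^+ 2.
  rewrite poincare_integrandE /wker gtr0_norm ?subr_gt0//.
  have xy0 : x - y != 0 by rewrite subr_eq0 lt_eqF.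
  by field; rewrite yx0 xy0 !gt_eqF.
rewrite EFinM; apply: (@le_trans _ _ ((wker m r x y / (y - x))%:E *
    ((y - x)%:E * \int[leb]_(u in `[x, y]) (f u ^+ 2)%:E))%E).
  by apply: lee_wpmul2l => //; rewrite lee_fin divr_ge0// ltW// subr_gt0.
by rewrite muleA -EFinM divfK.
Qed.

Lemma poincare_point m r (phi f : R -> R) x y :
  (forall z : R, is_derive z 1 phi (f z)) -> continuous f ->
  m - r <= x <= m + r -> m - r <= y <= m + r ->
  ((poincare_integrand (m - r) (m + r) phi x y)%:E <= \int[leb]_u (majorant m r f y u x)%:E)%E.
Proof.
move=> df cf hx hy.
have F0 z w : (0 <= \int[leb]_u (majorant m r f z u w)%:E)%E.
  by apply: integral_ge0 => u _; rewrite lee_fin majorant_ge0.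
have [hx'|/(poincare_integrand_edge _ _ phi _ y hx)-> //] := boolP (m - r < x < m + r).
have [hy'|] := boolP (m - r < y < m + r); last first.
  by move/(poincare_integrand_edge _ _ phi _ x hy); rewrite poincare_integrandC => ->.
have [xy|yx|<-] := ltgtP x y; first exact: poincare_point_lt.
  rewrite poincare_integrandC; under eq_integral do rewrite majorantC.
  exact: poincare_point_lt.
by rewrite poincare_integrandE subrr mul0r expr0n/= mul0r.
Qed.

(** Pointwise majorization of the integrand by an integral in [u], then
    Tonelli brings the integral in [u] outside, where [integral_majorant]
    evaluates the weight of [f u ^2]. *)
Lemma poincare_upper m r (phi f : R -> R) : 0 < r ->
  (forall z : R, is_derive z 1 phi (f z)) -> continuous f ->
  (\int[leb]_(y in `[(m - r)%R, (m + r)%R]) \int[leb]_(x in `[(m - r)%R, (m + r)%R])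
     (poincare_integrand (m - r) (m + r) phi x y)%:E
  <= \int[leb]_(u in `](m - r)%R, (m + r)%R[) (2 * pi * (f u ^+ 2 * chi m r u))%R%:E)%E.
Proof.
move=> r0 df cf.
have mf : measurable_fun [set: R] f by exact: continuous_measurable_fun.
apply: (@le_trans _ _ (\int[leb]_y \int[leb]_x \int[leb]_u (majorant m r f y u x)%:E)%E).
  rewrite integral_mkcond; apply: ge0_le_integral_pointwise => y _.
    apply: erestrict_ge0 => {}y/=; rewrite in_itv/= => hy.
    apply: integral_ge0 => x /=; rewrite in_itv/= => hx.
    by rewrite lee_fin poincare_integrand_ge0.
  rewrite patchE; case: ifPn => [/set_mem/=|_]; last first.
    do 2 (apply: integral_ge0 => ? _).
    by rewrite lee_fin majorant_ge0.
  rewrite in_itv/= => hy.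
  rewrite integral_mkcond; apply: ge0_le_integral_pointwise => x _.
    apply: erestrict_ge0 => {}x/=; rewrite in_itv/= => hx.
    by rewrite lee_fin poincare_integrand_ge0.
  rewrite patchE; case: ifPn => [/set_mem/=|_]; last first.
    by apply: integral_ge0 => ? _; rewrite lee_fin majorant_ge0.
  by rewrite in_itv/= => hx; exact: poincare_point.
have s1 (y : R) : (\int[leb]_x \int[leb]_u (majorant m r f y u x)%:E
   = \int[leb]_u \int[leb]_x (majorant m r f y u x)%:E)%E.
  apply: (fubini_tonelli (fun p : measurableTypeR R * measurableTypeR R =>
    (majorant m r f y p.2 p.1)%:E)) => [|p]; last by rewrite lee_fin majorant_ge0.
  by apply/measurable_EFinP; apply: measurable_majorant.
under eq_integral do rewrite s1.
pose H (p : measurableTypeR R * measurableTypeR R) : \bar R :=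
  (\int[leb]_x (majorant m r f p.1 p.2 x)%:E)%E.
have mH : measurable_fun setT H.
  apply: (measurable_fun_fubini_tonelli_F (fun q : (measurableTypeR R * measurableTypeR R) * measurableTypeR R =>
    (majorant m r f q.1.1 q.1.2 q.2)%:E)) => [|q]; last by rewrite lee_fin majorant_ge0.
  apply/measurable_EFinP; apply: measurable_majorant => //.
  - exact: (measurableT_comp measurable_fst measurable_fst).
  - exact: (measurableT_comp measurable_snd measurable_fst).
have H0 p : (0 <= H p)%E by apply: integral_ge0 => x _; rewrite lee_fin majorant_ge0.
rewrite (fubini_tonelli H)// [leRHS]integral_mkcond.
rewrite le_eqVlt; apply/orP; left; apply/eqP; apply: eq_integral => u _.
exact: integral_majorant.
Qed.
End double_integral_upper.

(** * Probability measures with prescribed integrals *)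

Section measure_tools.
Local Open Scope ereal_scope.
Context d (T : measurableType d) (R : realType).

Lemma integral_mrestr (mu : {measure set T -> \bar R}) (D : set T) (mD : measurable D) (f : T -> \bar R) :
  measurable_fun setT f -> (forall x, 0 <= f x) ->
  \int[mrestr mu mD]_x f x = \int[mu]_(x in D) f x.
Proof.
move=> mf f0.
have mC : measurable (~` D) by exact: measurableC.
have mfD E : measurable E -> measurable_fun E f.
  by move=> mE; apply: (@measurable_funS _ _ _ _ setT).
rewrite -(setUv D) ge0_integral_setU//; last 2 first.
- exact/mfD/measurableU.
- by rewrite disj_set2E setICr eqxx.
have N0 : mrestr mu mD (~` D) = 0 by rewrite /mrestr setICl measure0.
rewrite [X in _ + X](_ : _ = 0) ?adde0; last first.
  apply/eqP; rewrite eq_le integral_ge0// andbT.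
  have : \int[mrestr mu mD]_(x in ~` D) f x <= \int[mrestr mu mD]_(x in ~` D) (cst +oo x).
    apply: ge0_le_integral => //; first exact: mfD.
    by move=> x _; rewrite /= leey.
  by rewrite integral_cst// [X in _ * X]N0 mule0.
apply: eq_measure_integral => A mA AD. by rewrite /= /mrestr setIidl.
Qed.

(** Probability measures are used only through their integrals of nonnegative
    functions; the existential statement keeps the structures built in the
    proof out of sight. *)
Lemma normalized_restr (mu : {measure set T -> \bar R}) (P : probability T R) (D : set T) :
  measurable D -> 0 < mu D -> mu D < +oo ->
  exists kappa : probability T R, forall f : T -> \bar R,
    measurable_fun setT f -> (forall x, 0 <= f x) ->
    \int[kappa]_x f x = (fine (mu D))^-1%:E * \int[mu]_(x in D) f x.
Proof.
move=> mD D0 Doo.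
have q0 : (0 < fine (mu D))%R by rewrite fine_gt0// D0.
have qi : (0 <= (fine (mu D))^-1)%R by rewrite invr_ge0 ltW.
exists (mnormalize (mrestr mu mD) P) => f mf f0.
rewrite -integral_mrestr// -[X in X%:E * _]/((NngNum qi)%:num).
rewrite -ge0_integral_mscale//; apply: eq_measure_integral => A mA _.
rewrite /= /mnormalize /= /mrestr setTI gt_eqF//= lt_eqF//=.
by rewrite /mscale/= muleC.
Qed.

Lemma convex_comb (mu kappa : probability T R) (t : R) : (0 <= t <= 1)%R ->
  exists nu : probability T R, forall f : T -> \bar R,
    measurable_fun setT f -> (forall x, 0 <= f x) ->
    \int[nu]_x f x = (1 - t)%:E * \int[mu]_x f x + t%:E * \int[kappa]_x f x.
Proof.
move=> /andP[t0 t1].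
have t1' : (0 <= 1 - t)%R by rewrite subr_ge0.
pose m := measure_add (mscale (NngNum t1') mu) (mscale (NngNum t0) kappa).
exists (mnormalize m mu) => f mf f0.
rewrite -[X in X%:E * _ + _]/((NngNum t1')%:num) -[X in _ + X%:E * _]/((NngNum t0)%:num).
rewrite -!ge0_integral_mscale// -ge0_integral_measure_add//.
apply: eq_measure_integral => A mA _.
have m1 : m setT = 1.
  rewrite /m measure_addE /= /mscale /=. rewrite !probability_setT !mule1 -EFinD.
  by rewrite subrK.
rewrite /= /mnormalize.
set v := (X in (X == 0) || _).
have -> : v = 1 by exact: m1.
rewrite onee_eq0/=; have := m1; rewrite /m /measure_add /= => ->.
by rewrite /= invr1 mule1.
Qed.

(** Also for a [g] of infinite integral, where both sides are [-oo]; this is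
    the case of measures of infinite energy. *)
Lemma integral_cstB (P : probability T R) (c : R) (g : T -> \bar R) :
  measurable_fun setT g -> (forall x, 0 <= g x) ->
  \int[P]_x (c%:E - g x) = c%:E - \int[P]_x g x.
Proof.
move=> mg g0.
have Pc (k : R) : P.-integrable setT (cst k%:E) by exact: finite_measure_integrable_cst.
have Ic (k : R) : \int[P]_x (cst k%:E x) = k%:E.
  by rewrite integral_cst// [X in _ * X]probability_setT mule1.
have [oo|] := ltP (\int[P]_x g x) +oo.
  have ig : P.-integrable setT g.
    apply/integrableP; split => //.
    by under eq_integral do rewrite gee0_abs//.
  rewrite integralB//; last exact: Pc.
  by congr (_ - _); exact: Ic.
rewrite leye_eq => /eqP ig; rewrite ig /= integralE.
have mf : measurable_fun setT (fun x => c%:E - g x).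
  by apply: emeasurable_funB.
have p1 : \int[P]_x (fun x => c%:E - g x)^\+ x <= `|c|%:E.
  rewrite -(Ic `|c|%R); apply: ge0_le_integral => //.
    exact: measurable_funepos.
  move=> x _; rewrite funeposE ge_max; apply/andP; split; last by rewrite lee_fin.
  rewrite (@le_trans _ _ c%:E)//; last by rewrite lee_fin ler_norm.
  by have := g0 x; case: (g x) => [s| |]//=; rewrite -?EFinB ?lee_fin ?leNye//; lra.
have p2 : \int[P]_x (fun x => c%:E - g x)^\- x = +oo.
  apply/eqP; rewrite -leye_eq.
  have : \int[P]_x g x <= \int[P]_x ((fun x => c%:E - g x)^\- x + cst `|c|%:E x).
    apply: ge0_le_integral => //.
      apply: emeasurable_funD => //; exact: measurable_funeneg.
    move=> x _ /=; rewrite funenegE.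
    apply: (@le_trans _ _ (- (c%:E - g x) + `|c|%:E)).
      have := g0 x; case: (g x) => [r| |] //= _; rewrite ?leey// ?lee_fin.
      by have := ler_norm c; lra.
    by apply: leeD => //; rewrite le_max lexx.
  have mneg : measurable_fun setT (fun x => c%:E - g x)^\- by exact: measurable_funeneg.
  rewrite ig ge0_integralD//=.
  have aux (I : \bar R) (r : R) : +oo <= I + r%:E -> +oo <= I by case: I.
  by rewrite (Ic `|c|%R); exact: aux.
have aux (I : \bar R) (r : R) : I <= r%:E -> I - +oo = c%:E - +oo by case: I.
by rewrite p2; exact: aux p1.
Qed.

End measure_tools.

(** * The logarithmic kernel and the energy *)

Section logkernel.
Context {R : realType}.
Local Notation leb := (@lebesgue_measure R).
Implicit Types (x y t M A B : R).

(** The kernel [- ln |t|] made nonnegative by adding [M] and truncating. For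
    measures on an interval of length at most [exp M] the truncation changes
    nothing, and all integrals become integrals of nonnegative functions, to
    which Tonelli applies without conditions. *)
Definition logker M t : \bar R := if t == 0 then +oo%E else (Num.max 0 (M - ln `|t|))%:E.

Lemma logker_ge0 M t : (0 <= logker M t)%E.
Proof. by rewrite /logker; case: ifP => // _; rewrite lee_fin le_max lexx. Qed.

Lemma logkerN M t : logker M (- t) = logker M t.
Proof. by rewrite /logker oppr_eq0 normrN. Qed.

Lemma measurable_logker M : measurable_fun [set: R] (logker M).
Proof.
apply: measurable_fun_ifT => //.
  by apply: measurable_fun_eqr.
apply/measurable_EFinP; apply: measurable_maxr => //.
apply: measurable_funB => //.
by apply: measurableT_comp => //; exact: measurable_ln.
Qed.

Lemma measurable_logker2 d (T : measurableType d) M (f g : T -> R) :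
  measurable_fun setT f -> measurable_fun setT g ->
  measurable_fun setT (fun p => logker M (f p - g p)).
Proof.
move=> mf mg; apply: (measurableT_comp (measurable_logker M)).
exact: measurable_funB.
Qed.

Lemma dell (t : R) : t != 0 -> is_derive t 1 ell (ln `|t| + 1).
Proof.
move=> t0; have d1 := dlnabs t t0.
by dstart; [rewrite /ell; der|rewrite /=; field].
Qed.

Lemma measurable_lnabsB M (D : set R) : measurable_fun D (fun t : R => (M - ln `|t|)%:E).
Proof.
apply: measurable_funTS; apply/measurable_EFinP; apply: measurable_funB => //.
by apply: measurableT_comp => //; exact: measurable_ln.
Qed.

Lemma integral_logker_lty M : (\int[leb]_t logker M t < +oo)%E.
Proof.
wlog M0 : M / 0 <= M => [W|].
  have [|M0] := leP 0 M; first exact: W.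
  apply: le_lt_trans (W 0 (lexx _)); apply: ge0_le_integral_pointwise => t _; first exact: logker_ge0.
  rewrite /logker; case: ifP => // _; rewrite lee_fin ge_max !le_max lexx /=.
  by rewrite lerD2r (ltW M0) orbT.
pose e := expR M; have e0 : 0 < e by exact: expR_gt0.
have E : (\int[leb]_t logker M t = \int[leb]_(t in `](- e)%R, e[) (M - ln `|t|)%:E)%E.
  rewrite [RHS]integral_mkcond.
  have Z : leb.-negligible [set 0 : R].
    exists [set 0]; split => //; exact: lebesgue_measure_set1.
  apply: ae_eq_integral => //.
  - exact: measurable_logker.
  - have mN : measurable (`](- e), e[%classic : set R) by exact: measurable_itv.
    by apply/(measurable_restrictT _ mN); exact: measurable_lnabsB.
  - apply: negligibleS Z => t /=; apply: contra_notP => /eqP t0 _.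
    have te : (t \in `](- e), e[%classic) = (ln `|t| < M).
      by rewrite mem_setE in_itv/= -ltr_norml -[RHS]ltr_expR lnK ?posrE ?normr_gt0.
    rewrite patchE /logker (negbTE t0) te; case: ltP => h; congr (_%:E).
      by apply/max_idPr; rewrite subr_ge0 ltW.
    by apply/max_idPl; rewrite subr_le0.
pose F (t : R) : R := (M + 1) * t - ell t.
have -> : (\int[leb]_t logker M t = (F e - F (- e))%:E)%E; last exact: ltry.
rewrite E; apply: (ge0_FTC2_except R [:: 0] (fun t => M - ln `|t|) F).
- lra.
- by apply: measurable_funB => //; apply: measurableT_comp => //; exact: measurable_ln.
- move=> t; rewrite -ltr_norml => te; rewrite subr_ge0.
  have [->|t0] := eqVneq t 0; first by rewrite normr0 ln0.
  by rewrite -ler_expR lnK ?posrE ?normr_gt0// ltW.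
- by move=> t _; have ct := cell t; rewrite /F; cont.
- by move=> t _; rewrite inE => t0; cont; rewrite normr_gt0.
- move=> t _; rewrite inE => t0; have dt := dell t t0.
  by dstart; [rewrite /F; der|rewrite /=; ring].
Qed.

Lemma integral_logker_shift M y : (\int[leb]_x logker M (x - y) = \int[leb]_t logker M t)%E.
Proof. by apply: (integral_shift R (logker M) (- y)); [exact: measurable_logker|exact: logker_ge0]. Qed.

End logkernel.

Section energy.
Context {R : realType}.
Variables (V : R -> R) (A B M v0 : R).

(** On [[A, B]] the field is made nonnegative by a bound [v0] of its absolute
    value. *)
Definition shifted_field (x : R) : R := if (A <= x <= B) then V x + v0 else 0.

(** On measures carried by [[A, B]], the energy is a sum of two integrals of
    nonnegative functions, up to a constant; the value [+oo] is included. *)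
Lemma energy_logker (nu : probability (measurableTypeR R) R) :
  A < B -> ln (B - A) <= M -> measurable_fun [set: R] V ->
  (forall x, A <= x <= B -> `|V x| <= v0) -> nu (~` `[A, B]%classic) = 0 ->
  energy V nu = ((\int[nu]_x (shifted_field x)%:E + \int[nu]_x \int[nu]_y logker M (x - y))
    - (v0 + M)%:E)%E.
Proof.
move=> AB hM mV Vb nuC.
have v00 : 0 <= v0 by rewrite (le_trans _ (Vb A _))//; lra.
have mAB : measurable (`[A, B]%classic : set (measurableTypeR R)) by exact: measurable_itv.
have mCAB : measurable (~` `[A, B]%classic : set (measurableTypeR R)) by exact: measurableC.
have mVp : measurable_fun [set: measurableTypeR R] shifted_field.
  apply: measurable_fun_ifT => //.
    by apply: measurable_and; apply: measurable_fun_ler.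
  exact: measurable_funD.
have iVp : nu.-integrable setT (EFin \o shifted_field).
  apply: measurable_bounded_integrable => //.
    by rewrite (le_lt_trans (probability_le1 _ _))// ltry.
  exists (v0 + v0); split; first exact: num_real.
  move=> z hz x _; rewrite /= /shifted_field; case: (boolP (A <= x <= B)) => [hx|_]; last by rewrite normr0; lra.
  have h1 := Vb _ hx; have := ler_normD (V x) v0; rewrite (ger0_norm v00); lra.
have E1 : (\int[nu]_x (V x)%:E = \int[nu]_x (shifted_field x)%:E - v0%:E)%E.
  transitivity (\int[nu]_x ((shifted_field x)%:E - (cst v0 x)%:E))%E.
    apply: ae_eq_integral => //.
    - exact/measurable_EFinP.
    - apply: emeasurable_funB; exact/measurable_EFinP.
    - exists (~` `[A, B]%classic); split => // x /= H; apply: contra_not H.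
      rewrite /shifted_field /= in_itv/= => -> _ /=.
      by rewrite -EFinB addrK.
  rewrite integralB//; last exact: finite_measure_integrable_cst.
  have Ic : (\int[nu]_x (cst v0%:E x) = v0%:E)%E.
    by rewrite integral_cst// [X in (_ * X)%E]probability_setT mule1.
  by congr (_ - _)%E; exact: Ic.
pose g2 (p : measurableTypeR R * measurableTypeR R) : \bar R := logker M (p.1 - p.2).
have mg2 : measurable_fun setT g2 by exact: measurable_logker2.
have g20 p : (0 <= g2 p)%E by exact: logker_ge0.
have E2 : (\int[nu \x nu]_z lne (`|z.1 - z.2|)%:E = M%:E - \int[nu]_x \int[nu]_y logker M (x - y))%E.
  transitivity (\int[nu \x nu]_z (M%:E - g2 z))%E.
    have lneE (t : R) : lne (`|t|)%:E = if t == 0 then -oo%E else (ln `|t|)%:E.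
      case: eqVneq => [->|t0]; first by rewrite normr0 le0_lneNy.
      by rewrite lne_EFin// normr_gt0.
    apply: ae_eq_integral => //.
    - under eq_fun do rewrite lneE.
      apply: measurable_fun_ifT => //.
        by apply: measurable_fun_eqr => //; exact: measurable_funB.
      apply/measurable_EFinP; apply: measurableT_comp; first exact: measurable_ln.
      by apply: measurableT_comp => //; exact: measurable_funB.
    - by apply: emeasurable_funB.
    - pose N : set (measurableTypeR R * measurableTypeR R) :=
        ((~` `[A, B]%classic) `*` setT) `|` (setT `*` (~` `[A, B]%classic)).
      have mN1 : measurable ((~` `[A, B]%classic) `*` [set: measurableTypeR R] : set (measurableTypeR R * measurableTypeR R)).
        exact: measurableX.
      have mN2 : measurable ([set: measurableTypeR R] `*` (~` `[A, B]%classic) : set (measurableTypeR R * measurableTypeR R)).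
        exact: measurableX.
      exists N; split.
      + exact: measurableU.
      + apply/eqP; rewrite eq_le measure_ge0 andbT.
        rewrite (le_trans (measureU2 _ mN1 mN2))//.
        have n1 : (nu \x nu)%E ((~` `[A, B]%classic) `*` [set: measurableTypeR R]) = 0%E.
          by rewrite product_measure1E// [X in (X * _)%E]nuC mul0e.
        have n2 : (nu \x nu)%E ([set: measurableTypeR R] `*` (~` `[A, B]%classic)) = 0%E.
          by rewrite product_measure1E// [X in (_ * X)%E]nuC mule0.
        by rewrite [X in (X + _)%E]n1 [X in (_ + X)%E]n2 adde0.
      + move=> [x y] /= H; apply: contra_notP H => hN _ /=.
        have [hx hy] : A <= x <= B /\ A <= y <= B.
          split; apply/negP => /negP h; apply: hN.
            by left; split => //=; rewrite in_itv/=; apply/negP.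
          by right; split => //=; rewrite in_itv/=; apply/negP.
        rewrite normr_le0 subr_eq0 /g2 /logker /= subr_eq0; case: eqVneq => // xy.
        rewrite -EFinB; congr (_%:E).
        have : ln `|x - y| <= M.
          rewrite (le_trans _ hM)// ler_ln ?posrE ?normr_gt0 ?subr_eq0 ?subr_gt0//.
          by rewrite ler_norml; lra.
        by move=> h; rewrite (max_idPr _) ?subr_ge0//; ring.
  by rewrite integral_cstB// (fubini_tonelli1 g2).
rewrite /energy E1 E2.
have : (\int[nu]_x (shifted_field x)%:E)%E \is a fin_num by exact: integrable_fin_num.
case: (\int[nu]_x (shifted_field x)%:E)%E => // v _.
have : (0 <= \int[nu]_x \int[nu]_y logker M (x - y))%E.
  by apply: integral_ge0 => x _; apply: integral_ge0 => y _; exact: logker_ge0.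
case: (\int[nu]_x _)%E => [i| |] // _.
by rewrite /= /dual_adde /= ; congr (_%:E); ring.
Qed.
End energy.

(** * Euler-Lagrange conditions *)

Section variation.
Context {R : realType}.
Local Notation prob := (probability (measurableTypeR R) R).
Variables (V : R -> R) (A B M v0 : R).

(** For [mu] on an interval of length at most [exp M], the potential for the
    kernel [- ln |x - y|], plus [M]. *)
Definition pot (mu : prob) (x : R) : \bar R := (\int[mu]_y logker M (x - y))%E.
Definition total_energy (mu : prob) : \bar R := (\int[mu]_x (shifted_field V A B v0 x)%:E + \int[mu]_x pot mu x)%E.
(** Up to a constant, the derivative of [total_energy] at [mu] in the
    direction of the Dirac mass at [x]. *)
Definition effpot (mu : prob) (x : R) : \bar R := ((shifted_field V A B v0 x)%:E + 2%:E * pot mu x)%E.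

Lemma pot_ge0 (mu : prob) x : (0 <= pot mu x)%E.
Proof. by apply: integral_ge0 => y _; exact: logker_ge0. Qed.

Lemma measurable_pot (mu : prob) : measurable_fun [set: measurableTypeR R] (pot mu).
Proof.
apply: (measurable_fun_fubini_tonelli_F (fun p : measurableTypeR R * measurableTypeR R => logker M (p.1 - p.2))).
- exact: measurable_logker2.
- by move=> p; exact: logker_ge0.
Qed.

Lemma pot_sym (mu kappa : prob) : (\int[kappa]_x pot mu x = \int[mu]_x pot kappa x)%E.
Proof.
rewrite /pot (fubini_tonelli (fun p : measurableTypeR R * measurableTypeR R => logker M (p.1 - p.2))).
- by apply: eq_integral => y _; apply: eq_integral => x _ /=; rewrite -logkerN opprB.
- exact: measurable_logker2.
- by move=> p; exact: logker_ge0.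
Qed.

Hypotheses (AB : A < B) (hM : ln (B - A) <= M) (mV : measurable_fun [set: R] V).
Hypothesis (Vb : forall x, A <= x <= B -> `|V x| <= v0).

Lemma v0_ge0 : 0 <= v0.
Proof. by rewrite (le_trans _ (Vb A _)) ?lexx ?(ltW AB). Qed.

Lemma shifted_field_ge0 x : 0 <= shifted_field V A B v0 x.
Proof.
rewrite /shifted_field; case: (boolP (A <= x <= B)) => // /Vb.
by rewrite ler_norml => /andP[h _]; rewrite -lerBlDr sub0r.
Qed.

Lemma shifted_field_le x : shifted_field V A B v0 x <= v0 + v0.
Proof.
have v00 := v0_ge0.
rewrite /shifted_field; case: (boolP (A <= x <= B)) => [/Vb|_]; last exact: addr_ge0.
by rewrite ler_norml => /andP[_ h]; rewrite lerD2r.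
Qed.

Lemma measurable_shifted_field : measurable_fun [set: measurableTypeR R] (shifted_field V A B v0).
Proof.
apply: measurable_fun_ifT => //.
  by apply: measurable_and; apply: measurable_fun_ler.
exact: measurable_funD.
Qed.

Lemma measurable_effpot (mu : prob) : measurable_fun [set: measurableTypeR R] (effpot mu).
Proof.
apply: emeasurable_funD; first (by apply/measurable_EFinP; exact: measurable_shifted_field).
by apply: emeasurable_funM => //; exact: measurable_pot.
Qed.

Lemma effpot_ge0 (mu : prob) x : (0 <= effpot mu x)%E.
Proof. by rewrite adde_ge0 ?lee_fin ?shifted_field_ge0// mule_ge0// pot_ge0. Qed.

Lemma integral_effpot (mu kappa : prob) :
  (\int[kappa]_x effpot mu x = \int[kappa]_x (shifted_field V A B v0 x)%:E + 2%:E * \int[kappa]_x pot mu x)%E.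
Proof.
rewrite ge0_integralD//; last 4 first.
- by move=> x _; rewrite lee_fin shifted_field_ge0.
- by apply/measurable_EFinP; exact: measurable_shifted_field.
- by move=> x _; rewrite mule_ge0// pot_ge0.
- by apply: emeasurable_funM => //; exact: measurable_pot.
rewrite ge0_integralZl//; first exact: measurable_pot.
by move=> x _; exact: pot_ge0.
Qed.

Lemma integral_shifted_field_fin (mu : prob) : (\int[mu]_x (shifted_field V A B v0 x)%:E)%E \is a fin_num.
Proof.
rewrite ge0_fin_numE; last by apply: integral_ge0 => x _; rewrite lee_fin shifted_field_ge0.
apply: (@le_lt_trans _ _ (\int[mu]_x (cst (v0 + v0)%:E x))%E).
  apply: ge0_le_integral => //.
  - by move=> x _; rewrite lee_fin shifted_field_ge0.
  - by apply/measurable_EFinP; exact: measurable_shifted_field.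
  - by move=> x _; rewrite lee_fin shifted_field_le.
by rewrite integral_cst// [X in (_ * X)%E]probability_setT mule1 ltry.
Qed.

Lemma minimizer_total_energy (mu nu : prob) : energy_minimizer V mu ->
  mu (~` `[A, B]%classic) = 0%E -> nu (~` `[A, B]%classic) = 0%E ->
  (total_energy mu <= total_energy nu)%E.
Proof.
move=> + mu0 nu0 => /(_ nu).
rewrite (energy_logker V A B M v0 mu)// (energy_logker V A B M v0 nu)//.
by rewrite leeD2rE.
Qed.

Lemma prob_indic (mu : prob) (S : set R) : measurable (S : set (measurableTypeR R)) ->
  (mu S = \int[mu]_x (\1_S x)%:E)%E.
Proof. by move=> mS; rewrite integral_indic// setIT. Qed.

(** The first-order condition at [t = 0] of a one-sided minimum. *)
Lemma linear_coef_ge0 (L Q : R) : (forall t, 0 < t <= 1 -> 0 <= t * L + t ^+ 2 * Q) -> 0 <= L.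
Proof.
move=> h; rewrite leNgt; apply/negP => L0.
(* at [t = - L / q] the quadratic term is smaller than the linear one *)
pose q := `|Q| + - L + 1.
have q0 : 0 < q by rewrite /q; have := normr_ge0 Q; lra.
pose t := - L / q.
have t0 : 0 < t by rewrite divr_gt0// oppr_gt0.
have tq : t * q = - L by rewrite /t divfK// gt_eqF.
have t1 : t <= 1 by rewrite /t ler_pdivrMr// mul1r /q; have := normr_ge0 Q; lra.
have := h t; rewrite t0 t1 => /(_ isT).
have h2 : t * Q < - L.
  rewrite -tq ltr_pM2l// /q; have := ler_norm Q; lra.
suff : t * (L + t * Q) < 0 by lra.
by rewrite pmulr_rlt0//; lra.
Qed.

(** Along [(1 - t) mu + t kappa] the total energy is a quadratic polynomial
    in [t] that is minimal at [t = 0]. *)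
Lemma first_variation (mu kappa : prob) : energy_minimizer V mu ->
  mu (~` `[A, B]%classic) = 0%E -> kappa (~` `[A, B]%classic) = 0%E ->
  (total_energy mu < +oo)%E -> (\int[kappa]_x pot kappa x < +oo)%E ->
  (\int[mu]_x effpot mu x <= \int[kappa]_x effpot mu x)%E.
Proof.
move=> hmin mu0 ka0 Jmu kk.
have mCAB : measurable (~` `[A, B]%classic : set (measurableTypeR R)).
  by apply: measurableC; exact: measurable_itv.
rewrite !integral_effpot.
have int0 (m n : prob) : (0 <= \int[m]_x pot n x)%E.
  by apply: integral_ge0 => x _; exact: pot_ge0.
have fv := integral_shifted_field_fin mu; have fw := integral_shifted_field_fin kappa.
have [kmu|] := ltP (\int[kappa]_x pot mu x)%E +oo%E; last first.
  rewrite leye_eq => /eqP ->.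
  rewrite -(fineK fw) gt0_muley ?lte_fin// addey// leey//.
have mm : (\int[mu]_x pot mu x < +oo)%E.
  by apply: le_lt_trans Jmu; rewrite leeDr// integral_ge0// => x _; rewrite lee_fin shifted_field_ge0.
have fm : (\int[mu]_x pot mu x)%E \is a fin_num by rewrite ge0_fin_numE.
have fk : (\int[kappa]_x pot kappa x)%E \is a fin_num by rewrite ge0_fin_numE.
have fc : (\int[kappa]_x pot mu x)%E \is a fin_num by rewrite ge0_fin_numE.
have fc' : (\int[mu]_x pot kappa x)%E = (\int[kappa]_x pot mu x)%E by exact: (esym (pot_sym mu kappa)).
pose v := fine (\int[mu]_x (shifted_field V A B v0 x)%:E)%E.
pose w := fine (\int[kappa]_x (shifted_field V A B v0 x)%:E)%E.
pose i := fine (\int[mu]_x pot mu x)%E.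
pose k := fine (\int[kappa]_x pot kappa x)%E.
pose c := fine (\int[kappa]_x pot mu x)%E.
rewrite -(fineK fv) -(fineK fw) -(fineK fm) -(fineK fc) -/v -/w -/i -/c.
rewrite -!EFinM -!EFinD lee_fin -subr_ge0.
apply: (linear_coef_ge0 _ (i - 2 * c + k)) => t /andP[t0 t1].
have t01 : 0 <= t <= 1 by rewrite ltW.
have t1' : 0 <= 1 - t by lra.
have [nu nuE] := convex_comb _ _ _ mu kappa t t01.
have nu0 : nu (~` `[A, B]%classic) = 0%E.
  have mi : measurable_fun [set: measurableTypeR R] (fun x => (\1_(~` `[A, B]%classic) x : R)%:E).
    by apply/measurable_EFinP; exact: measurable_indic.
  rewrite prob_indic// nuE//.
  by rewrite -!prob_indic// [X in (_ * X + _)%E]mu0 [X in (_ + _ * X)%E]ka0 !mule0 adde0.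
have := minimizer_total_energy _ _ hmin mu0 nu0; rewrite /total_energy.
have mVp : measurable_fun [set: measurableTypeR R] (fun x => (shifted_field V A B v0 x)%:E).
  by apply/measurable_EFinP; exact: measurable_shifted_field.
rewrite nuE//; last by move=> x; rewrite lee_fin shifted_field_ge0.
have potE x : pot nu x = ((1 - t)%:E * pot mu x + t%:E * pot kappa x)%E.
  rewrite {1}/pot nuE//; last by move=> y; exact: logker_ge0.
  exact: measurable_logker2.
have mpot (m : prob) (r : R) : measurable_fun [set: measurableTypeR R] (fun x => r%:E * pot m x)%E.
  by apply: emeasurable_funM => //; exact: measurable_pot.
have pot0 (m : prob) (r : R) x : 0 <= r -> (0 <= r%:E * pot m x)%E.
  by move=> r0; rewrite mule_ge0// pot_ge0.
have intpot (n : prob) : (\int[n]_x ((1 - t)%:E * pot mu x + t%:E * pot kappa x) =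
    (1 - t)%:E * \int[n]_x pot mu x + t%:E * \int[n]_x pot kappa x)%E.
  rewrite ge0_integralD//; last 2 first.
  - by move=> x _; exact: pot0.
  - by move=> x _; apply: pot0; exact: ltW.
  have mp := measurable_pot.
  have p0 (m : prob) x : setT x -> (0 <= pot m x)%E by move=> _; exact: pot_ge0.
  have z1 := @ge0_integralZl _ _ _ n setT measurableT (pot mu) (mp mu) (1 - t)%:E (p0 mu) t1'.
  have z2 := @ge0_integralZl _ _ _ n setT measurableT (pot kappa) (mp kappa) t%:E (p0 kappa) (ltW t0).
  by rewrite z1 z2.
rewrite nuE; last 2 first.
- exact: measurable_pot.
- exact: pot_ge0.
have -> : pot nu = (fun x => (1 - t)%:E * pot mu x + t%:E * pot kappa x)%E.
  by apply/funext => x; exact: potE.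
rewrite !intpot fc' -(fineK fv) -(fineK fw) -(fineK fm) -(fineK fc) -(fineK fk).
rewrite -/v -/w -/i -/c -/k -?EFinM -?EFinD -?EFinM -?EFinD -?EFinM -?EFinD lee_fin.
by move=> h; lra.
Qed.

(** Fatou along a sequence; the kernel is continuous with values in
    [[0, +oo]]. *)
Lemma pot_lsc (mu : prob) (x0 d : R) : (d%:E < pot mu x0)%E ->
  exists2 e : R, 0 < e & forall x, `|x - x0| < e -> (d%:E < pot mu x)%E.
Proof.
move=> hd; apply: contrapT => hne.
have H n : exists x, `|x - x0| < (n.+1%:R^-1 : R) /\ (pot mu x <= d%:E)%E.
  apply: contrapT => hn; apply: hne; exists n.+1%:R^-1; first by rewrite invr_gt0.
  move=> x hx; rewrite ltNge; apply/negP => hx2; apply: hn; by exists x.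
have [u hu] := choice H.
have ucvg : u n @[n --> \oo] --> x0.
  apply/cvgrPdist_lt => e e0.
  have := @cvg_harmonic R; move/cvgrPdist_lt => /(_ e e0).
  apply: filterS => n; rewrite /harmonic/= sub0r normrN gtr0_norm ?invr_gt0// => h.
  by rewrite distrC; apply: lt_trans h; exact: (hu n).1.
have gcvg y : logker M (u n - y) @[n --> \oo] --> logker M (x0 - y).
  have vc : (u n - y) @[n --> \oo] --> x0 - y by apply: cvgB => //; exact: cvg_cst.
  rewrite {2}/logker; case: eqVneq => [x0y|x0y].
    apply/cvgeyPger => K _.
    pose eK := expR (M - K).
    have eK0 : 0 < eK by exact: expR_gt0.
    move/cvgrPdist_lt : vc => /(_ eK eK0).
    apply: filterS => n /=; rewrite x0y sub0r normrN /logker => h.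
    case: eqVneq => [_|t0]; first by rewrite leey.
    rewrite lee_fin le_max; apply/orP; right.
    have : ln `|u n - y| <= M - K.
      by rewrite -[leRHS](expRK (M - K)) ler_ln ?posrE ?normr_gt0// ltW.
    lra.
  pose g (t : R) : R := Num.max 0 (M - ln `|t|).
  have cg : {for x0 - y, continuous g}.
    have c1 : {for x0 - y, continuous (fun t : R => M - ln `|t|)} by cont; rewrite normr_gt0.
    have c0 : {for x0 - y, continuous (fun t : R => 0 : R)} by cont.
    by apply: continuous_max.
  have : (g (u n - y))%:E @[n --> \oo] --> (g (x0 - y))%:E.
    by apply: cvg_EFin; [exact: nearW|exact: continuous_cvg].
  apply: cvg_trans; apply: near_eq_cvg.
  have : 0 < `|x0 - y| by rewrite normr_gt0.
  move/cvgrPdist_lt : vc => /[apply].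
  apply: filterS => n h /=; rewrite /logker; case: eqVneq => // E.
  by move: h; rewrite E subr0 ltxx.
have : (pot mu x0 <= d%:E)%E.
  have -> : pot mu x0 = (\int[mu]_y limn_einf (fun n => logker M (u n - y)))%E.
    apply: eq_integral => y _; apply/esym.
    by rewrite is_cvg_limn_einfE; [exact: cvg_lim|exact: cvgP (gcvg y)].
  have mu_n n : measurable_fun [set: measurableTypeR R] (fun y : R => logker M (u n - y)).
    by apply: measurable_logker2.
  apply: (le_trans (fatou mu measurableT mu_n _)); first by move=> n y _; exact: logker_ge0.
  rewrite limn_einf_lim; apply: lime_le; first exact: is_cvg_einfs.
  apply: nearW => n; apply: (@le_trans _ _ (pot mu (u n))); last exact: (hu n).2.
  by apply: ereal_inf_lbound; exists n => //=.
by rewrite leNgt hd.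
Qed.
End variation.

Section conditions.
Context {R : realType}.
Local Notation leb := (@lebesgue_measure R).
Local Notation prob := (probability (measurableTypeR R) R).
Variables (V : R -> R) (A B M v0 : R).
Hypotheses (AB : A < B) (hM : ln (B - A) <= M) (cV : continuous V).
Hypothesis (Vb : forall x, A <= x <= B -> `|V x| <= v0).
Variable mu : prob.
Hypotheses (hmin : energy_minimizer V mu) (mu0 : mu (~` `[A, B]%classic) = 0%E).

Let mV : measurable_fun [set: R] V.
Proof. exact: continuous_measurable_fun. Qed.

Let mAB : measurable (`[A, B]%classic : set (measurableTypeR R)).
Proof. exact: measurable_itv. Qed.

Let mCAB : measurable (~` `[A, B]%classic : set (measurableTypeR R)).
Proof. exact: measurableC. Qed.

(** The competitor in the first variation; its potential is bounded because
    the kernel is integrable over the line. *)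
Lemma uniform_prob (S : set (measurableTypeR R)) : measurable S ->
  S `<=` `[A, B]%classic -> (0 < leb S)%E ->
  exists kappa : prob, [/\ forall f : R -> \bar R,
      measurable_fun [set: measurableTypeR R] f -> (forall x, 0 <= f x)%E ->
      (\int[kappa]_x f x = (fine (leb S))^-1%:E * \int[leb]_(x in S) f x)%E,
    kappa (~` `[A, B]%classic) = 0%E & (\int[kappa]_x pot M kappa x < +oo)%E].
Proof.
move=> mS SAB S0.
have Soo : (leb S < +oo)%E.
  apply: (@le_lt_trans _ _ (leb `[A, B]%classic)).
    by apply: le_measure => //; rewrite inE.
  by rewrite lebesgue_measure_itv/= lte_fin AB -EFinB ltry.
have [kappa kE] := normalized_restr _ _ _ leb mu S mS S0 Soo.
have q0 : 0 <= (fine (leb S))^-1 by rewrite invr_ge0 fine_ge0// ltW.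
have mi : measurable_fun [set: measurableTypeR R] (fun x => (\1_(~` `[A, B]%classic) x : R)%:E).
  by apply/measurable_EFinP; exact: measurable_indic.
exists kappa; split => //.
  rewrite prob_indic// kE// integral_indic//.
  rewrite (_ : _ `&` S = set0) ?measure0 ?mule0//.
  by rewrite setIC; apply/disjoints_subset; rewrite setCK.
have potk x : (pot M kappa x <= (fine (leb S))^-1%:E * \int[leb]_t logker M t)%E.
  rewrite /pot kE; last 2 first.
  - exact: measurable_logker2.
  - by move=> y; exact: logker_ge0.
  apply: lee_wpmul2l; first by rewrite lee_fin.
  rewrite -(integral_logker_shift M x); apply: (@le_trans _ _ (\int[leb]_y logker M (x - y))%E).
    apply: ge0_subset_integral => //; first exact: measurable_logker2.
    by move=> y _; exact: logker_ge0.
  rewrite le_eqVlt; apply/orP; left; apply/eqP; apply: eq_integral => y _.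
  by rewrite -logkerN opprB.
have gf := integral_logker_lty M.
have g0 : (0 <= \int[leb]_t logker M t)%E by apply: integral_ge0 => t _; exact: logker_ge0.
apply: (@le_lt_trans _ _ (\int[kappa]_x cst ((fine (leb S))^-1%:E * \int[leb]_t logker M t) x)%E).
  apply: ge0_le_integral_pointwise => x _; [exact: pot_ge0|exact: potk].
rewrite integral_cst// [X in (_ * X)%E]probability_setT mule1.
by apply: lte_mul_pinfty => //; rewrite lee_fin.
Qed.

Lemma total_energy_lty : (total_energy V A B M v0 mu < +oo)%E.
Proof.
have [|kappa [kE k0 kk]] := uniform_prob _ mAB (@subset_refl _ _).
  by rewrite lebesgue_measure_itv/= lte_fin AB -EFinB lte_fin subr_gt0.
apply: (@le_lt_trans _ _ (total_energy V A B M v0 kappa)).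
  exact: minimizer_total_energy.
have fv := integral_shifted_field_fin V A B v0 AB mV Vb kappa.
have : (0 <= \int[kappa]_x pot M kappa x)%E by apply: integral_ge0 => x _; exact: pot_ge0.
rewrite /total_energy -(fineK fv); move: kk; case: (\int[kappa]_x pot M kappa x)%E => //= r _ _.
by rewrite -EFinD ltry.
Qed.

Let effpot_mean := (\int[mu]_x effpot V A B M v0 mu x)%E.

Lemma effpot_mean_fin : effpot_mean \is a fin_num.
Proof.
rewrite ge0_fin_numE; last by apply: integral_ge0 => x _; apply: effpot_ge0.
have := total_energy_lty; rewrite /effpot_mean integral_effpot// /total_energy.
have fv := integral_shifted_field_fin V A B v0 AB mV Vb mu.
rewrite -(fineK fv).
have : (0 <= \int[mu]_x pot M mu x)%E by apply: integral_ge0 => x _; exact: pot_ge0.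
by case: (\int[mu]_x pot M mu x)%E => //= r _ _; rewrite -EFinM -EFinD ltry.
Qed.

(** Otherwise the uniform measure on a set where [effpot] is below its mean
    would contradict [first_variation]. *)
Lemma effpot_ge_ae : leb.-negligible [set x | A <= x <= B /\ (effpot V A B M v0 mu x < effpot_mean)%E].
Proof.
have mPhi := measurable_effpot V A B M v0 mV mu.
pose S (n : nat) : set (measurableTypeR R) := `[A, B]%classic `&`
  [set x | (effpot V A B M v0 mu x <= effpot_mean - (n.+1%:R^-1)%:E)%E].
have mS n : measurable (S n).
  by apply: emeasurable_fun_infty_c => //; exact: measurable_funTS.
have S0 n : leb (S n) = 0%E.
  apply/eqP; rewrite eq_le measure_ge0 andbT leNgt; apply/negP => Sn0.
  have [|kappa [kE k0 kk]] := uniform_prob _ (mS n) _ Sn0.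
    by move=> x [].
  have := first_variation V A B M v0 AB hM mV Vb mu kappa hmin mu0 k0 total_energy_lty kk.
  rewrite -/effpot_mean leNgt => /negP; apply.
  have i0 : 0 < n.+1%:R^-1 :> R by rewrite invr_gt0.
  apply: (@le_lt_trans _ _ (effpot_mean - (n.+1%:R^-1)%:E)%E); last first.
    by rewrite -(fineK effpot_mean_fin) -EFinB lte_fin ltrBlDr ltrDl.
  have Soo : (leb (S n) < +oo)%E.
    apply: (@le_lt_trans _ _ (leb `[A, B]%classic)).
      by apply: le_measure => //; rewrite ?inE// => x [].
    by rewrite lebesgue_measure_itv/= lte_fin AB -EFinB ltry.
  have fS : leb (S n) \is a fin_num by rewrite ge0_fin_numE// ltW.
  have fS0 : 0 < fine (leb (S n)) by rewrite fine_gt0// Sn0.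
  rewrite kE//; last by move=> x; apply: effpot_ge0.

  apply: (@le_trans _ _ ((fine (leb (S n)))^-1%:E *
      \int[leb]_(x in S n) (cst (fine effpot_mean - n.+1%:R^-1)%:E x))%E).
    apply: lee_wpmul2l; first by rewrite lee_fin invr_ge0 ltW.
    apply: ge0_le_integral_pointwise => x.
      by move=> _; exact: effpot_ge0.
    by move=> [_ /=]; rewrite EFinB (fineK effpot_mean_fin).
  rewrite integral_cst// muleCA.
  have -> : ((fine (leb (S n)))^-1%:E * leb (S n) = 1)%E.
    by rewrite -{2}(fineK fS) -EFinM mulVf// gt_eqF.
  by rewrite mule1 EFinB (fineK effpot_mean_fin).
have -> : [set x | A <= x <= B /\ (effpot V A B M v0 mu x < effpot_mean)%E] = \bigcup_n S n.
  apply/seteqP; split => x /=.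
    move=> [hx hP].
    have fP : effpot V A B M v0 mu x \is a fin_num.
      rewrite ge0_fin_numE; last exact: effpot_ge0.
      by apply: lt_le_trans hP _; rewrite leey.
    have d0 : 0 < fine effpot_mean - fine (effpot V A B M v0 mu x).
      by rewrite subr_gt0 -lte_fin (fineK effpot_mean_fin) (fineK fP).
    have := @cvg_harmonic R; move/cvgrPdist_lt => /(_ _ d0) [N _ /(_ N (leqnn N))].
    rewrite /harmonic/= sub0r normrN gtr0_norm ?invr_gt0// => hN.
    exists N => //; split => /=; first by rewrite in_itv.
    by rewrite -(fineK effpot_mean_fin) -(fineK fP) -EFinB lee_fin lerBrDr -lerBrDl; exact: ltW.
  move=> [n _ [/=]]; rewrite in_itv/= => hx hP; split => //.
  apply: le_lt_trans hP _; rewrite -(fineK effpot_mean_fin) -EFinB lte_fin.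
  by rewrite ltrBlDr ltrDl invr_gt0.
apply: negligible_bigcup => n. apply/(negligibleP _ (mS n)). exact: S0.
Qed.

Lemma effpot_lsc (x0 c : R) : A <= x0 <= B -> (c%:E < effpot V A B M v0 mu x0)%E ->
  exists2 e : R, 0 < e & forall x, `|x - x0| < e -> A <= x <= B ->
    (c%:E < effpot V A B M v0 mu x)%E.
Proof.
move=> hx0; rewrite /effpot {1}/shifted_field hx0 => hc.
have [eta eta0 hd] : exists2 eta : R, 0 < eta &
    (((c - (V x0 + v0) + eta) / 2)%:E < pot M mu x0)%E.
  have := pot_ge0 M mu x0; move: hc; case: (pot M mu x0) => [q| |] //.
    rewrite -EFinM -EFinD lte_fin => h _.
    by exists ((V x0 + v0 + 2 * q - c) / 2); [lra|rewrite lte_fin; lra].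
  by exists 1 => //; rewrite ltry.
have [e1 e10 h1] := pot_lsc M mu x0 _ hd.
have := cV x0; move/cvgrPdist_lt => /(_ eta eta0).
case/nbhs_ballP => e2 /= e20 h2.
exists (Num.min e1 e2); first by rewrite lt_min e10.
move=> x; rewrite lt_min => /andP[hx1 hx2] hx.
have p1 := h1 _ hx1.
have : `|V x0 - V x| < eta by apply: h2; rewrite /ball/= distrC.
rewrite /shifted_field hx ltr_norml => /andP[h3 h4].
move: p1; case: (pot M mu x) => [q| |] //.
  by rewrite !lte_fin => p1; lra.
by move=> _; rewrite gt0_muley ?lte_fin// addey// ltry.
Qed.

(** By lower semicontinuity, [effpot] would exceed its mean on a
    neighbourhood [O] of a bad point of the support; removing the mass of [O]
    and renormalizing would then contradict [first_variation]. *)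
Lemma effpot_le_support (x0 : R) : measure_support mu x0 -> A <= x0 <= B ->
  (effpot V A B M v0 mu x0 <= effpot_mean)%E.
Proof.
move=> sx0 hx0; rewrite leNgt; apply/negP => hC.
have mPhi := measurable_effpot V A B M v0 mV mu.
have P0 x : (0 <= effpot V A B M v0 mu x)%E by exact: effpot_ge0.
have [c' hc1 hc2] : exists2 c' : R, (effpot_mean < c'%:E)%E & (c'%:E < effpot V A B M v0 mu x0)%E.
  move: hC; rewrite -(fineK effpot_mean_fin); case: (effpot V A B M v0 mu x0) => [q| |] //.
    rewrite lte_fin => h; exists ((fine effpot_mean + q) / 2); rewrite lte_fin; lra.
  by exists (fine effpot_mean + 1); rewrite ?ltry// lte_fin; lra.
have [e e0 he] := effpot_lsc x0 c' hx0 hc2.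
pose O : set (measurableTypeR R) := ball x0 e.
have mO : measurable O by exact: measurable_ball.
have mCO : measurable (~` O) by exact: measurableC.
have O0 : (0 < mu O)%E by apply: sx0; [exact: ball_open|exact: ballxx].
have fO : mu O \is a fin_num by exact: fin_num_measure.
pose q := fine (mu O).
have q0 : 0 < q by rewrite /q fine_gt0// O0 -ge0_fin_numE.
have I1 : (c'%:E * mu O <= \int[mu]_(x in O) effpot V A B M v0 mu x)%E.
  rewrite -integral_cst//.
  have -> : (\int[mu]_(x in O) cst c'%:E x = \int[mu]_(x in O `&` `[A, B]) cst c'%:E x)%E.
    rewrite !integral_cst//; last exact: measurableI.
    congr (_ * _)%E; rewrite -[in LHS](setIT O) -(setUv `[A, B]%classic) setIUr.
    rewrite measureU//; last 3 first.
    - exact: measurableI.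
    - exact: measurableI.
    - by rewrite setIACA setICr setI0.
    rewrite [X in (_ + X)%E](_ : _ = 0%E) ?adde0//.
    apply/eqP; rewrite eq_le measure_ge0 andbT -mu0.
    by apply: le_measure; rewrite ?inE//; exact: measurableI.
  have c'0 : 0 <= c'.
    rewrite -lee_fin (le_trans _ (ltW hc1))//; apply: integral_ge0 => x _; exact: P0.
  apply: (@le_trans _ _ (\int[mu]_(x in O `&` `[A, B]) effpot V A B M v0 mu x)%E).
    apply: ge0_le_integral_pointwise => x; first by rewrite lee_fin.
    move=> [/= hx]; rewrite in_itv/= => hx'; apply: ltW; apply: he => //.
    by rewrite distrC.
  apply: ge0_subset_integral => //; first exact: measurableI.
  exact: measurable_funTS.
have I2 : (effpot_mean = \int[mu]_(x in O) effpot V A B M v0 mu x + \int[mu]_(x in ~` O) effpot V A B M v0 mu x)%E.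
  rewrite /effpot_mean -ge0_integral_setU//; last 2 first.
  - by rewrite setUv; exact: mPhi.
  - by rewrite disj_set2E setICr eqxx.
  by rewrite setUv.
have fI1 : (\int[mu]_(x in O) effpot V A B M v0 mu x)%E \is a fin_num.
  rewrite ge0_fin_numE ?integral_ge0//; apply: (@le_lt_trans _ _ effpot_mean).
    by rewrite I2 leeDl// integral_ge0.
  by rewrite -ge0_fin_numE ?effpot_mean_fin// integral_ge0.
have fI2 : (\int[mu]_(x in ~` O) effpot V A B M v0 mu x)%E \is a fin_num.
  rewrite ge0_fin_numE ?integral_ge0//; apply: (@le_lt_trans _ _ effpot_mean).
    by rewrite I2 leeDr// integral_ge0.
  by rewrite -ge0_fin_numE ?effpot_mean_fin// integral_ge0.
have D1 : (mu (~` O) = (1 - q)%:E)%E.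
  by rewrite probability_setC// -(fineK fO) -EFinB.
move: hc1 I1; rewrite -(fineK effpot_mean_fin) lte_fin -(fineK fI1) -(fineK fO) -/q -EFinM lee_fin.
move: I2; rewrite -(fineK effpot_mean_fin) -{1}(fineK fI1) -{1}(fineK fI2) -EFinD => -[].
set c := fine effpot_mean; set i1 := fine (\int[mu]_(x in O) _)%E; set i2 := fine (\int[mu]_(x in ~` O) _)%E.
move=> cE /= hc1 I1.
have i20 : 0 <= i2 by rewrite fine_ge0// integral_ge0.
have q1 : q <= 1 by rewrite -lee_fin /q (fineK fO) probability_le1.
have [q1'|q1'] := eqVneq q 1.
  by move: I1; rewrite q1' mulr1 => I1; lra.
have D0 : (0 < mu (~` O))%E by rewrite D1 lte_fin subr_gt0 lt_neqAle q1' q1.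
have Doo : (mu (~` O) < +oo)%E by rewrite D1 ltry.
have [kappa kE] := normalized_restr _ _ _ mu mu (~` O) mCO D0 Doo.
have r0 : 0 <= (fine (mu (~` O)))^-1 by rewrite invr_ge0 fine_ge0// ltW.
have k0 : kappa (~` `[A, B]%classic) = 0%E.
  have mi : measurable_fun [set: measurableTypeR R] (fun x => (\1_(~` `[A, B]%classic) x : R)%:E).
    by apply/measurable_EFinP; exact: measurable_indic.
  rewrite prob_indic// kE// integral_indic//.
  rewrite [X in (_ * X)%E](_ : _ = 0%E) ?mule0//.
  apply/eqP; rewrite eq_le measure_ge0 andbT -mu0.
  by apply: le_measure; rewrite ?inE//; exact: measurableI.
have le_kappa (f : R -> \bar R) : measurable_fun [set: measurableTypeR R] f ->
    (forall x, 0 <= f x)%E ->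
    (\int[kappa]_x f x <= (fine (mu (~` O)))^-1%:E * \int[mu]_x f x)%E.
  move=> mf f0; rewrite kE//; apply: lee_wpmul2l; first by rewrite lee_fin.
  by apply: ge0_subset_integral.
have mm : (\int[mu]_x pot M mu x < +oo)%E.
  apply: le_lt_trans total_energy_lty; rewrite /total_energy leeDr// integral_ge0// => x _.
  by rewrite lee_fin shifted_field_ge0.
have kk : (\int[kappa]_x pot M kappa x < +oo)%E.
  apply: (@le_lt_trans _ _ ((fine (mu (~` O)))^-1%:E * ((fine (mu (~` O)))^-1%:E * \int[mu]_x pot M mu x))%E); last first.
    do 2 (apply: lte_mul_pinfty; [by rewrite lee_fin|by []|]); exact: mm.
  apply: (@le_trans _ _ (\int[kappa]_x ((fine (mu (~` O)))^-1%:E * pot M mu x))%E).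
    apply: ge0_le_integral_pointwise => x _; first exact: pot_ge0.
    apply: le_kappa; first exact: measurable_logker2.
    by move=> y; exact: logker_ge0.
  rewrite ge0_integralZl//; last 2 first.
  - exact: measurable_pot.
  - by move=> x _; exact: pot_ge0.
  apply: lee_wpmul2l; first by rewrite lee_fin.
  by apply: le_kappa; [exact: measurable_pot|move=> x; exact: pot_ge0].
have := first_variation V A B M v0 AB hM mV Vb mu kappa hmin mu0 k0 total_energy_lty kk.
rewrite (kE _ mPhi P0) -/effpot_mean.
have -> : (fine (mu (~` O)))^-1 = (1 - q)^-1.
  by congr (_^-1); exact: (congr1 fine D1).
rewrite -(fineK effpot_mean_fin) -(fineK fI2) -EFinM lee_fin -/c -/i2.
have q1'' : 0 < 1 - q by rewrite subr_gt0 lt_neqAle q1' q1.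
rewrite ler_pdivlMl// => h.
have : q * (c' - c) <= 0 by lra.
by rewrite pmulr_rle0//; lra.
Qed.
End conditions.

(** * Second differences and antiderivatives of the logarithm *)

Section kernels.
Context {R : realType}.
Local Notation leb := (@lebesgue_measure R).
Implicit Types (d s t h x y c L M : R).

(** All smoothing is by second differences, so that convexity and the
    Euler-Lagrange conditions enter without differentiation. *)
Definition diff2 d (F : R -> R) (x : R) : R := F (x + d) + F (x - d) - 2 * F x.

Lemma measurable_diff2_quotient (F : R -> R) c : measurable_fun [set: R] F ->
  measurable_fun [set: R] (fun h => diff2 h F c / h ^+ 2).
Proof.
move=> mF; apply: measurable_funM; last first.
  by apply: invr_ge0_measurable => [|x]; [exact: measurable_funX|exact: sqr_ge0].
apply: measurable_funB => //; apply: measurable_funD; apply: (measurableT_comp mF).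
  exact: measurable_funD.
exact: measurable_funB.
Qed.

(** A second antiderivative of [ln |t|]. *)
Definition lnabs_int2 t : R := t / 2 * ell t - 3 / 4 * t ^+ 2.
(** A second antiderivative of [|t| / 2], so that two second differences of
    step [d] make it a cubic B-spline. *)
Definition cube t : R := `|t| ^+ 3 / 12.

Lemma clnabs_int2 t : {for t, continuous lnabs_int2}.
Proof. by have := cell t; rewrite /lnabs_int2 => ?; cont. Qed.

Lemma dlnabs_int2 t : t != 0 -> is_derive t 1 lnabs_int2 (ell t - t).
Proof.
move=> t0; have d1 := dell t t0.
dstart; first by rewrite /lnabs_int2; der.
by rewrite /ell/=; field.
Qed.

Lemma lnabs_int2N t : lnabs_int2 (- t) = lnabs_int2 t.
Proof. by rewrite /lnabs_int2 /ell normrN; ring. Qed.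

Lemma cubeN t : cube (- t) = cube t.
Proof. by rewrite /cube normrN. Qed.

Lemma dshift (F : R -> R) (t c df : R) : is_derive (t - c) 1 F df ->
  is_derive t 1 (fun t => F (t - c)) df.
Proof.
move=> dF; have d1 : is_derive t 1 (fun t : R => t - c) 1.
  by have := dadd _ _ _ _ _ (did t) (dcst (- c) t); rewrite addr0.
by have := @dcomp R F (fun z => z - c) t _ _ dF d1; rewrite mulr1.
Qed.

Lemma cshift (F : R -> R) (t c : R) : (forall t, {for t, continuous F}) ->
  {for t, continuous (fun t => F (t - c))}.
Proof. by move=> cF; apply: (ccomp F); [exact: cF|cont]. Qed.

Lemma measurable_lnabs s : measurable_fun [set: R] (fun t : R => ln `|t - s|).
Proof.
apply: measurableT_comp; first exact: measurable_ln.
by apply: measurableT_comp => //; apply: measurable_funB.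
Qed.

Lemma integral_linear_ln p q M s a b : a <= b ->
  (forall h, a < h < b -> 0 <= p + q * h) ->
  (forall h, a < h < b -> h != s -> ln `|h - s| <= M) -> 0 <= M ->
  let F h := M * (p * h + q * (h ^+ 2 / 2))
    - ((p + q * h) * (ell (h - s) - (h - s)) - q * lnabs_int2 (h - s)) in
  (\int[leb]_(h in `]a, b[) ((p + q * h) * (M - ln `|h - s|))%:E = (F b - F a)%:E)%E.
Proof.
move=> ab pq hM hM0 F.
apply: (ge0_FTC2_except R [:: s] (fun h => (p + q * h) * (M - ln `|h - s|)) F a b ab).
- apply: measurable_funM; first by apply: measurable_funD => //; exact: measurable_funM.
  by apply: measurable_funB => //; exact: measurable_lnabs.
- move=> h hd; apply: mulr_ge0; first exact: pq.
  rewrite subr_ge0; have [->|hs] := eqVneq h s; first by rewrite subrr normr0 ln0.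
  exact: hM.
- move=> h _; have c1 := cshift ell h s cell; have c2 := cshift lnabs_int2 h s clnabs_int2.
  by rewrite /F; cont.
- move=> h _; rewrite inE => hs; cont.
  by rewrite normr_gt0 subr_eq0.
- move=> h _; rewrite inE => hs; have hs0 : h - s != 0 by rewrite subr_eq0.
  have d1 := dshift ell h s _ (dell _ hs0).
  have d2 := dshift lnabs_int2 h s _ (dlnabs_int2 _ hs0).
  dstart; first by rewrite /F; der.
  by rewrite /ell/=; field.
Qed.

(** The second difference of step [d] of [|x| / 2]: the weight for which
    integration against [ln |x - y|] gives a second difference of
    [lnabs_int2]. *)
Definition hat d x : R := Num.max 0 (d - `|x|).

Lemma hat_ge0 d x : 0 <= hat d x.
Proof. by rewrite /hat le_max lexx. Qed.

Lemma measurable_hat d : measurable_fun [set: R] (hat d).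
Proof. by apply: measurable_maxr => //; apply: measurable_funB. Qed.

Lemma integral_hat_logker d M (y c : R) : 0 < d -> 0 <= M ->
  (forall x, `|x - c| < d -> x != y -> ln `|x - y| <= M) ->
  (\int[leb]_x ((hat d (x - c))%:E * logker M (x - y))
   = (M * d ^+ 2 - diff2 d lnabs_int2 (y - c))%R%:E)%E.
Proof.
move=> d0 M0 hM; pose s := y - c.
have hMs h : - d < h < d -> h != s -> ln `|h - s| <= M.
  move=> hd hs; have := hM (h + c); rewrite /s opprB addrA addrK; apply.
    by rewrite ltr_norml; lra.
  by rewrite eq_sym -subr_eq eq_sym.
pose g h : \bar R := ((hat d h)%:E * logker M (h - s))%E.
have mg : measurable_fun [set: R] g.
  apply: emeasurable_funM; first by apply/measurable_EFinP; exact: measurable_hat.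
  apply: (measurableT_comp (measurable_logker M)); exact: measurable_funB.
have g0 h : (0 <= g h)%E by rewrite mule_ge0 ?logker_ge0// lee_fin hat_ge0.
have -> : (\int[leb]_x ((hat d (x - c))%:E * logker M (x - y)) = \int[leb]_h g h)%E.
  rewrite -(integral_shift R g (- c) mg g0); apply: eq_integral => x _.
  by rewrite /g /s opprB addrA subrK.
pose f h := (d - `|h|) * (M - ln `|h - s|).
have mf : measurable_fun [set: R] f.
  by apply: measurable_funM; apply: measurable_funB => //; exact: measurable_lnabs.
have f0 h : - d < h < d -> 0 <= f h.
  move=> hd; apply: mulr_ge0; first by rewrite subr_ge0 ler_norml; lra.
  rewrite subr_ge0; have [->|hs] := eqVneq h s; first by rewrite subrr normr0 ln0.
  exact: hMs.
have -> : (\int[leb]_h g h = \int[leb]_(h in `](- d)%R, d[) (f h)%:E)%E.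
  rewrite [RHS]integral_mkcond.
  have Z : leb.-negligible [set s].
    exists [set s]; split => //; exact: lebesgue_measure_set1.
  have mI : measurable (`](- d), d[%classic : set R) by exact: measurable_itv.
  apply: ae_eq_integral => //.
    by apply/(measurable_restrictT _ mI); apply: measurable_funTS; exact/measurable_EFinP.
  apply: negligibleS Z => h /=; apply: contra_notP => /eqP hs _.
  rewrite patchE /g /logker subr_eq0 (negbTE hs) -EFinM.
  have [hd|nd] := boolP (- d < h < d).
    rewrite mem_set ?in_itv//= /hat; congr (_%:E).
    rewrite (max_idPr _); last by rewrite subr_ge0 ler_norml; lra.
    by rewrite (max_idPr _) ?subr_ge0 ?hMs.
  rewrite memNset; last by rewrite /= in_itv/=; apply/negP.
  rewrite /hat (max_idPl _) ?mul0r// subr_le0 leNgt ltr_norml.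
  exact: nd.
have h0d : - d < 0 < d by lra.
rewrite (ge0_integral_split R f (- d) d 0)//; last by lra.
have fl h : - d < h < 0 -> 0 <= d + 1 * h by lra.
have fr h : 0 < h < d -> 0 <= d + (- 1) * h by lra.
have hl h : - d < h < 0 -> h != s -> ln `|h - s| <= M by move=> ?; apply: hMs; lra.
have hr h : 0 < h < d -> h != s -> ln `|h - s| <= M by move=> ?; apply: hMs; lra.
have -> : (\int[leb]_(h in `](- d)%R, 0%R[) (f h)%:E
  = \int[leb]_(h in `](- d)%R, 0%R[) ((d + 1 * h) * (M - ln `|h - s|))%:E)%E.
  apply: eq_integral => h /set_mem/=; rewrite in_itv/= => hd.
  by rewrite /f ltr0_norm ?opprK ?mul1r//; lra.
have -> : (\int[leb]_(h in `]0%R, d[) (f h)%:E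
  = \int[leb]_(h in `]0%R, d[) ((d + (- 1) * h) * (M - ln `|h - s|))%:E)%E.
  apply: eq_integral => h /set_mem/=; rewrite in_itv/= => hd.
  by rewrite /f gtr0_norm ?mulN1r//; lra.
rewrite (integral_linear_ln d 1 M s (- d) 0 _ fl hl M0); last lra.
rewrite (integral_linear_ln d (- 1) M s 0 d _ fr hr M0); last lra.
rewrite -EFinD; congr (_%:E); rewrite -/s.
have -> : diff2 d lnabs_int2 s = lnabs_int2 (d - s) + lnabs_int2 (- d - s) - 2 * lnabs_int2 (0 - s).
  rewrite /diff2 sub0r lnabs_int2N -[lnabs_int2 (s + d)]lnabs_int2N -[lnabs_int2 (s - d)]lnabs_int2N.
  by rewrite opprB opprD [- s - d]addrC; ring.
by field.
Qed.

Lemma diff2_cube_ge0 t h : 0 <= h -> 0 <= diff2 h cube t.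
Proof.
move=> h0; wlog t0 : t / 0 <= t => [W|].
  have [|t0] := leP 0 t; first exact: W.
  have := W (- t); rewrite oppr_ge0 => /(_ (ltW t0)).
  rewrite /diff2 cubeN -(cubeN (- t + h)) -(cubeN (- t - h)).
  by rewrite !opprD !opprK [cube (t - h) + _]addrC.
rewrite /diff2 /cube (ger0_norm t0) [`|t + h|]ger0_norm; last lra.
have [hb|hb] := leP h t.
  rewrite ger0_norm; last lra.
  have -> : (t + h) ^+ 3 / 12 + (t - h) ^+ 3 / 12 - 2 * (t ^+ 3 / 12) = t * h ^+ 2 / 2 by field.
  by rewrite !mulr_ge0// sqr_ge0.
rewrite ltr0_norm; last lra.
have -> : (t + h) ^+ 3 / 12 + (- (t - h)) ^+ 3 / 12 - 2 * (t ^+ 3 / 12)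
  = ((h ^+ 3 - t ^+ 3) + 3 * t ^+ 2 * h) / 6 by field.
rewrite divr_ge0// addr_ge0//; last by rewrite !mulr_ge0 ?sqr_ge0.
by rewrite subr_ge0 lerXn2r ?nnegrE//; lra.
Qed.

(** The integrand is [t / 2] for [h < |t|] and a rational function of [h]
    beyond. Up to terms that two further second differences kill, the result
    is [2 cube t / L - lnabs_int2 t]: the truncated half-Laplacian of [cube]
    is a potential of the logarithm. *)
Lemma integral_cube_diff2 t L : 0 < L -> `|t| <= L ->
  (\int[leb]_(h in `]0%R, L[) (diff2 h cube t / h ^+ 2)%:E
   = (L ^+ 2 / 12 + (ln L / 2 - 1 / 2) * t ^+ 2 + 2 * cube t / L - lnabs_int2 t)%R%:E)%E.
Proof.
move=> L0.
wlog t0 : t / 0 <= t => [W|].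
  have [t0|t0] := leP 0 t; first exact: W.
  move=> tL; have := W (- t); rewrite oppr_ge0 normrN => /(_ (ltW t0) tL).
  rewrite cubeN lnabs_int2N sqrrN => <-; apply: eq_integral => h _.
  congr (_%:E); congr (_ / _); rewrite /diff2 cubeN -(cubeN (- t + h)) -(cubeN (- t - h)).
  by rewrite !opprD !opprK; ring.
rewrite ger0_norm// => tL.
have mf : measurable_fun [set: R] (fun h => diff2 h cube t / h ^+ 2).
  apply: measurable_diff2_quotient; apply: measurable_funM => //.
  by apply: measurable_funX.
have f0 h : 0 < h < L -> 0 <= diff2 h cube t / h ^+ 2.
  by move=> /andP[/ltW h0 _]; rewrite divr_ge0 ?sqr_ge0// diff2_cube_ge0.
have e1 h : 0 < h < t -> diff2 h cube t / h ^+ 2 = t / 2.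
  move=> ht; rewrite /diff2 /cube !ger0_norm; try lra.
  by field; lra.
have e2 h : t < h -> 0 < h -> diff2 h cube t / h ^+ 2
    = h / 6 + t ^+ 2 / 2 / h - t ^+ 3 / 6 / h ^+ 2.
  move=> ht h0; rewrite /diff2 /cube ger0_norm; last lra.
  rewrite ltr0_norm; last lra.
  rewrite ger0_norm; last lra.
  by field; lra.
have [t0'|t1] := eqVneq t 0.
  pose F h : R := h ^+ 2 / 12.
  rewrite t0' in f0 e2 *.
  have -> : L ^+ 2 / 12 + (ln L / 2 - 1 / 2) * 0 ^+ 2 + 2 * cube 0 / L - lnabs_int2 0 = F L - F 0.
    by rewrite /F /cube normr0 /lnabs_int2 /ell; field; lra.
  rewrite (_ : (\int[leb]_(x in _) _ = \int[leb]_(h in `]0%R, L[) (h / 6)%:E)%E); last first.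
    apply: eq_integral => h /set_mem/=; rewrite in_itv/= => /andP[h0 hL].
    by rewrite e2//; congr (_%:E); field; lra.
  apply: (ge0_FTC2_except _ [::]) => //.
  - exact: ltW.
  - exact: measurable_funM.
  - by move=> x hx; lra.
  - by move=> x _; rewrite /F; cont.
  - by move=> x _ _; cont.
  - by move=> x _ _; dstart; [rewrite /F; der|rewrite /=; field].
have tp : 0 < t by rewrite lt_neqAle eq_sym t1.
rewrite (ge0_integral_split R _ 0 L t) ?(ltW tp)//.
pose F1 h : R := t / 2 * h.
pose F2 h : R := h ^+ 2 / 12 + t ^+ 2 / 2 * ln h + t ^+ 3 / 6 / h.
have -> : (\int[leb]_(h in `]0%R, t[) (diff2 h cube t / h ^+ 2)%:E = (F1 t - F1 0)%:E)%E.
  rewrite (_ : (\int[leb]_(x in _) _ = \int[leb]_(h in `]0%R, t[) (t / 2)%:E)%E); last first.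
    by apply: eq_integral => h /set_mem/=; rewrite in_itv/= => ht; rewrite e1.
  apply: (ge0_FTC2_except _ [::]) => //.
  - by move=> x hx; lra.
  - by move=> x _; rewrite /F1; cont.
  - by move=> x _ _; cont.
  - by move=> x _ _; dstart; [rewrite /F1; der|rewrite /=; field].
have -> : (\int[leb]_(h in `]t, L[) (diff2 h cube t / h ^+ 2)%:E = (F2 L - F2 t)%:E)%E.
  apply: (ge0_FTC2_except R [::] (fun h => diff2 h cube t / h ^+ 2) F2 t L tL mf).
  - by move=> x hx; apply: f0; lra.
  - by move=> x hx; rewrite /F2; cont; first lra; rewrite gt_eqF//; lra.
  - move=> x hx _; have x0 : 0 < x by lra.
    have xn : x != 0 by rewrite gt_eqF.
    have c1 : {for x, continuous (fun h => h / 6 + t ^+ 2 / 2 / h - t ^+ 3 / 6 / h ^+ 2)}.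
      by cont; rewrite sqrf_eq0.
    have E : {near nbhs x, (fun h => h / 6 + t ^+ 2 / 2 / h - t ^+ 3 / 6 / h ^+ 2)
        =1 (fun h => diff2 h cube t / h ^+ 2)}.
      near=> y; rewrite e2//.
      - by near: y; apply: lt_nbhsr; lra.
      - by near: y; apply: lt_nbhsr; lra.
    rewrite /prop_for /continuous_at e2; [|lra|lra].
    exact: (cvg_trans (near_eq_cvg E) c1).
  - move=> x hx _; have x0 : 0 < x by lra.
    rewrite e2; [|lra|lra].
    dstart; first by rewrite /F2; der; rewrite ?gt_eqF.
    by rewrite /=; field; rewrite gt_eqF.
rewrite -EFinD; congr (_%:E); rewrite /F1 /F2 /cube /lnabs_int2 /ell ger0_norm//.
by field; lra.
Unshelve. all: by end_near. Qed.
End kernels.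

(** * Convolution with the measure and the cubic spline *)

Section conv.
Context {R : realType}.
Variables (mu : probability (measurableTypeR R) R) (a b : R).

Lemma continuous_bounded_itv (G : R -> R) (x y : R) : (forall t, {for t, continuous G}) ->
  exists C : R, forall t, x <= t <= y -> `|G t| <= C.
Proof.
move=> cG; have [xy|yx] := leP x y; last by exists 0 => t; lra.
have cN t : {for t, continuous (fun t => `|G t|)} by have c := cG t; cont.
have [c _ hc] := EVT_max xy (continuous_in_subspaceT (fun t _ => cN t)).
by exists `|G c| => t ht; apply: hc; rewrite in_itv.
Qed.

(** The integral of the translate of [G] against [mu] carried by [[a, b]];
    for an even [G] this is the convolution [G * mu]. *)
Definition conv (G : R -> R) (w : R) : R :=
  \int[mu]_(y in `[a, b]%classic : set (measurableTypeR R)) G (y - w).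

Lemma continuous_measurable (G : R -> R) : (forall t, {for t, continuous G}) ->
  measurable_fun [set: R] G.
Proof. by move=> cG; apply: continuous_measurable_fun => t; exact: cG. Qed.

Lemma conv_integrable (G : R -> R) (w : R) : (forall t, {for t, continuous G}) ->
  mu.-integrable (`[a, b]%classic : set (measurableTypeR R)) (fun y => (G (y - w))%:E).
Proof.
move=> cG; have [C hC] := continuous_bounded_itv G (a - w) (b - w) cG.
have mG := continuous_measurable G cG.
apply: measurable_bounded_integrable => //.
- by rewrite (le_lt_trans (probability_le1 _ _)) ?ltry//; exact: measurable_itv.
- by apply: measurable_funTS; apply: measurableT_comp => //; exact: measurable_funB.
- exists C; split; first exact: num_real.
  move=> z hz y /=; rewrite in_itv/= => hy; apply: (le_trans _ (ltW hz)); apply: hC; lra.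
Qed.

Lemma conv_ge0 (G : R -> R) (w : R) : (forall t, 0 <= G t) -> 0 <= conv G w.
Proof. by move=> G0; apply: Rintegral_ge0. Qed.

Lemma cdiff2 d (G : R -> R) t : (forall t, {for t, continuous G}) ->
  {for t, continuous (diff2 d G)}.
Proof.
move=> cG; have c1 : {for t, continuous (fun t => G (t + d))}.
  by apply: (ccomp G); [exact: cG|cont].
by have c2 := cshift G t d cG; have c3 := cG t; rewrite /diff2; cont.
Qed.

Lemma conv_diff2 d (G : R -> R) (w : R) : (forall t, {for t, continuous G}) ->
  conv (diff2 d G) w = diff2 d (conv G) w.
Proof.
move=> cG.
pose D := `[a, b]%classic : set (measurableTypeR R).
have mD : measurable D by exact: measurable_itv.
have i1 (w : R) := conv_integrable G w cG.
have i2 : mu.-integrable D (EFin \o (fun y => G (y - (w - d)) + G (y - (w + d)))).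
  by have := integrableD mD (i1 (w - d)) (i1 (w + d)); apply: eq_integrable.
have i3 : mu.-integrable D (EFin \o (fun y => 2 * G (y - w))).
  by have := integrableZl mD 2 (i1 w); apply: eq_integrable.
transitivity (\int[mu]_(y in D) (G (y - (w - d)) + G (y - (w + d)) - 2 * G (y - w))).
  apply: eq_Rintegral => y _; rewrite /diff2.
  by congr (G _ + G _ - _); ring.
rewrite RintegralB// RintegralD//; [|exact: i1..].
by rewrite RintegralZl//; [rewrite -!/(conv G _) /diff2; ring|exact: i1].
Qed.

(** Dominated convergence: the integrands are bounded on [[a, b]] uniformly
    for [w] in a bounded interval. *)
Lemma conv_continuous (G : R -> R) (w : R) : (forall t, {for t, continuous G}) ->
  {for w, continuous (conv G)}.
Proof.
move=> cG; have [C hC] := continuous_bounded_itv G (a - w - 1) (b - w + 1) cG.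
pose D := `[a, b]%classic : set (measurableTypeR R).
have mD : measurable D by exact: measurable_itv.
have H := @continuity_under_integral R _ _ mu (fun w y => G (y - w)) D mD (w - 1) (w + 1) _ _ (fun=> C).
apply: H.
- by move=> x _; exact: conv_integrable.
- apply: aeW => y _ x _.
  have c : {for x, continuous (fun w => G (y - w))} by apply: (ccomp G); [exact: cG|cont].
  exact: c.
- by apply: finite_measure_integrable_cst; exact: mD.
- move=> x hx0; have hx : w - 1 < x < w + 1 by move: hx0; rewrite /= in_itv.
  apply: aeW => y; rewrite /D /= in_itv/= => hy.
  apply: hC; lra.
- by rewrite inE/= in_itv/=; lra.
Qed.
End conv.

Section spline.
Context {R : realType}.
Local Notation leb := (@lebesgue_measure R).
Implicit Types (d t : R).

(** The cubic B-spline of step [d], of total mass [d^4]. *)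
Definition spline d := diff2 d (diff2 d (@cube R)).

Lemma splineN d t : spline d (- t) = spline d t.
Proof.
rewrite /spline /diff2 -(cubeN (- t + d + d)) -(cubeN (- t + d - d)) -(cubeN (- t + d))
 -(cubeN (- t - d + d)) -(cubeN (- t - d - d)) -(cubeN (- t - d)) -(cubeN (- t)).
rewrite !opprD !opprK; ring.
Qed.

Lemma spline_out d t : 0 < d -> 2 * d <= `|t| -> spline d t = 0.
Proof.
move=> d0; wlog t0 : t / 0 <= t => [W|].
  by have [|t0] := leP 0 t; [exact: W|rewrite -normrN -splineN; apply: W; lra].
rewrite ger0_norm// => h; rewrite /spline /diff2 /cube !ger0_norm; lra.
Qed.

Lemma spline_ge0 d t : 0 < d -> 0 <= spline d t.
Proof.
move=> d0; wlog t0 : t / 0 <= t => [W|].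
  by have [|t0] := leP 0 t; [exact: W|rewrite -splineN; apply: W; lra].
have [h|h] := leP (2 * d) t; first by rewrite spline_out// ger0_norm.
rewrite /spline /diff2 /cube.
have -> : t + d - d = t by ring.
have -> : t - d + d = t by ring.
rewrite [`|t + d + d|]ger0_norm; last lra.
rewrite [`|t + d|]ger0_norm; last lra.
rewrite [`|t|]ger0_norm//.
rewrite [`|t - d - d|]ltr0_norm; last lra.
have [h1|h1] := leP d t.
  rewrite ger0_norm; last lra.
  set q := (X in 0 <= X); have -> : q = (2 * d - t) ^+ 3 / 6 by rewrite /q; field.
  by rewrite divr_ge0// exprn_ge0//; lra.
rewrite ltr0_norm; last lra.
set q := (X in 0 <= X).
have -> : q = (d ^+ 3 + 3 * ((d - t) * (d ^+ 2 + t * (d - t)))) / 6 by rewrite /q; field.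
rewrite divr_ge0// addr_ge0// ?exprn_ge0 ?(ltW d0)//.
rewrite mulr_ge0// mulr_ge0 ?subr_ge0 ?(ltW h1)// addr_ge0 ?sqr_ge0//.
by rewrite mulr_ge0// subr_ge0 ltW.
Qed.

Lemma ccube t : {for t, continuous (@cube R)}.
Proof.
rewrite /cube.
have -> : (fun t => `|t| ^+ 3 / 12) = (fun t : R => `|t| * `|t| ^+ 2 / 12).
  by apply/funext => x; rewrite exprS.
by cont.
Qed.

Lemma cspline d t : {for t, continuous (spline d)}.
Proof. by do 2 (apply: cdiff2 => ?); exact: ccube. Qed.

Let quart t : R := t * cube t / 4.

Let dquart t : t != 0 -> is_derive t 1 quart (cube t).
Proof.
move=> t0; have [tp|tn] := ltP 0 t.
  have H : is_derive t 1 (fun y : R => y ^+ 2 * y ^+ 2 / 48) (cube t).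
    by dstart; [der|rewrite /cube gtr0_norm//=; field].
  apply: (near_eq_is_derive _ H).
    near=> y; rewrite /quart /cube gtr0_norm//; first by field.
    by near: y; exact: lt_nbhsr.
have {t0 tn}tn : t < 0 by rewrite lt_neqAle t0.
have H : is_derive t 1 (fun y : R => - (y ^+ 2 * y ^+ 2 / 48)) (cube t).
  by dstart; [der|rewrite /cube ltr0_norm//=; field].
apply: (near_eq_is_derive _ H).
  near=> y; rewrite /quart /cube ltr0_norm//; first by field.
  by near: y; exact: lt_nbhsl.
Unshelve. all: by end_near. Qed.

Lemma integral_spline d : 0 < d -> (\int[leb]_t (spline d t)%:E = (d ^+ 4)%:E)%E.
Proof.
move=> d0.
have -> : (\int[leb]_t (spline d t)%:E
    = \int[leb]_(t in `](- (3 * d))%R, (3 * d)%R[) (spline d t)%:E)%E.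
  rewrite [RHS]integral_mkcond; apply: eq_integral => t _; rewrite patchE.
  case: ifPn => // /negP H; rewrite spline_out// leNgt; apply/negP => h; apply: H.
  by apply/mem_set; rewrite /= in_itv/=; move: h; rewrite ltr_norml; lra.
pose F := diff2 d (diff2 d quart).
have cq t : {for t, continuous quart}.
  by have c := ccube t; rewrite /quart; cont.
have -> : d ^+ 4 = F (3 * d) - F (- (3 * d)).
  have qp t : 0 <= t -> quart t = t ^+ 4 / 48 by move=> h; rewrite /quart /cube ger0_norm//; field.
  have qn t : t <= 0 -> quart t = - t ^+ 4 / 48 by move=> h; rewrite /quart /cube ler0_norm//; field.
  rewrite /F /diff2 [quart (3 * d + d + d)]qp; last lra.
  rewrite [quart (3 * d + d - d)]qp; last lra.
  rewrite [quart (3 * d + d)]qp; last lra.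
  rewrite [quart (3 * d - d + d)]qp; last lra.
  rewrite [quart (3 * d - d - d)]qp; last lra.
  rewrite [quart (3 * d - d)]qp; last lra.
  rewrite [quart (3 * d)]qp; last lra.
  by rewrite !qn; [field|lra..].
apply: (ge0_FTC2_except R [:: 0; - (2 * d); - d; d; 2 * d]).
- lra.
- by apply: continuous_measurable => t; exact: cspline.
- by move=> t _; exact: spline_ge0.
- by move=> t _; apply: cdiff2 => ?; apply: cdiff2 => ?; exact: cq.
- by move=> t _ _; exact: cspline.
- move=> t _; rewrite !inE !negb_or => /and5P[h0 h1 h2 h3 h4].
  have sh c : t - c != 0 -> is_derive t 1 (fun t => quart (t - c)) (cube (t - c)).
    by move=> h; apply: (dshift quart t c); exact: dquart.
  have e0 : is_derive t 1 (fun t => quart t) (cube t) by exact: dquart.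
  have e1 := sh (- (2 * d)); rewrite subr_eq0 in e1; have {}e1 := e1 h1.
  have e2 := sh (- d); rewrite subr_eq0 in e2; have {}e2 := e2 h2.
  have e3 := sh d; rewrite subr_eq0 in e3; have {}e3 := e3 h3.
  have e4 := sh (2 * d); rewrite subr_eq0 in e4; have {}e4 := e4 h4.
  have -> : F = fun t => quart (t - (- (2 * d))) + quart (t - 2 * d)
      - 4 * (quart (t - (- d)) + quart (t - d)) + 6 * quart t.
    apply/funext => x; rewrite /F /diff2 (_ : x + d + d = x - - (2 * d)); last ring.
    rewrite (_ : x + d - d = x); last ring.
    rewrite (_ : x - d + d = x); last ring.
    rewrite (_ : x - d - d = x - 2 * d); last ring.
    by rewrite !opprK; ring.
  dstart; first by der.
  rewrite /spline /diff2 (_ : t + d + d = t - - (2 * d)); last ring.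
  rewrite (_ : t + d - d = t); last ring.
  rewrite (_ : t - d + d = t); last ring.
  rewrite (_ : t - d - d = t - 2 * d); last ring.
  by rewrite !opprK /=; ring.
Qed.
End spline.

(** * Second differences of the logarithmic potential *)

(** Tonelli for the extension by zero outside the product set; the restricted
    measures need not be introduced. *)
Lemma tonelli_on d1 d2 (T1 : measurableType d1) (T2 : measurableType d2) (R : realType)
    (m1 : {sigma_finite_measure set T1 -> \bar R})
    (m2 : {sigma_finite_measure set T2 -> \bar R})
    (D1 : set T1) (D2 : set T2) (f : T1 * T2 -> \bar R) :
  measurable D1 -> measurable D2 ->
  measurable_fun setT f -> (forall p, 0 <= f p)%E ->
  (\int[m1]_(x in D1) \int[m2]_(y in D2) f (x, y)
   = \int[m2]_(y in D2) \int[m1]_(x in D1) f (x, y))%E.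
Proof.
move=> mD1 mD2 mf f0; pose g := (f \_ (D1 `*` D2)).
have mX : measurable (D1 `*` D2) by exact: measurableX.
have mg : measurable_fun setT g.
  by apply/(measurable_restrictT _ mX); exact: measurable_funTS.
have g0 p : (0 <= g p)%E by rewrite /g patchE; case: ifP.
have H := fubini_tonelli g mg g0 (m1 := m1) (m2 := m2).
rewrite [LHS]integral_mkcond [RHS]integral_mkcond.
transitivity (\int[m1]_x \int[m2]_y g (x, y))%E.
  apply: eq_integral => x _; rewrite patchE; case: ifPn => [/set_mem xD|xD].
    rewrite integral_mkcond; apply: eq_integral => y _; rewrite /g !patchE.
    have [yD|yD] := boolP (y \in D2); first by rewrite mem_set//; split => //; exact/set_mem.
    by rewrite memNset// => -[_ /= h]; move/negP: yD; apply; exact: mem_set.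
  rewrite integral0_eq// => y _; rewrite /g patchE memNset// => -[/= h _].
  by move/negP: xD; apply; exact: mem_set.
rewrite H; apply: eq_integral => y _; rewrite patchE; case: ifPn => [/set_mem yD|yD].
  rewrite [RHS]integral_mkcond; apply: eq_integral => x _; rewrite /g !patchE.
  have [xD|xD] := boolP (x \in D1); first by rewrite mem_set//; split => //; exact/set_mem.
  by rewrite memNset// => -[/= h _]; move/negP: xD; apply; exact: mem_set.
rewrite integral0_eq// => x _; rewrite /g patchE memNset// => -[_ /= h].
by move/negP: yD; apply; exact: mem_set.
Qed.

Section hat_integral.
Context {R : realType}.
Local Notation leb := (@lebesgue_measure R).

Lemma integral_hat (d c : R) : 0 < d -> (\int[leb]_x (hat d (x - c))%:E = (d ^+ 2)%:E)%E.
Proof.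
move=> d0.
have mh : measurable_fun [set: R] (EFin \o hat d) by apply/measurable_EFinP; exact: measurable_hat.
rewrite (integral_shift R (EFin \o hat d) (- c) mh); last by move=> x; rewrite lee_fin hat_ge0.
have -> : (\int[leb]_h (EFin \o hat d) h = \int[leb]_(h in `](- d)%R, d[) (hat d h)%:E)%E.
  rewrite [RHS]integral_mkcond; apply: eq_integral => t _; rewrite patchE.
  case: ifPn => // /negP H; rewrite /= /hat (max_idPl _)// subr_le0 leNgt; apply/negP => h; apply: H.
  by apply/mem_set; rewrite /= in_itv/=; move: h; rewrite ltr_norml.
have h0d : - d < 0 < d by lra.
rewrite (ge0_integral_split R (hat d) (- d) d 0)//; [|lra|exact: measurable_hat|by move=> *; exact: hat_ge0].
pose F1 (h : R) : R := d * h + h ^+ 2 / 2.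
pose F2 (h : R) : R := d * h - h ^+ 2 / 2.
have -> : (\int[leb]_(h in `](- d)%R, 0%R[) (hat d h)%:E = (F1 0 - F1 (- d))%:E)%E.
  rewrite (_ : (\int[leb]_(x in _) _ = \int[leb]_(h in `](- d)%R, 0%R[) (d + h)%:E)%E); last first.
    apply: eq_integral => h /set_mem/=; rewrite in_itv/= => ht.
    by rewrite /hat ltr0_norm; [rewrite opprK (max_idPr _)//; lra|lra].
  apply: (ge0_FTC2_except R [::] (fun h => d + h) F1).
  - lra.
  - exact: measurable_funD.
  - by move=> x; lra.
  - by move=> x _; rewrite /F1; cont.
  - by move=> x _ _; cont.
  - by move=> x _ _; dstart; [rewrite /F1; der|rewrite /=; field].
have -> : (\int[leb]_(h in `]0%R, d[) (hat d h)%:E = (F2 d - F2 0)%:E)%E.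
  rewrite (_ : (\int[leb]_(x in _) _ = \int[leb]_(h in `]0%R, d[) (d - h)%:E)%E); last first.
    apply: eq_integral => h /set_mem/=; rewrite in_itv/= => ht.
    by rewrite /hat gtr0_norm; [rewrite (max_idPr _)//; lra|lra].
  apply: (ge0_FTC2_except R [::] (fun h => d - h) F2).
  - lra.
  - exact: measurable_funB.
  - by move=> x; lra.
  - by move=> x _; rewrite /F2; cont.
  - by move=> x _ _; cont.
  - by move=> x _ _; dstart; [rewrite /F2; der|rewrite /=; field].
by rewrite -EFinD /F1 /F2; congr (_%:E); field.
Qed.
End hat_integral.

Section second_differences.
Context {R : realType}.
Local Notation leb := (@lebesgue_measure R).
Variables (mu : probability (measurableTypeR R) R) (a b M c0 rho : R) (W : R -> R).
Hypotheses (ab : a < b) (hM : ln (b - a) <= M) (M0 : 0 <= M) (rho0 : 0 < rho).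
Hypothesis (mu0 : mu (~` `[a, b]%classic) = 0%E).
Hypothesis EL_le : forall x, a <= x <= b -> ((W x)%:E + 2%:E * pot M mu x <= c0%:E)%E.
Hypothesis EL_ge : leb.-negligible [set x | a <= x <= b /\ ((W x)%:E + 2%:E * pot M mu x < c0%:E)%E].
Hypothesis Wconv : forall x d, 0 <= d -> a <= x - d -> x + d <= b ->
  2 * rho * d ^+ 2 <= diff2 d W x.

Let D := `[a, b]%classic : set (measurableTypeR R).
Let mD : measurable D. Proof. exact: measurable_itv. Qed.

Lemma integral_supp (f : R -> \bar R) : measurable_fun [set: measurableTypeR R] f ->
  (forall x, 0 <= f x)%E -> (\int[mu]_x f x = \int[mu]_(x in D) f x)%E.
Proof.
move=> mf f0; rewrite (ge0_negligible_integral (N := ~` D))//.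
- by rewrite setTD setCK.
- exact: measurableC.
Qed.

Lemma muD : mu D = 1%E.
Proof.
have := @probability_setC _ _ _ mu _ mD; rewrite mu0 => h.
have : mu D \is a fin_num by exact: fin_num_measure.
move: h; case: (mu D) => //= r h _; congr (_%:E).
by case: h => h; lra.
Qed.

Let P (d c : R) := (\int[leb]_x ((hat d (x - c))%:E * pot M mu x))%E.

(** Tonelli and [integral_hat_logker]. *)
Lemma hat_potE d c : 0 < d -> a <= c - d -> c + d <= b ->
  P d c = (M * d ^+ 2 - diff2 d (conv mu a b (@lnabs_int2 R)) c)%:E.
Proof.
move=> d0 ac cb.
pose g (p : measurableTypeR R * measurableTypeR R) : \bar R :=
  ((hat d (p.1 - c))%:E * logker M (p.1 - p.2))%E.
have mg : measurable_fun setT g.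
  apply: emeasurable_funM; last exact: measurable_logker2.
  apply/measurable_EFinP; apply: (measurableT_comp (measurable_hat d)).
  exact: measurable_funB.
have g0 p : (0 <= g p)%E by rewrite mule_ge0 ?logker_ge0// lee_fin hat_ge0.
have -> : P d c = (\int[leb]_x \int[mu]_y g (x, y))%E.
  apply: eq_integral => x _; rewrite /pot -ge0_integralZl//.
  - apply: (measurableT_comp (measurable_logker M)); exact: measurable_funB.
  - by move=> y _; exact: logker_ge0.
  - by rewrite lee_fin hat_ge0.
rewrite (tonelli_on _ _ _ _ _ leb mu setT setT g)//.
rewrite integral_supp; last 2 first.
- apply: (measurable_fun_fubini_tonelli_G g) => //.
- by move=> y; apply: integral_ge0 => x _; exact: g0.
pose G (t : R) : R := M * d ^+ 2 - diff2 d (@lnabs_int2 R) t.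
have cG t : {for t, continuous G}.
  by have c1 := cdiff2 d _ t (@clnabs_int2 R); rewrite /G; cont.
have -> : (\int[mu]_(y in D) \int[leb]_x g (x, y) = \int[mu]_(y in D) (G (y - c))%:E)%E.
  apply: eq_integral => y /set_mem/=; rewrite /D /= in_itv/= => hy.
  rewrite integral_hat_logker// => x; rewrite ltr_norml => hx xy.
  rewrite (le_trans _ hM)// ler_ln ?posrE ?normr_gt0 ?subr_eq0 ?subr_gt0//.
  by rewrite ler_norml; lra.
have iG := conv_integrable mu a b G c cG.
rewrite -(fineK (integrable_fin_num mD iG)); congr (_%:E).
rewrite -/(Rintegral _ _ _) -conv_diff2; last exact: clnabs_int2.
rewrite /G RintegralB//.
- by rewrite Rintegral_cst// [X in _ * X - _](congr1 fine muD)/= mulr1.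
- exact: finite_measure_integrable_cst.
- by apply: conv_integrable => t; apply: cdiff2; exact: clnabs_int2.
Qed.

Lemma EL_pot x : a <= x <= b -> pot M mu x \is a fin_num /\ 2 * fine (pot M mu x) <= c0 - W x.
Proof.
move=> hx; have := EL_le x hx; have := pot_ge0 M mu x.
case: (pot M mu x) => [r| |]//= _; last by rewrite mulry gtr0_sg// mul1e addey.
by rewrite -EFinM -EFinD lee_fin => h; split => //; lra.
Qed.

(** The Euler-Lagrange conditions bound the potential from above by
    [(c0 - W) / 2] at [x + d] and [x - d], with equality at almost every [x],
    and the strong convexity of [W] bounds its second difference. *)
Lemma hat_pot_concave d c : 0 < d -> a <= c - 2 * d -> c + 2 * d <= b ->
  (P d (c + d) + P d (c - d) + (rho * d ^+ 4)%:E <= 2%:E * P d c)%E.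
Proof.
move=> d0 ac cb.
pose h x := hat d (x - c).
have mh : measurable_fun [set: R] h.
  by apply: (measurableT_comp (measurable_hat d)); exact: measurable_funB.
have mp : measurable_fun [set: R] (pot M mu) by exact: measurable_pot.
have msh (k : R) : measurable_fun [set: R] (fun x => pot M mu (x + k)).
  by apply: (measurableT_comp mp); exact: measurable_funD.
have mhE : measurable_fun [set: R] (fun x => (h x)%:E) by exact/measurable_EFinP.
have h0 x : (0 <= (h x)%:E)%E by rewrite lee_fin hat_ge0.
have p0 x : (0 <= pot M mu x)%E by exact: pot_ge0.
have sh (k : R) : P d (c + k) = (\int[leb]_x ((h x)%:E * pot M mu (x + k)))%E.
  rewrite /P -(integral_shift R _ k).
  - by apply: eq_integral => x _; rewrite /h; congr ((hat d _)%:E * _)%E; ring.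
  - apply: emeasurable_funM => //; apply/measurable_EFinP.
    by apply: (measurableT_comp (measurable_hat d)); exact: measurable_funB.
  - by move=> x; rewrite mule_ge0// lee_fin hat_ge0.
have -> : P d (c + d) = (\int[leb]_x ((h x)%:E * pot M mu (x + d)))%E by exact: sh.
have -> : P d (c - d) = (\int[leb]_x ((h x)%:E * pot M mu (x - d)))%E by exact: sh.
have -> : (rho * d ^+ 4)%:E = (\int[leb]_x ((h x)%:E * (rho * d ^+ 2)%:E))%E.
  rewrite ge0_integralZr//; last by rewrite lee_fin mulr_ge0 ?sqr_ge0// ltW.
  rewrite integral_hat// -EFinM; congr (_%:E); ring.
have i0 (k : R) x : (0 <= (h x)%:E * pot M mu (x + k))%E by rewrite mule_ge0.
have mi (k : R) : measurable_fun [set: R] (fun x => (h x)%:E * pot M mu (x + k))%E.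
  exact: emeasurable_funM.
have mr : measurable_fun [set: R] (fun x => (h x)%:E * (rho * d ^+ 2)%:E)%E.
  exact: emeasurable_funM.
have r0 x : (0 <= (h x)%:E * (rho * d ^+ 2)%:E)%E.
  by rewrite mule_ge0// lee_fin mulr_ge0 ?sqr_ge0// ltW.
have -> : (\int[leb]_x ((h x)%:E * pot M mu (x + d))
    + \int[leb]_x ((h x)%:E * pot M mu (x - d))
    + \int[leb]_x ((h x)%:E * (rho * d ^+ 2)%:E)
    = \int[leb]_x ((h x)%:E * pot M mu (x + d) + (h x)%:E * pot M mu (x - d)
      + (h x)%:E * (rho * d ^+ 2)%:E))%E.
  have e := @ge0_integralD _ _ _ leb _ measurableT (fun x => (h x)%:E * pot M mu (x + d))%E
    (fun x => (h x)%:E * pot M mu (x - d))%E (fun x _ => i0 d x) (mi d)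
    (fun x _ => i0 (- d) x) (mi (- d)).
  have e2 := @ge0_integralD _ _ _ leb _ measurableT
    (fun x => (h x)%:E * pot M mu (x + d) + (h x)%:E * pot M mu (x - d))%E
    (fun x => (h x)%:E * (rho * d ^+ 2)%:E)%E
    (fun x _ => adde_ge0 (i0 d x) (i0 (- d) x)) (emeasurable_funD (mi d) (mi (- d)))
    (fun x _ => r0 x) mr.
  by rewrite e2 e.
have -> : (2%:E * P d c = \int[leb]_x (2%:E * ((h x)%:E * pot M mu x)))%E.
  rewrite -ge0_integralZl//; first exact: emeasurable_funM.
  by move=> x _; exact: mule_ge0 (h0 x) (p0 x).
apply: ae_ge0_le_integral => //.
- by move=> x _; rewrite !adde_ge0 ?i0.
- exact: emeasurable_funD (emeasurable_funD (mi d) (mi (- d))) mr.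
- by move=> x _; apply: mule_ge0 => //; exact: mule_ge0 (h0 x) (p0 x).
- by apply: emeasurable_funM => //; exact: emeasurable_funM.
apply: negligibleS EL_ge => x /= H.
have [hx|hx] := leP d `|x - c|.
  exfalso; apply: H => _; rewrite /h /hat (max_idPl _); last by rewrite subr_le0.
  by rewrite !mul0e !adde0 mule0.
have {}hx : c - d < x < c + d by move: hx; rewrite ltr_norml; lra.
split; first lra.
rewrite ltNge; apply/negP => H2; apply: H => _.
have [f1 l1] : pot M mu (x + d) \is a fin_num /\ 2 * fine (pot M mu (x + d)) <= c0 - W (x + d).
  by apply: EL_pot; lra.
have [f2 l2] : pot M mu (x - d) \is a fin_num /\ 2 * fine (pot M mu (x - d)) <= c0 - W (x - d).
  by apply: EL_pot; lra.
have [f3 _] : pot M mu x \is a fin_num /\ 2 * fine (pot M mu x) <= c0 - W x.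
  by apply: EL_pot; lra.
have w1 : 2 * rho * d ^+ 2 <= diff2 d W x by apply: Wconv; lra.
rewrite /diff2 in w1.
move: H2; rewrite -(fineK f1) -(fineK f2) -(fineK f3) -!EFinM -!EFinD !lee_fin => H2.
rewrite -!mulrDr [leRHS]mulrCA ler_wpM2l ?hat_ge0//.
lra.
Qed.

(** [hat_pot_concave] with the potentials evaluated by [hat_potE]; the
    constant [M] cancels. *)
Lemma log_potential_diff4 d c : 0 < d -> a <= c - 2 * d -> c + 2 * d <= b ->
  rho * d ^+ 4 <= diff2 d (diff2 d (conv mu a b (@lnabs_int2 R))) c.
Proof.
move=> d0 ac cb; have := hat_pot_concave d c d0 ac cb.
rewrite !hat_potE//; try lra.
rewrite -!EFinM -!EFinD lee_fin; set Y := diff2 d (conv _ _ _ _).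
by rewrite [diff2 d Y c]/diff2; lra.
Qed.

End second_differences.

(** * The truncated half-Laplacian of the smoothed measure *)

Section fractional.
Context {R : realType}.
Local Notation leb := (@lebesgue_measure R).

Lemma Rintegral_diff2 d' (X : measurableType d') (m : {measure set X -> \bar R}) (d c : R) (F : R -> X -> R) (S : set X) : measurable S ->
  (forall w, `|w - c| <= `|d| -> m.-integrable S (fun h => (F w h)%:E)) ->
  m.-integrable S (fun h => (diff2 d (F ^~ h) c)%:E) /\
  \int[m]_(h in S) diff2 d (F ^~ h) c = diff2 d (fun w => \int[m]_(h in S) F w h) c.
Proof.
move=> mS iF.
have i1 : m.-integrable S (EFin \o F (c + d)) by apply: iF; rewrite addrC addKr.
have i2 : m.-integrable S (EFin \o F (c - d)) by apply: iF; rewrite addrC addKr normrN.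
have i3 : m.-integrable S (EFin \o F c) by apply: iF; rewrite subrr normr0.
have i4 : m.-integrable S (EFin \o (fun h => F (c + d) h + F (c - d) h)).
  by have := integrableD mS i1 i2; apply: eq_integrable.
have i5 : m.-integrable S (EFin \o (fun h => 2 * F c h)).
  by have := integrableZl mS 2 i3; apply: eq_integrable.
split; first by have := integrableB mS i4 i5; apply: eq_integrable.
by rewrite /diff2 RintegralB// RintegralD// RintegralZl.
Qed.

Variables (mu : probability (measurableTypeR R) R) (a b : R).
Hypotheses (ab : a < b) (mu0 : mu (~` `[a, b]%classic) = 0%E).

Let D := `[a, b]%classic : set (measurableTypeR R).
Let mD : measurable D. Proof. exact: measurable_itv. Qed.

(** The value of the integral in [integral_cube_diff2]. *)
Definition cubeker (L t : R) : R :=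
  L ^+ 2 / 12 + (ln L / 2 - 1 / 2) * t ^+ 2 + 2 * cube t / L - lnabs_int2 t.

Lemma ccubeker L t : L != 0 -> {for t, continuous (cubeker L)}.
Proof.
move=> L0; have c1 := @ccube R t; have c2 := @clnabs_int2 R t.
by rewrite /cubeker; cont.
Qed.

Lemma diff2C (d h : R) (F : R -> R) (x : R) : diff2 d (diff2 h F) x = diff2 h (diff2 d F) x.
Proof.
rewrite /diff2 (addrAC x h d) (addrAC x h (- d)) (addrAC x (- h) d) (addrAC x (- h) (- d)).
by ring.
Qed.

Lemma diff2Zr (d k : R) (F : R -> R) (x : R) :
  diff2 d (fun w => F w * k) x = diff2 d F x * k.
Proof. by rewrite /diff2; ring. Qed.

(** Tonelli, the second differences of [cube] being nonnegative by convexity. *)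
Lemma integral_conv_cube L w : 0 < L -> b - a <= L -> a <= w <= b ->
  (\int[leb]_(h in `]0%R, L[) (diff2 h (conv mu a b (@cube R)) w / h ^+ 2)%:E
   = (conv mu a b (cubeker L) w)%:E)%E.
Proof.
move=> L0 baL hw.
pose g (p : measurableTypeR R * measurableTypeR R) : \bar R :=
  (diff2 (`|p.1|) (@cube R) (p.2 - w) / p.1 ^+ 2)%:E.
have mcube : measurable_fun [set: R] (@cube R).
  by apply: continuous_measurable; exact: ccube.
have mg : measurable_fun setT g.
  apply/measurable_EFinP; apply: measurable_funM; last first.
    by apply: invr_ge0_measurable => [|x]; [exact: measurable_funX|exact: sqr_ge0].
  have m1 : measurable_fun setT (fun p : measurableTypeR R * measurableTypeR R => p.2 - w).
    exact: measurable_funB.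
  have m2 : measurable_fun setT (fun p : measurableTypeR R * measurableTypeR R => `|p.1|).
    exact: measurableT_comp.
  apply: measurable_funB; first apply: measurable_funD.
  - by apply: (measurableT_comp mcube); exact: measurable_funD.
  - by apply: (measurableT_comp mcube); exact: measurable_funB.
  - by apply: measurable_funM => //; exact: (measurableT_comp mcube).
have g0 p : (0 <= g p)%E.
  by rewrite lee_fin divr_ge0 ?sqr_ge0// diff2_cube_ge0.
have mI : measurable (`]0%R, L[%classic : set (measurableTypeR R)) by exact: measurable_itv.
have E1 : (\int[leb]_(h in `]0%R, L[) (diff2 h (conv mu a b (@cube R)) w / h ^+ 2)%:E
    = \int[leb]_(h in `]0%R, L[) \int[mu]_(y in D) g (h, y))%E.
  apply: eq_integral => h /set_mem/=; rewrite in_itv/= => /andP[h0 hL].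
  rewrite /g /= gtr0_norm// -conv_diff2; last exact: ccube.
  have ci t : {for t, continuous (fun t => diff2 h (@cube R) t / h ^+ 2)}.
    exact: (cmul _ (fun=> (h ^+ 2)^-1) t (cdiff2 h _ t (@ccube R)) (ccst _ t)).
  have i1 := conv_integrable mu a b _ w ci.
  have i2 : mu.-integrable D (EFin \o (fun y => diff2 h (@cube R) (y - w))).
    by apply: conv_integrable => t; apply: cdiff2; exact: ccube.
  rewrite -(fineK (integrable_fin_num mD i1)) -/(Rintegral _ _ _).
  by rewrite RintegralZr.
rewrite E1 (tonelli_on _ _ _ _ _ leb mu _ _ g)//.
have E2 : (\int[mu]_(y in D) \int[leb]_(h in `]0%R, L[) g (h, y)
    = \int[mu]_(y in D) (cubeker L (y - w))%:E)%E.
  apply: eq_integral => y /set_mem; rewrite /D /= in_itv/= => hy.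
  rewrite /cubeker -integral_cube_diff2//; last by rewrite ler_norml; lra.
  apply: eq_integral => h /set_mem/=; rewrite in_itv/= => /andP[h0 hL].
  by rewrite /g /= gtr0_norm.
rewrite E2.
have i1 : mu.-integrable D (fun y => (cubeker L (y - w))%:E).
  by apply: conv_integrable => t; apply: ccubeker; rewrite gt_eqF.
by rewrite -(fineK (integrable_fin_num mD i1)).
Qed.

(** The truncated half-Laplacian of the spline at [c] is the fourth
    difference of [cubeker L], in which the polynomial terms of degree at
    most two disappear; what remains is [2 / L] times the spline minus a
    fourth difference of [lnabs_int2]. *)
Lemma spline_fractional (d c L rho : R) : 0 < d -> a <= c - 2 * d -> c + 2 * d <= b ->
  b - a <= L -> rho * d ^+ 4 <= diff2 d (diff2 d (conv mu a b (@lnabs_int2 R))) c ->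
  let f := conv mu a b (spline d) in
  leb.-integrable `]0, L[ (fun h => (diff2 h f c / h ^+ 2)%:E) /\
  \int[leb]_(h in `]0, L[) (diff2 h f c / h ^+ 2) <= 2 * f c / L - rho * d ^+ 4.
Proof.
move=> d0 ac cb baL EL f.
have L0 : 0 < L by lra.
pose Z := conv mu a b (@cube R).
pose T w h := diff2 h Z w / h ^+ 2.
have mI : measurable (`]0%R, L[%classic : set (measurableTypeR R)) by exact: measurable_itv.
have iT w : a <= w <= b -> leb.-integrable `]0, L[ (fun h => (T w h)%:E).
  move=> hw; apply/integrableP; split.
    apply/measurable_EFinP; apply: measurable_funTS; apply: measurable_diff2_quotient.
    by apply: continuous_measurable => t; apply: conv_continuous; exact: ccube.
  rewrite (_ : (\int[leb]_(x in _) _ = \int[leb]_(h in `]0%R, L[) (T w h)%:E)%E).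
    by rewrite integral_conv_cube// ltry.
  apply: eq_integral => h /set_mem/=; rewrite in_itv/= => /andP[h0 hL].
  rewrite ger0_norm// divr_ge0 ?sqr_ge0// /Z -conv_diff2; last exact: ccube.
  by apply: conv_ge0 => t; apply: diff2_cube_ge0; exact: ltW.
have RT w : a <= w <= b -> \int[leb]_(h in `]0, L[) T w h = conv mu a b (cubeker L) w.
  by move=> hw; rewrite /Rintegral integral_conv_cube.
have near_c w w' : `|w - c| <= `|d| -> `|w' - w| <= `|d| -> a <= w' <= b.
  by rewrite (gtr0_norm d0) !ler_norml; lra.
have near_c1 w : `|w - c| <= `|d| -> a <= w <= b.
  by rewrite (gtr0_norm d0) !ler_norml; lra.
have s1 w : `|w - c| <= `|d| -> _ /\ _ :=
  fun h => Rintegral_diff2 _ _ leb d w T _ mI (fun w' h' => iT w' (near_c w w' h h')).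
have [s2 s3] := Rintegral_diff2 _ _ leb d c (fun w h => diff2 d (T ^~ h) w) _ mI (fun w h => (s1 w h).1).
have fE x : f x = diff2 d (diff2 d Z) x.
  rewrite /f /spline conv_diff2; last by move=> t; apply: cdiff2; exact: ccube.
  by congr diff2; apply/funext => y; rewrite conv_diff2//; exact: ccube.
have TE h : diff2 h f c / h ^+ 2 = diff2 d (diff2 d (T ^~ h)) c.
  have -> : f = diff2 d (diff2 d Z) by exact/funext.
  rewrite diff2C (_ : diff2 h _ = diff2 d (diff2 h Z)); last by apply/funext => x; exact: diff2C.
  rewrite -diff2Zr (_ : (fun x => _) = diff2 d (T ^~ h))//.
  by apply/funext => x; rewrite -diff2Zr.
split; first by apply: eq_integrable s2 => // h _; rewrite TE.
under eq_Rintegral do rewrite TE.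
rewrite s3.
have -> : diff2 d (fun w => \int[leb]_(h in `]0, L[) diff2 d (T ^~ h) w) c
  = diff2 d (diff2 d (conv mu a b (cubeker L))) c.
  rewrite {1 3}/diff2 !(s1 _ _).2; last 3 first.
  - by rewrite subrr normr0.
  - by rewrite addrC addKr normrN.
  - by rewrite addrC addKr.
  by rewrite /diff2 !RT//; apply/andP; split; lra.
have ck t : {for t, continuous (cubeker L)} by apply: ccubeker; rewrite gt_eqF.
have ck2 t : {for t, continuous (diff2 d (cubeker L))} by exact: cdiff2.
have cl2 t : {for t, continuous (diff2 d (diff2 d (@lnabs_int2 R)))}.
  by do 2 (apply: cdiff2 => ?); exact: clnabs_int2.
have e4 (G : R -> R) : (forall t, {for t, continuous G}) ->
    diff2 d (diff2 d (conv mu a b G)) c = conv mu a b (diff2 d (diff2 d G)) c.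
  move=> cG; rewrite conv_diff2; last by move=> t; exact: cdiff2.
  by congr diff2; apply/funext => y; rewrite conv_diff2.
rewrite e4//; rewrite e4 in EL; last exact: clnabs_int2.
have kE : diff2 d (diff2 d (cubeker L)) = fun t => 2 / L * spline d t - diff2 d (diff2 d (@lnabs_int2 R)) t.
  by apply/funext => t; rewrite /spline /cubeker /diff2; ring.
rewrite kE /conv RintegralB//.
- rewrite RintegralZl//; first by rewrite -!/(conv mu a b _ _) -/f; lra.
  by apply: conv_integrable => t; exact: cspline.
- have i := conv_integrable mu a b (spline d) c (cspline d).
  by have := integrableZl mD (2 / L) i; apply: eq_integrable.
- exact: conv_integrable.
Qed.
End fractional.

(** * The truncated half-Laplacian of the semicircle *)

Section semicircle_fractional.
Context {R : realType}.
Local Notation leb := (@lebesgue_measure R).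
Implicit Types (m r c z h L : R).

Lemma chi_out m r z : 0 <= r -> r <= `|z - m| -> chi m r z = 0.
Proof.
move=> r0 h; rewrite /chi ler0_sqrtr// subr_le0 -[leRHS]real_normK ?num_real//.
by rewrite lerXn2r ?nnegrE.
Qed.

Lemma chi_tangent_upper m r c z : m - r < c < m + r -> m - r <= z <= m + r ->
  chi m r z <= chi m r c - (c - m) / chi m r c * (z - c).
Proof.
move=> hc hz; have c0 := chi_gt0 _ _ _ hc.
have c2 : chi m r c ^+ 2 = r ^+ 2 - (c - m) ^+ 2 by apply: chi_sqr; lra.
have z2 := chi_sqr _ _ _ hz; have z0 := chi_ge0 m r z.
have -> : chi m r c - (c - m) / chi m r c * (z - c)
    = (chi m r c ^+ 2 - (c - m) * (z - c)) / chi m r c by field; lra.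
rewrite ler_pdivlMr// c2.
move: (chi m r z) (chi m r c) c0 c2 z2 z0 => v u u0 u2 v2 v0.
have N0 : 0 < r ^+ 2 - (c - m) ^+ 2 - (c - m) * (z - c).
  have h1 : 0 <= (m + r - c) * (z - m + r) by apply: mulr_ge0; lra.
  have h2 : 0 <= (c - m + r) * (m + r - z) by apply: mulr_ge0; lra.
  have [v1|v1] := leP m z.
    have : 0 < (m + r - c) * (z - m + r) by apply: mulr_gt0; lra.
    lra.
  have : 0 < (c - m + r) * (m + r - z) by apply: mulr_gt0; lra.
  lra.
have : (v * u) ^+ 2 <= (r ^+ 2 - (c - m) ^+ 2 - (c - m) * (z - c)) ^+ 2.
  rewrite exprMn u2 v2 -subr_ge0; set q := (X in 0 <= X).
  have -> : q = (r * (z - c)) ^+ 2 by rewrite /q; ring.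
  exact: sqr_ge0.
have vu0 : 0 <= v * u by rewrite mulr_ge0// ltW.
by rewrite ler_pXn2r ?nnegrE ?(ltW N0).
Qed.

(** Squaring, [chi z ^2 >= A^2 - (r w / u)^2], where [A] is the value of the
    tangent, [u = chi c] and [w = z - c]. This beats [(A - K w^2)^2] unless
    [A < u / 2], and then [w] is so large that [K w^2] exceeds [A]. *)
Lemma chi_tangent_lower m r c z : m - r < c < m + r ->
  chi m r c - (c - m) / chi m r c * (z - c)
    - 2 * r ^+ 2 / chi m r c ^+ 3 * (z - c) ^+ 2 <= chi m r z.
Proof.
move=> hc; have c0 := chi_gt0 _ _ _ hc.
have c2 : chi m r c ^+ 2 = r ^+ 2 - (c - m) ^+ 2 by apply: chi_sqr; lra.
have z2 : r ^+ 2 - (z - m) ^+ 2 <= chi m r z ^+ 2.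
  rewrite /chi; have [h|h] := leP 0 (r ^+ 2 - (z - m) ^+ 2); first by rewrite sqr_sqrtr.
  by rewrite (le_trans (ltW h))// sqr_ge0.
have z0 := chi_ge0 m r z; move: (chi m r z) (chi m r c) c0 c2 z2 z0 => v u u0 u2 v2 v0.
pose k : R := (c - m) / u; pose K : R := 2 * r ^+ 2 / u ^+ 3; pose w := z - c.
rewrite -/k -/K -/w; pose A : R := u - k * w; rewrite -/A leNgt; apply/negP => H.
have r0 : 0 < r ^+ 2 by nra.
have ku : k * u = c - m by rewrite /k divfK// gt_eqF.
have K0 : 0 < K by rewrite divr_gt0 ?exprn_gt0// mulr_gt0.
have Ku : K * u ^+ 3 = 2 * r ^+ 2 by rewrite /K divfK// expf_neq0// gt_eqF.
have v2' : u ^+ 2 * A ^+ 2 - r ^+ 2 * w ^+ 2 <= u ^+ 2 * v ^+ 2.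
  have -> : u ^+ 2 * A ^+ 2 - r ^+ 2 * w ^+ 2 = u ^+ 2 * (r ^+ 2 - (z - m) ^+ 2).
    have -> : u ^+ 2 * A ^+ 2 = (u ^+ 2 - (k * u) * w) ^+ 2 by rewrite /A; ring.
    by rewrite ku u2 /w; ring.
  by rewrite ler_wpM2l// sqr_ge0.
have w0 : 0 < w ^+ 2.
  rewrite lt_neqAle sqr_ge0 andbT eq_sym sqrf_eq0; apply/eqP => w0.
  move: H v2'; rewrite /A w0 !mulr0 expr0n/= mulr0 !subr0 mulr0 subr0 => H.
  by rewrite ler_pM2l ?exprn_gt0// ler_pXn2r ?nnegrE ?(ltW u0)//; lra.
have T2 : v ^+ 2 < (A - K * w ^+ 2) ^+ 2.
  by rewrite ltrXn2r// ?nnegrE//; lra.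
have : u ^+ 2 * v ^+ 2 < u ^+ 2 * (A - K * w ^+ 2) ^+ 2 by rewrite ltr_pM2l// exprn_gt0.
move=> h1.
have h2 : u ^+ 2 * (K * (2 * A - K * w ^+ 2)) < r ^+ 2.
  have : w ^+ 2 * (u ^+ 2 * (K * (2 * A - K * w ^+ 2))) < w ^+ 2 * r ^+ 2 by lra.
  by rewrite ltr_pM2l.
have AK : K * w ^+ 2 < A by lra.
have h3 : u ^+ 2 * (K * A) < r ^+ 2.
  apply: le_lt_trans h2; rewrite ler_pM2l ?exprn_gt0// ler_pM2l//; lra.
have h4 : A < u / 2.
  rewrite -(ltr_pM2l K0) -(@ltr_pM2l _ (u ^+ 2)) ?exprn_gt0//.
  apply: (lt_le_trans h3); lra.
have h5 : u ^+ 2 / 4 < k ^+ 2 * w ^+ 2.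
  have : u / 2 < k * w by rewrite /A in h4; lra.
  rewrite -exprMn => h; have : (u / 2) ^+ 2 < (k * w) ^+ 2 by rewrite ltrXn2r ?nnegrE//; lra.
  by rewrite expr_div_n; lra.
have k2 : u ^+ 2 * k ^+ 2 <= r ^+ 2 by rewrite -exprMn mulrC ku; have := sqr_ge0 u; lra.
have h6 : u ^+ 2 * (u ^+ 2 / 4) < r ^+ 2 * w ^+ 2.
  have u20 : 0 < u ^+ 2 by rewrite exprn_gt0.
  have : u ^+ 2 * (u ^+ 2 / 4) < u ^+ 2 * (k ^+ 2 * w ^+ 2) by rewrite ltr_pM2l.
  move/lt_le_trans; apply; rewrite mulrA ler_pM2r//.
have h7 : u ^+ 4 / 4 * K < r ^+ 2 * w ^+ 2 * K.
  by rewrite ltr_pM2r// (le_lt_trans _ h6)//; lra.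
have h9 : r ^+ 2 * (K * w ^+ 2) < r ^+ 2 * A by rewrite ltr_pM2l.
have e4 : u ^+ 4 / 4 * K = u / 4 * (K * u ^+ 3) by ring.
have h8 : r ^+ 2 * (u / 2) < r ^+ 2 * A by rewrite e4 Ku in h7; lra.
by move: h8; rewrite ltr_pM2l//; lra.
Qed.

Lemma chi_diff2_lower m r c h : m - r < c < m + r ->
  - (4 * r ^+ 2 / chi m r c ^+ 3) * h ^+ 2 <= diff2 h (chi m r) c.
Proof.
move=> hc; have := chi_tangent_lower m r c (c + h) hc; have := chi_tangent_lower m r c (c - h) hc.
have -> : c - h - c = - h by ring.
have -> : c + h - c = h by ring.
have -> : 4 * r ^+ 2 / chi m r c ^+ 3 = 2 * (2 * r ^+ 2 / chi m r c ^+ 3) by ring.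
by rewrite sqrrN /diff2; lra.
Qed.

Lemma chi_diff2_upper m r c h : m - r < c < m + r -> m - r <= c - h -> c + h <= m + r ->
  0 <= h -> diff2 h (chi m r) c <= 0.
Proof.
move=> hc h1 h2 h0.
have : chi m r (c + h) <= chi m r c - (c - m) / chi m r c * (c + h - c).
  by apply: chi_tangent_upper => //; lra.
have : chi m r (c - h) <= chi m r c - (c - m) / chi m r c * (c - h - c).
  by apply: chi_tangent_upper => //; lra.
have -> : c - h - c = - h by ring.
have -> : c + h - c = h by ring.
by rewrite /diff2; lra.
Qed.

Lemma chi_reflect m r c h : diff2 h (chi m r) (2 * m - c) = diff2 h (chi m r) c.
Proof.
have e z : chi m r (2 * m - z) = chi m r z by rewrite /chi; congr Num.sqrt; ring.
rewrite /diff2 -(e (c + h)) -(e (c - h)) -(e c).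
have -> : 2 * m - (c + h) = 2 * m - c - h by ring.
have -> : 2 * m - (c - h) = 2 * m - c + h by ring.
by ring.
Qed.

(** The second difference of [chi] divided by [h^2] integrates by parts to
    [- diff2 h chi c / h] plus antiderivatives [asn] and [Lg] of
    [chi' (c + h) / h] and [chi' (c - h) / h]. Both singularities at [h = 0]
    cancel. The ends of the interval are reached from [c] at the distances
    [h1] and [h2], and [chi] vanishes beyond. The constant [K] makes the
    integrand nonnegative. *)
Lemma chi_fractional m r c L K : m - r < c < m + r -> 2 * r <= L ->
  K = 4 * r ^+ 2 / chi m r c ^+ 3 ->
  (\int[leb]_(h in `]0%R, L[) (K + diff2 h (chi m r) c / h ^+ 2)%:E
   = (K * L + 2 * chi m r c / L - pi)%R%:E)%E.
Proof.
move=> hc0 rL KE0.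
wlog : c hc0 KE0 / m <= c => [W|mc].
  have [|cm] := leP m c; first exact: W.
  have e : chi m r (2 * m - c) = chi m r c by rewrite /chi; congr Num.sqrt; ring.
  have := W (2 * m - c); rewrite e => <-//; [|lra|lra].
  by apply: eq_integral => h _; rewrite chi_reflect.
have hc := hc0; have x0 := chi_gt0 _ _ _ hc.
pose x := chi m r c.
have D0 h : 0 < h -> 0 <= K + diff2 h (chi m r) c / h ^+ 2.
  move=> h0; have := chi_diff2_lower m r c h hc; rewrite -KE0 => H.
  by rewrite -lerBlDl sub0r ler_pdivlMr// exprn_gt0.
have cch z : {for z, continuous (chi m r)} := cchi m r z.
have mf : measurable_fun [set: R] (fun h => K + diff2 h (chi m r) c / h ^+ 2).
  apply: measurable_funD => //; apply: measurable_diff2_quotient.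
  exact: continuous_measurable.
pose h1 := m + r - c; pose h2 := c - m + r.
have h10 : 0 < h1 by rewrite /h1; lra.
have h12 : h1 <= h2 by rewrite /h1 /h2; lra.
have h2L : h2 <= L by rewrite /h2; lra.
pose k : R := (c - m) / x.
(* antiderivatives while two, one or none of [c + h] and [c - h] are inside *)
pose F1 h : R := K * h - diff2 h (chi m r) c / h
  + (asn m r (c - h) - asn m r (c + h) + k * (Lg m r (c + h) c - Lg m r (c - h) c)).
pose F2 h : R := K * h - (chi m r (c - h) - 2 * x) / h
  + (asn m r (c - h) - pi / 2 - k * Lg m r (c - h) c).
pose majorant h : R := K * h + 2 * x / h - pi.
have r0 : 0 < r by lra.
have cp (F : R -> R) (h : R) : {for c + h, continuous F} -> {for h, continuous (fun h => F (c + h))}.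
  move=> cF; have c1 : {for h, continuous (fun h : R => c + h)} by cont.
  exact: (ccomp F (fun h => c + h) h cF c1).
have cm (F : R -> R) (h : R) : {for c - h, continuous F} -> {for h, continuous (fun h => F (c - h))}.
  move=> cF; have c1 : {for h, continuous (fun h : R => c - h)} by cont.
  exact: (ccomp F (fun h => c - h) h cF c1).
have dp (F : R -> R) (h df : R) : is_derive (c + h) 1 F df -> is_derive h 1 (fun h => F (c + h)) df.
  move=> dF; have d1 : is_derive h 1 (fun h : R => c + h) 1.
    by have := dadd _ _ _ _ _ (dcst c h) (did h); rewrite add0r.
  by have := @dcomp R F (fun h => c + h) h _ _ dF d1; rewrite mulr1.
have dm (F : R -> R) (h df : R) : is_derive (c - h) 1 F df -> is_derive h 1 (fun h => F (c - h)) (- df).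
  move=> dF; have d1 : is_derive h 1 (fun h : R => c - h) (- 1).
    by have := dadd _ _ _ _ _ (dcst c h) (dopp _ _ _ (did h)); rewrite add0r.
  by have := @dcomp R F (fun h => c - h) h _ _ dF d1; rewrite mulrN1.
have E1 : (\int[leb]_(h in `]0%R, h1[) (K + diff2 h (chi m r) c / h ^+ 2)%:E = (F1 h1 - 0)%:E)%E.
  apply: (ge0_FTC2_open R (fun h => K + diff2 h (chi m r) c / h ^+ 2) F1 0 h1 0 (F1 h1) h10).
  - by move=> h /andP[h0 _]; exact: D0.
  - move=> h /andP[h0 _]; rewrite /diff2.
    have e1 := cp _ h (cch (c + h)); have e2 := cm _ h (cch (c - h)).
    by cont; rewrite gt_eqF// exprn_gt0.
  - move=> h hh; have hp : m - r < c + h < m + r by rewrite /h1 in hh; lra.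
    have hm : m - r < c - h < m + r by rewrite /h1 in hh; lra.
    have np : c + h != c by rewrite gt_eqF//; lra.
    have nm : c - h != c by rewrite lt_eqF//; lra.
    have e1 := dp _ h _ (dchi _ _ _ hp); have e2 := dm _ h _ (dchi _ _ _ hm).
    have e3 := dp _ h _ (dasn _ _ _ r0 hp); have e4 := dm _ h _ (dasn _ _ _ r0 hm).
    have e5 := dp _ h _ (dLg _ _ _ _ hc hp np); have e6 := dm _ h _ (dLg _ _ _ _ hc hm nm).
    have hn : h != 0 by rewrite gt_eqF//; lra.
    dstart; first by rewrite /F1 /diff2; der.
    have p0 := chi_gt0 _ _ _ hp; have m0 := chi_gt0 _ _ _ hm.
    rewrite /k /x /diff2 /=.
    have -> : c - (c + h) = - h by ring.
    have -> : c - (c - h) = h by ring.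
    by field; rewrite hn (gt_eqF m0) (gt_eqF p0) (gt_eqF x0).
  - pose N h := asn m r (c - h) - asn m r (c + h)
      + k * (ln (num m r (c + h) c) - ln (num m r (c - h) c)).
    pose Q h := K * h - diff2 h (chi m r) c / h.
    have N0 : N h @[h --> 0^'+] --> 0.
      have N00 : N 0 = 0 by rewrite /N !(addr0, subr0) !subrr mulr0 addr0.
      rewrite -[X in _ --> X]N00.
      apply: cvg_at_right_filter.
      have n0 z : m - r <= z <= m + r -> 0 < num m r z c by exact: num_gt0.
      have cn z : {for z, continuous (fun z => num m r z c)}.
        by have cz := cch z; rewrite /num; cont.
      have e1 := cm _ 0 (casn m r (c - 0) r0); have e2 := cp _ 0 (casn m r (c + 0) r0).
      have e3 := cp _ 0 (cn (c + 0)); have e4 := cm _ 0 (cn (c - 0)).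
      have e5 : {for 0, continuous N}.
        by rewrite /N; cont; apply: n0; lra.
      exact: e5.
    have Q0 : Q h @[h --> 0^'+] --> 0.
      apply: (@squeeze_cvgr _ _ _ _ (fun=> 0) (fun h => 2 * K * h)).
      - near=> h; have h0 : 0 < h by near: h; exact: nbhs_right_gt.
        have hh1 : h < h1 by near: h; exact: nbhs_right_lt.
        have up : diff2 h (chi m r) c <= 0.
          by apply: chi_diff2_upper => //; rewrite /h1 in hh1; lra.
        have lo := chi_diff2_lower m r c h hc; rewrite -KE0 in lo.
        have K0 : 0 <= K * h.
          by rewrite KE0 mulr_ge0 ?(ltW h0)// divr_ge0 ?exprn_ge0 ?(ltW x0)// mulr_ge0 ?sqr_ge0.
        have a1 : diff2 h (chi m r) c / h <= 0 by rewrite ler_pdivrMr// mul0r.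
        have a2 : - (K * h) <= diff2 h (chi m r) c / h by rewrite ler_pdivlMr//; lra.
        by rewrite /Q; apply/andP; split; lra.
      - exact: cvg_cst.
      - rewrite -[X in _ --> X](mulr0 (2 * K)).
        apply: cvg_at_right_filter.
        have e5 : {for 0, continuous (fun h : R => 2 * K * h)} by cont.
        exact: e5.
    have QN : (fun h => Q h + N h) h @[h --> 0^'+] --> 0.
      by rewrite -[X in _ --> X](addr0 0); exact: cvgD Q0 N0.
    have E : {near 0^'+, (fun h => Q h + N h) =1 F1}; last first.
      exact: (cvg_trans (near_eq_cvg E) QN).
    near=> h; have h0 : 0 < h by near: h; exact: nbhs_right_gt.
    rewrite /F1 /Q /N /=; congr (_ + (_ + k * _)); symmetry.
    rewrite /Lg (_ : c + h - c = h); last ring.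
    by rewrite (_ : c - h - c = - h); [rewrite normrN; ring|ring].
  - have e1 : {for h1, continuous F1}.
      have hp : m - r <= c + h1 <= m + r by rewrite /h1; lra.
      have hm : m - r <= c - h1 <= m + r by rewrite /h1; lra.
      have np : c + h1 != c by rewrite gt_eqF//; lra.
      have nm : c - h1 != c by rewrite lt_eqF//; lra.
      have a1 := cp _ h1 (cch (c + h1)); have a2 := cm _ h1 (cch (c - h1)).
      have a3 := cp _ h1 (casn m r (c + h1) r0); have a4 := cm _ h1 (casn m r (c - h1) r0).
      have a5 := cp _ h1 (cLg _ _ _ _ hc hp np); have a6 := cm _ h1 (cLg _ _ _ _ hc hm nm).
      by rewrite /F1 /diff2; cont; rewrite gt_eqF.
    by apply: cvg_at_left_filter; exact: e1.
have E2 : (\int[leb]_(h in `]h1, h2[) (K + diff2 h (chi m r) c / h ^+ 2)%:E = (F2 h2 - F2 h1)%:E)%E.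
  have cp0 h : h1 <= h -> chi m r (c + h) = 0.
    by rewrite /h1 => hh; rewrite chi_out//; [lra|rewrite ger0_norm; lra].
  apply: (ge0_FTC2_except R [::] (fun h => K + diff2 h (chi m r) c / h ^+ 2) F2 h1 h2 h12 mf).
  - by move=> h hh; apply: D0; lra.
  - move=> h hh; have e2 := cm _ h (cch (c - h)).
    have e4 := cm _ h (casn m r (c - h) r0).
    have e6 : {for h, continuous (fun h => Lg m r (c - h) c)}.
      apply: (cm (fun z => Lg m r z c)); apply: cLg => //; first by rewrite /h2 in hh; lra.
      by rewrite lt_eqF//; lra.
    by rewrite /F2; cont; rewrite gt_eqF//; lra.
  - move=> h hh _; rewrite /diff2.
    have e1 := cp _ h (cch (c + h)); have e2 := cm _ h (cch (c - h)).
    by cont; rewrite gt_eqF// exprn_gt0//; lra.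
  - move=> h hh _; rewrite /diff2 cp0; last lra.
    have hm : m - r < c - h < m + r by rewrite /h2 in hh; lra.
    have nm : c - h != c by rewrite lt_eqF//; lra.
    have e2 := dm _ h _ (dchi _ _ _ hm); have e4 := dm _ h _ (dasn _ _ _ r0 hm).
    have e6 := dm _ h _ (dLg _ _ _ _ hc hm nm).
    have hn : h != 0 by rewrite gt_eqF//; lra.
    dstart; first by rewrite /F2; der.
    have m0 := chi_gt0 _ _ _ hm.
    rewrite /k /x /=.
    have -> : c - (c - h) = h by ring.
    by field; rewrite hn (gt_eqF m0) (gt_eqF x0).
have E3 : (\int[leb]_(h in `]h2, L[) (K + diff2 h (chi m r) c / h ^+ 2)%:E = (majorant L - majorant h2)%:E)%E.
  have cp0 h : h2 <= h -> diff2 h (chi m r) c = - 2 * x.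
    rewrite /h2 => hh; rewrite /diff2 (chi_out m r (c + h)) ?(ltW r0)//; last first.
      by rewrite ger0_norm; lra.
    rewrite (chi_out m r (c - h)) ?(ltW r0)//; first by rewrite /x; ring.
    by rewrite ler0_norm; lra.
  apply: (ge0_FTC2_except R [::] (fun h => K + diff2 h (chi m r) c / h ^+ 2) majorant h2 L h2L mf).
  - by move=> h hh; apply: D0; lra.
  - by move=> h hh; rewrite /majorant; cont; rewrite gt_eqF//; lra.
  - move=> h hh _; rewrite /diff2.
    have e1 := cp _ h (cch (c + h)); have e2 := cm _ h (cch (c - h)).
    by cont; rewrite gt_eqF// exprn_gt0//; lra.
  - move=> h hh _; rewrite cp0; last lra.
    have hn : h != 0 by rewrite gt_eqF//; lra.
    by dstart; [rewrite /majorant; der|rewrite /=; field].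
have D0' h : 0 < h < L -> 0 <= K + diff2 h (chi m r) c / h ^+ 2 by move=> /andP[? _]; exact: D0.
rewrite (ge0_integral_split R _ 0 L h1)//; last by lra.
rewrite (ge0_integral_split R _ h1 L h2)//; [|lra|by move=> h hh; apply: D0; lra].
rewrite E1 E2 E3 -!EFinD; congr (_%:E).
have e1 : F1 h1 = F2 h1.
  rewrite /F1 /F2 /diff2 (_ : c + h1 = m + r); last by rewrite /h1; ring.
  by rewrite chi_right asn_right// Lg_right// /x; ring.
have e2 : F2 h2 = majorant h2.
  rewrite /F2 /majorant (_ : c - h2 = m - r); last by rewrite /h2; ring.
  by rewrite chi_left asn_left// Lg_left//; field; lra.
by rewrite e1 e2 /majorant /x; ring.
Unshelve. all: by end_near. Qed.
End semicircle_fractional.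

(** * Domination of the semicircle density *)

Section lower_bound.
Context {R : realType}.
Local Notation leb := (@lebesgue_measure R).
Variables (mu : probability (measurableTypeR R) R) (a b rho : R).
Hypotheses (ab : a < b) (rho0 : 0 < rho) (mu0 : mu (~` `[a, b]%classic) = 0%E).
Hypothesis EL : forall c d, 0 < d -> a <= c - 2 * d -> c + 2 * d <= b ->
  rho * d ^+ 4 <= diff2 d (diff2 d (conv mu a b (@lnabs_int2 R))) c.

Let D := `[a, b]%classic : set (measurableTypeR R).
Let mD : measurable D. Proof. exact: measurable_itv. Qed.
Let mI (x y : R) : measurable (`]x, y[%classic : set (measurableTypeR R)).
Proof. exact: measurable_itv. Qed.

(** The minimum principle: at a minimum [c] of the difference [g] the second
    differences of the spline average dominate those of the semicircle, and
    the comparison of [spline_fractional] with [chi_fractional] gives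
    [g c >= 0]. No boundary term appears because [chi] is defined, and zero,
    outside its interval, where the spline average is nonnegative. *)
Lemma spline_ge_semicircle (d m r x : R) : 0 < d -> 0 < r ->
  a + 2 * d <= m - r -> m + r <= b - 2 * d ->
  d ^+ 4 * (rho / pi) * chi m r x <= conv mu a b (spline d) x.
Proof.
move=> d0 r0 har hrb; pose f := conv mu a b (spline d).
pose k : R := d ^+ 4 * (rho / pi).
have pi0 : 0 < pi :> R := pi_gt0 R.
have k0 : 0 < k by rewrite mulr_gt0 ?exprn_gt0// divr_gt0.
pose g z := f z - k * chi m r z.
have cf z : {for z, continuous f} by apply: conv_continuous; exact: cspline.
have cg z : {for z, continuous g}.
  by have c1 := cf z; have c2 := cchi m r z; rewrite /g; cont.
have f0 z : 0 <= f z by apply: conv_ge0 => t; exact: spline_ge0.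
rewrite -subr_ge0 -/f -/k -/(g x).
have mr : m - r <= m + r by lra.
have [c cI cmin] := EVT_min mr (continuous_in_subspaceT (fun z _ => cg z)).
have gout z : ~~ (m - r < z < m + r) -> 0 <= g z.
  move=> hz; rewrite /g chi_out ?(ltW r0)// ?mulr0 ?subr0//.
  by rewrite leNgt ltr_norml; apply: contra hz; lra.
suff gc : 0 <= g c.
  have [hx|hx] := boolP (m - r < x < m + r); last exact: gout.
  by apply: (le_trans gc); apply: cmin; rewrite in_itv/=; lra.
have [hc|hc] := boolP (m - r < c < m + r); last exact: gout.
rewrite leNgt; apply/negP => gc0.
have gmin z : g c <= g z.
  have [hz|hz] := boolP (m - r < z < m + r); first by apply: cmin; rewrite in_itv/=; lra.
  by apply: (le_trans (ltW gc0)); exact: gout.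
pose L := b - a.
have L0 : 0 < L by rewrite /L; lra.
have [iF IF] : leb.-integrable `]0, L[ (fun h => (diff2 h f c / h ^+ 2)%:E) /\
    \int[leb]_(h in `]0, L[) (diff2 h f c / h ^+ 2) <= 2 * f c / L - rho * d ^+ 4.
  by apply: (spline_fractional mu a b d c L rho d0); [lra|lra|rewrite /L; lra|apply: EL => //; lra].
(* adding [K] makes the integrand of the semicircle nonnegative *)
pose K : R := 4 * r ^+ 2 / chi m r c ^+ 3.
have rL : 2 * r <= L by rewrite /L; lra.
have IS := chi_fractional m r c L K hc rL erefl.
have iK : leb.-integrable `]0, L[ (EFin \o cst (k * K)).
  apply/integrableP; split; first by apply/measurable_EFinP; exact: measurable_cst.
  rewrite (_ : (\int[leb]_(x in _) _ = \int[leb]_(x in `]0%R, L[) cst (`|k * K|%:E) x)%E)//.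
  by rewrite integral_cst//= lebesgue_measure_itv/= lte_fin L0 -EFinB -EFinM ltry.
have IS' : (\int[leb]_(h in `]0%R, L[) (k * (K + diff2 h (chi m r) c / h ^+ 2))%:E
   = (k * (K * L + 2 * chi m r c / L - pi))%R%:E)%E.
  have mfS : measurable_fun [set: R] (fun h => K + diff2 h (chi m r) c / h ^+ 2).
    apply: measurable_funD => //; apply: measurable_diff2_quotient.
    by apply: continuous_measurable; exact: cchi.
  have K0 h : `]0, L[%classic h -> 0 <= K + diff2 h (chi m r) c / h ^+ 2.
    rewrite /= in_itv/= => /andP[h0 _]; have H := chi_diff2_lower m r c h hc.
    by rewrite -lerBlDl sub0r ler_pdivlMr ?exprn_gt0.
  rewrite EFinM -IS -ge0_integralZl//.
  - by apply: measurable_funTS; exact/measurable_EFinP.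
  - by rewrite lee_fin ltW.
have le1 : (\int[leb]_(h in `]0%R, L[) (k * (K + diff2 h (chi m r) c / h ^+ 2))%:E
    <= \int[leb]_(h in `]0%R, L[) ((k * K)%:E + (diff2 h f c / h ^+ 2)%:E))%E.
  apply: ge0_le_integral_pointwise => h; rewrite /= in_itv/= => /andP[h0 hL].
    rewrite lee_fin mulr_ge0 ?(ltW k0)//; have H := chi_diff2_lower m r c h hc.
    by rewrite -lerBlDl sub0r ler_pdivlMr ?exprn_gt0.
  rewrite -EFinD lee_fin mulrDr lerD2l mulrA ler_pM2r ?invr_gt0 ?exprn_gt0//.
  have := gmin (c + h); have := gmin (c - h); rewrite /g /diff2; lra.
rewrite IS' integralD// in le1.
have iFf : (\int[leb]_(h in `]0%R, L[) (diff2 h f c / h ^+ 2)%:E)%E \is a fin_num.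
  exact: integrable_fin_num.
rewrite -(fineK iFf) in le1.
rewrite [X in (_ <= X + _)%E](_ : _ = (k * K * L)%:E)%E in le1; last first.
  by rewrite integral_cst//= lebesgue_measure_itv/= lte_fin L0 -EFinB subr0.
rewrite -EFinD lee_fin in le1.
rewrite -/(Rintegral _ _ _) in le1.
have kpi : k * pi = rho * d ^+ 4 by rewrite /k mulrA divfK ?gt_eqF// mulrC.
have : k * (2 * chi m r c / L) <= 2 * f c / L by lra.
have -> : k * (2 * chi m r c / L) = 2 / L * (k * chi m r c) by ring.
have -> : 2 * f c / L = 2 / L * f c by ring.
rewrite ler_pM2l ?divr_gt0//.
by move: gc0; rewrite /g; lra.
Qed.

Lemma chi_radius_le (m r r' e x : R) : 0 <= e -> r ^+ 2 - r' ^+ 2 <= e ^+ 2 ->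
  chi m r x <= chi m r' x + e.
Proof.
move=> e0 he; have u0 := chi_ge0 m r' x.
rewrite -(@ler_pXn2r _ 2) ?nnegrE ?chi_ge0 ?addr_ge0//.
have [h|h] := leP 0 (r ^+ 2 - (x - m) ^+ 2); last first.
  by rewrite {1}/chi ler0_sqrtr ?(ltW h)// expr0n/= sqr_ge0.
rewrite {1}/chi sqr_sqrtr//.
have h2 : r' ^+ 2 - (x - m) ^+ 2 <= chi m r' x ^+ 2.
  rewrite /chi; have [h'|h'] := leP 0 (r' ^+ 2 - (x - m) ^+ 2); first by rewrite sqr_sqrtr.
  by rewrite (le_trans (ltW h'))// sqr_ge0.
have : 0 <= chi m r' x * e by rewrite mulr_ge0.
lra.
Qed.

(** After Tonelli the inner integral of the spline is [d^4], and on its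
    support [psi] varies by at most [2 d C]. *)
Lemma integral_spline_le (psi : R -> R) (d C : R) : 0 < d -> 0 <= C -> continuous psi ->
  (forall x, 0 <= psi x) ->
  (forall x y, a <= x <= b -> a <= y <= b -> psi x <= psi y + C * `|x - y|) ->
  (\int[leb]_(x in `]a, b[) (psi x * conv mu a b (spline d) x)%:E
   <= (d ^+ 4)%:E * (\int[mu]_(y in D) (psi y)%:E + (C * (2 * d))%:E))%E.
Proof.
move=> d0 C0 cpsi psi0 lip.
have mpsi : measurable_fun [set: R] psi by apply: continuous_measurable; exact: cpsi.
have mspl : measurable_fun [set: R] (spline d) by apply: continuous_measurable; exact: cspline.
pose g (p : measurableTypeR R * measurableTypeR R) : \bar R :=
  (psi p.1 * spline d (p.2 - p.1))%:E.
have mg : measurable_fun setT g.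
  apply/measurable_EFinP; apply: measurable_funM; first exact: (measurableT_comp mpsi).
  by apply: (measurableT_comp mspl); exact: measurable_funB.
have g0 p : (0 <= g p)%E by rewrite lee_fin mulr_ge0// spline_ge0.
have -> : (\int[leb]_(x in `]a, b[) (psi x * conv mu a b (spline d) x)%:E
    = \int[leb]_(x in `]a, b[) \int[mu]_(y in D) g (x, y))%E.
  apply: eq_integral => x _.
  have i1 := conv_integrable mu a b (spline d) x (cspline d).
  have i2 : mu.-integrable D (EFin \o (fun y => psi x * spline d (y - x))).
    by have := integrableZl mD (psi x) i1; apply: eq_integrable.
  rewrite /g /= -(fineK (integrable_fin_num mD i2)) -/(Rintegral _ _ _).
  by rewrite RintegralZl.
rewrite (tonelli_on _ _ _ _ _ leb mu _ _ g)//.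
have mpe : measurable_fun D (fun y => (psi y)%:E).
  by apply: measurable_funTS; exact/measurable_EFinP.
have -> : ((d ^+ 4)%:E * (\int[mu]_(y in D) (psi y)%:E + (C * (2 * d))%:E)
    = \int[mu]_(y in D) ((d ^+ 4)%:E * (psi y + C * (2 * d))%:E))%E.
  rewrite ge0_integralZl//; last 3 first.
  - by apply: measurable_funTS; apply/measurable_EFinP; exact: measurable_funD.
  - by move=> y _; rewrite lee_fin addr_ge0// !mulr_ge0// ltW.
  - by rewrite lee_fin exprn_ge0// ltW.
  congr (_ * _)%E; under [RHS]eq_integral do rewrite EFinD.
  rewrite ge0_integralD//; last 2 first.
  - by move=> y _; rewrite lee_fin psi0.
  - by move=> y _; rewrite lee_fin !mulr_ge0// ltW.
  congr (_ + _)%E; rewrite integral_cst//.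
  by rewrite [X in (_ * X)%E](muD mu a b mu0) mule1.
apply: ge0_le_integral_pointwise => y; rewrite /D /= in_itv/= => hy.
  by apply: integral_ge0 => x _; exact: g0.
have -> : (d ^+ 4)%:E = (\int[leb]_x (spline d (x - y))%:E)%E.
  rewrite (integral_shift R (EFin \o spline d) (- y)).
  - by rewrite integral_spline.
  - exact/measurable_EFinP.
  - by move=> x; rewrite lee_fin spline_ge0.
rewrite -ge0_integralZr//; last 3 first.
- by apply/measurable_EFinP; apply: (measurableT_comp mspl); exact: measurable_funB.
- by move=> x _; rewrite lee_fin spline_ge0.
- by rewrite lee_fin addr_ge0// !mulr_ge0// ltW.
rewrite [leLHS]integral_mkcond; apply: ge0_le_integral_pointwise => x _; rewrite patchE.
  by case: ifP.
have r0 : (0 <= (spline d (x - y))%:E * (psi y + C * (2 * d))%:E)%E.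
  by rewrite -EFinM lee_fin mulr_ge0 ?spline_ge0// addr_ge0// !mulr_ge0// ltW.
case: ifPn => [/set_mem|_]; last exact: r0.
rewrite /= in_itv/= => hx; rewrite /g -EFinM lee_fin /=.
rewrite -(opprB x y) splineN mulrC.
have [h|h] := leP (2 * d) `|x - y|; first by rewrite spline_out// !mul0r.
rewrite ler_wpM2l ?spline_ge0//.
have hx' : a <= x <= b by lra.
apply: (le_trans (lip x y hx' hy)); rewrite lerD2l ler_wpM2l//; exact: ltW.
Qed.

(** The radius is shrunk by [2 d] so that [spline_ge_semicircle] applies up
    to the endpoints; [chi_radius_le] controls the change of [chi], and [d]
    is chosen in terms of the error [e0]. *)
Lemma integral_semicircle_le (psi : R -> R) (C : R) : 0 <= C -> continuous psi ->
  (forall x, 0 <= psi x) ->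
  (forall x y, a <= x <= b -> a <= y <= b -> psi x <= psi y + C * `|x - y|) ->
  (\int[leb]_(x in `]a, b[) (rho / pi * (psi x * chi ((a + b) / 2) ((b - a) / 2) x))%:E
   <= \int[mu]_(y in D) (psi y)%:E)%E.
Proof.
move=> C0 cpsi psi0 lip; pose m : R := (a + b) / 2; pose r0 : R := (b - a) / 2.
have pi0 : 0 < pi :> R := pi_gt0 R.
pose k : R := rho / pi; have k0 : 0 < k by rewrite divr_gt0.
have mpsi : measurable_fun [set: R] psi by apply: continuous_measurable; exact: cpsi.
have [B hB] := continuous_bounded_itv psi a b cpsi.
have B0 : 0 <= B by rewrite (le_trans _ (hB a _))// lexx ltW.
have ba : 0 < b - a by rewrite subr_gt0.
have r00 : 0 < r0 by rewrite /r0 divr_gt0.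
pose Q : R := C * 2 + k * B * (b - a).
have kB : 0 <= k * B by rewrite mulr_ge0// ltW.
have kBab : 0 <= k * B * (b - a) by rewrite mulr_ge0// subr_ge0 ltW.
have Q0 : 0 <= Q by rewrite /Q; lra.
apply/lee_addgt0Pr => e0 he0.
have r04 : 0 < 4 * r0 by rewrite mulr_gt0.
pose e : R := e0 / (Q + 1).
have e_gt0 : 0 < e by rewrite divr_gt0//; lra.
(* [d <= e ^+ 2 / (4 * r0)] keeps the change of [chi] below [e] *)
pose d : R := Num.min e (Num.min (r0 / 4) (e ^+ 2 / (4 * r0))).
have d0 : 0 < d.
  by rewrite !lt_min e_gt0 divr_gt0//= divr_gt0 ?exprn_gt0.
have de : d <= e by rewrite ge_min lexx.
have dr : d <= r0 / 4 by rewrite !ge_min lexx orbT.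
have de2 : 4 * r0 * d <= e ^+ 2.
  have : d <= e ^+ 2 / (4 * r0) by rewrite !ge_min lexx !orbT.
  by rewrite ler_pdivlMr//; lra.
pose r : R := r0 - 2 * d.
have chile x : chi m r0 x <= chi m r x + e.
  apply: chi_radius_le; first exact: ltW.
  rewrite /r; apply: (le_trans _ de2).
  have : 0 <= d ^+ 2 by exact: sqr_ge0.
  lra.
have fS x : k * chi m r x <= conv mu a b (spline d) x / d ^+ 4.
  rewrite ler_pdivlMr ?exprn_gt0// mulrC mulrA.
  by apply: spline_ge_semicircle => //; rewrite /r /m /r0 in dr *; lra.
have I1 := integral_spline_le psi d C d0 C0 cpsi psi0 lip.
pose f := conv mu a b (spline d).
have mf : measurable_fun [set: R] f.
  by apply: continuous_measurable => t; apply: conv_continuous; exact: cspline.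
have f0 x : 0 <= f x by apply: conv_ge0 => t; exact: spline_ge0.
apply: (@le_trans _ _ (\int[leb]_(x in `]a, b[)
    ((d ^+ 4)^-1%:E * (psi x * f x)%:E + (k * B * e)%:E))%E).
  apply: ge0_le_integral_pointwise => x; rewrite /= in_itv/= => hx.
    by rewrite lee_fin mulr_ge0 ?(ltW k0)// mulr_ge0// chi_ge0.
  rewrite -EFinM -EFinD lee_fin.
  have pB : psi x <= B by rewrite -[leLHS]ger0_norm//; apply: hB; rewrite !ltW//; lra.
  have h1 : psi x * (k * chi m r x) <= psi x * (f x / d ^+ 4) by rewrite ler_wpM2l// fS.
  have h2 : k * psi x * chi m r0 x <= k * psi x * (chi m r x + e).
    by rewrite ler_wpM2l// mulr_ge0// ltW.
  have h3 : k * e * psi x <= k * e * B by rewrite ler_wpM2l// mulr_ge0 ?ltW.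
  rewrite -/m -/r0 -/k; lra.
have d40 : 0 <= (d ^+ 4)^-1 by rewrite invr_ge0 exprn_ge0// ltW.
have mpf : measurable_fun (`]a, b[%classic : set (measurableTypeR R)) (fun x => (psi x * f x)%:E).
  by apply: measurable_funTS; apply/measurable_EFinP; exact: measurable_funM.
rewrite ge0_integralD//; last 3 first.
- by move=> x _; rewrite mule_ge0// lee_fin// mulr_ge0.
- by apply: emeasurable_funM.
- by move=> x _; rewrite lee_fin; exact: (mulr_ge0 kB (ltW e_gt0)).
rewrite ge0_integralZl//; last by move=> x _; rewrite lee_fin mulr_ge0.
have -> : (\int[leb]_(x in `]a, b[) (k * B * e)%:E)%E = (k * B * e * (b - a))%:E.
  by rewrite integral_cst//= lebesgue_measure_itv/= lte_fin ab -EFinB.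
set J := (\int[mu]_(y in D) _)%E in I1 *.
have J0 : (0 <= J)%E by apply: integral_ge0 => y _; rewrite lee_fin.
apply: (@le_trans _ _ (J + (C * (2 * d))%:E + (k * B * e * (b - a))%:E)%E).
  rewrite leeD2r//; apply: (@le_trans _ _ ((d ^+ 4)^-1%:E * ((d ^+ 4)%:E * (J + (C * (2 * d))%:E)))%E).
    by rewrite lee_wpmul2l// lee_fin.
  by rewrite muleA -EFinM mulVf ?mul1e// expf_neq0// gt_eqF.
rewrite -addeA leeD2l// -EFinD lee_fin.
have h1 : C * (2 * d) <= C * (2 * e) by rewrite ler_wpM2l//; lra.
have h2 : e * (Q + 1) = e0 by rewrite /e divfK// gt_eqF//; lra.
by rewrite /Q in h2; lra.
Qed.

End lower_bound.

(** * Convex fields and the inequality *)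

Section convex_facts.
Context {R : realType}.

Lemma convex_functionP (F : R -> R) (x y t : R) :
  convex_function [set: R^o] (F : R^o -> R^o) -> 0 <= t <= 1 ->
  F (t * x + (1 - t) * y) <= t * F x + (1 - t) * F y.
Proof.
move=> cF /andP[t0 t1]; have := cF (Itv01 t0 t1) x y.
by rewrite !inE => /(_ Logic.I Logic.I).
Qed.

(** The increments of a convex function over [[x - 1, x + 1]] are controlled
    by those between [x] and [x + 1], [x - 1]; the lower bound writes [x] as
    a barycentre of [x + s h] and [x - s]. *)
Lemma convex_slopes (F : R -> R) (x h s : R) :
  (forall x y t : R, 0 <= t <= 1 -> F (t * x + (1 - t) * y) <= t * F x + (1 - t) * F y) ->
  0 <= h <= 1 -> (s == 1) || (s == -1) ->
  `|F (x + s * h) - F x| <= h * (`|F (x + 1) - F x| + `|F (x - 1) - F x|).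
Proof.
move=> cF hh hs.
have up : F (x + s * h) <= h * F (x + s) + (1 - h) * F x.
  have -> : x + s * h = h * (x + s) + (1 - h) * x by ring.
  exact: cF.
have lo : (1 + h) * F x <= F (x + s * h) + h * F (x - s).
  have h1 : 0 < 1 + h by lra.
  have := cF (x + s * h) (x - s) (1 + h)^-1.
  have -> : (1 + h)^-1 * (x + s * h) + (1 - (1 + h)^-1) * (x - s) = x by field; lra.
  have e : 1 - (1 + h)^-1 = h / (1 + h) by field; lra.
  have h2 : 0 <= (1 + h)^-1 <= 1 by rewrite invr_ge0 (ltW h1) invf_le1//; lra.
  rewrite e => /(_ h2)/(ler_wpM2l (ltW h1)).
  have -> // : (1 + h) * ((1 + h)^-1 * F (x + s * h) + h / (1 + h) * F (x - s))
    = F (x + s * h) + h * F (x - s) by field; lra.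
have [h0 h1] : 0 <= h /\ h <= 1 by lra.
have m1 := ler_norm (F (x + 1) - F x); have m2 := ler_norm (F (x - 1) - F x).
have n1 := normr_ge0 (F (x + 1) - F x); have n2 := normr_ge0 (F (x - 1) - F x).
have p1 : h * (F (x + 1) - F x) <= h * `|F (x + 1) - F x| by rewrite ler_wpM2l.
have p2 : h * (F (x - 1) - F x) <= h * `|F (x - 1) - F x| by rewrite ler_wpM2l.
have q1 : 0 <= h * `|F (x + 1) - F x| by rewrite mulr_ge0.
have q2 : 0 <= h * `|F (x - 1) - F x| by rewrite mulr_ge0.
case/orP: hs => /eqP se; rewrite se ?opprK in up lo *; rewrite ler_norml; lra.
Qed.

Lemma convex_continuous (F : R -> R) :
  (forall x y t : R, 0 <= t <= 1 -> F (t * x + (1 - t) * y) <= t * F x + (1 - t) * F y) ->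
  continuous F.
Proof.
move=> cF x; pose K : R := `|F (x + 1) - F x| + `|F (x - 1) - F x|.
apply: (@squeeze_cvgr _ _ _ _ (fun y => F x - `|y - x| * K) (fun y => F x + `|y - x| * K)).
- near=> y.
  have hy : `|y - x| <= 1.
    by near: y; apply/nbhs_ballP; exists 1 => //= z; rewrite /ball/= distrC => /ltW.
  have : `|F y - F x| <= `|y - x| * K.
    have [xy|yx] := leP x y.
      rewrite ger0_norm ?subr_ge0// in hy; rewrite [`|y - x|]ger0_norm ?subr_ge0//.
      have := convex_slopes F x (y - x) 1 cF; rewrite mul1r eqxx (addrC x) subrK.
      by apply=> //; apply/andP; split; lra.
    have yx' : y - x < 0 by lra.
    rewrite ltr0_norm// in hy; rewrite [`|y - x|]ltr0_norm//.
    have := convex_slopes F x (- (y - x)) (- 1) cF; rewrite mulrNN mul1r eqxx orbT (addrC x) subrK.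
    by apply=> //; apply/andP; split; lra.
  by rewrite ler_norml; lra.
- have c : {for x, continuous (fun y => F x - `|y - x| * K)} by cont.
  by move: c; rewrite /prop_for /continuous_at subrr normr0 mul0r subr0.
- have c : {for x, continuous (fun y => F x + `|y - x| * K)} by cont.
  by move: c; rewrite /prop_for /continuous_at subrr normr0 mul0r addr0.
Unshelve. all: by end_near. Qed.

Lemma convex_diff2 (F : R -> R) (x d : R) :
  (forall x y t : R, 0 <= t <= 1 -> F (t * x + (1 - t) * y) <= t * F x + (1 - t) * F y) ->
  0 <= diff2 d F x.
Proof.
move=> cF; have h : 0 <= (2^-1 : R) <= 1 by lra.
have := cF (x + d) (x - d) 2^-1 h.
have -> : 2^-1 * (x + d) + (1 - 2^-1) * (x - d) = x by field.
by rewrite /diff2; lra.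
Qed.

End convex_facts.

Section support.
Context {R : realType}.
Variable mu : probability (measurableTypeR R) R.

(** The complement of the support is covered by the null intervals with
    rational endpoints, which are countably many. *)
Lemma negligible_compl_support : mu.-negligible (~` measure_support mu).
Proof.
pose I (p : rat * rat) : set (measurableTypeR R) := `](ratr p.1), (ratr p.2)[%classic.
pose F n : set (measurableTypeR R) :=
  if unpickle n is Some p then (if mu (I p) == 0%E then I p else set0) else set0.
apply: (@negligibleS _ _ _ _ (\bigcup_n F n)); last first.
  apply: negligible_bigcup => n; rewrite /F; case: unpickle => [p|]; last exact: negligible_set0.
  case: eqP => [h|_]; last exact: negligible_set0.
  by exists (I p); split => //; exact: measurable_itv.
move=> x /= /existsNP[U /not_implyP[oU /not_implyP[Ux /negP]]].
rewrite -leNgt => U0.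
have [e /= e0 eU] : exists2 e : R, 0 < e & ball x e `<=` U.
  by apply/nbhs_ballP; apply: open_nbhs_nbhs; split.
have [p] : exists q, ratr q \in `](x - e), x[ by apply: rat_in_itvoo; rewrite ltrBlDr ltrDl.
have [q] : exists q, ratr q \in `]x, (x + e)[ by apply: rat_in_itvoo; rewrite ltrDl.
rewrite !in_itv/= => /andP[xq qe] /andP[pe px].
exists (pickle (p, q)); first exact: Logic.I.
rewrite /F pickleK.
have sub : I (p, q) `<=` U.
  move=> y; rewrite /I /= in_itv/= => /andP[py yq]; apply: eU.
  by rewrite /ball/= ltr_norml; apply/andP; split; lra.
have -> : mu (I (p, q)) = 0%E.
  apply/eqP; rewrite eq_le measure_ge0 andbT (le_trans _ U0)//.
  apply: le_measure; rewrite ?inE; [exact: measurable_itv|exact: open_measurable|exact: sub].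
by rewrite eqxx /I /= in_itv/= px xq.
Qed.

Lemma concentratedS (X Y : set (measurableTypeR R)) : measurable X -> measurable Y ->
  X `<=` Y -> mu (~` X) = 0%E -> mu (~` Y) = 0%E.
Proof.
move=> mX mY XY X0; apply/eqP; rewrite eq_le measure_ge0 andbT -X0.
by apply: le_measure; rewrite ?inE; [exact: measurableC..|exact: subsetC].
Qed.

Lemma support_itv a b : measure_support mu = `[a, b]%classic -> mu (~` `[a, b]%classic) = 0%E.
Proof.
move=> E; have := negligible_compl_support; rewrite E.
move=> /negligibleP; apply; apply: measurableC; exact: measurable_itv.
Qed.
End support.

Section lipschitz.
Context {R : realType}.

Lemma sqr_lipschitz (f g : R -> R) (a b : R) :
  (forall x : R, is_derive x 1 f (g x)) -> (forall x, {for x, continuous g}) ->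
  exists2 C : R, 0 <= C & forall x y, a <= x <= b -> a <= y <= b ->
    f x ^+ 2 <= f y ^+ 2 + C * `|x - y|.
Proof.
move=> df cg.
have cf x : {for x, continuous f}.
  by apply: differentiable_continuous; apply/derivable1_diffP; have [] := df x.
have ch x : {for x, continuous (fun x => 2 * f x * g x)}.
  by have c1 := cf x; have c2 := cg x; cont.
have [C bd] := continuous_bounded_itv _ a b ch.
exists `|C|; first exact: normr_ge0.
have key x y : x < y -> a <= x <= b -> a <= y <= b ->
    `|f y ^+ 2 - f x ^+ 2| <= `|C| * (y - x).
  move=> xy hx hy.
  have [c] := @MVT R (fun x => f x ^+ 2) (fun x => 2 * f x * g x) x y xy
    (fun z _ => dsqr f z _ (df z)) (continuous_in_subspaceT (fun z _ => csqr f z (cf z))).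
  rewrite in_itv/= => hc ->; rewrite normrM (gtr0_norm (x := y - x)) ?subr_gt0//.
  rewrite ler_wpM2r ?subr_ge0 ?(ltW xy)//; apply: le_trans (ler_norm C); apply: bd; lra.
move=> x y hx hy; have [xy|yx|->] := ltgtP x y.
- have := key x y xy hx hy; rewrite (ltr0_norm (x := x - y)) ?subr_lt0// ler_norml; lra.
- have := key y x yx hy hx; rewrite (gtr0_norm (x := x - y)) ?subr_gt0// ler_norml; lra.
- by rewrite subrr normr0 mulr0 addr0.
Qed.
End lipschitz.

Section euler_lagrange.
Context {R : realType}.
Variables (V : R -> R) (rho : R) (mu : probability (measurableTypeR R) R) (a b : R).
Hypotheses (rho0 : 0 < rho) (ab : a < b).
Hypothesis cW : forall x y t : R, 0 <= t <= 1 ->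
  V (t * x + (1 - t) * y) - rho * (t * x + (1 - t) * y) ^+ 2
  <= t * (V x - rho * x ^+ 2) + (1 - t) * (V y - rho * y ^+ 2).
Hypotheses (hmin : energy_minimizer V mu) (Es : measure_support mu = `[a, b]%classic).

Lemma strongly_convex_continuous : continuous V.
Proof.
move=> x; have c := convex_continuous (fun x => V x - rho * x ^+ 2) cW x.
have -> : V = fun x => (V x - rho * x ^+ 2) + rho * x ^+ 2 by apply/funext => y; rewrite subrK.
have c1 : {for x, continuous (fun x => V x - rho * x ^+ 2)} by exact: c.
have c2 : {for x, continuous (fun x : R => rho * x ^+ 2)} by cont.
exact: (cadd _ _ x c1 c2).
Qed.

(** The variations take place in [[a - 1, b + 1]], which contains the support
    in its interior and whose length has a nonnegative logarithm. *)
Lemma euler_lagrange_diff4 c d : 0 < d -> a <= c - 2 * d -> c + 2 * d <= b ->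
  rho * d ^+ 4 <= diff2 d (diff2 d (conv mu a b (@lnabs_int2 R))) c.
Proof.
move=> d0 ac cb; have ab' := ab; have cV := strongly_convex_continuous.
pose A : R := a - 1; pose B : R := b + 1; pose M : R := ln (B - A).
have [v0 Vb] := continuous_bounded_itv V A B cV.
have AB : A < B by rewrite /A /B; lra.
have mu1 : mu (~` `[A, B]%classic) = 0%E.
  apply: concentratedS (support_itv mu a b Es); try exact: measurable_itv.
  by move=> x; rewrite /A /B /= !in_itv/=; lra.
have C0f := effpot_mean_fin V A B M v0 AB (lexx _) cV Vb mu hmin mu1.
pose c0 := fine (\int[mu]_x effpot V A B M v0 mu x)%E.
pose W := shifted_field V A B v0.
have M0 : 0 <= M by rewrite ln_ge0// /B /A; lra.
have hM : ln (b - a) <= M by rewrite ler_ln ?posrE// /A /B; lra.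
apply: (log_potential_diff4 mu a b M c0 rho W ab hM M0 rho0 (support_itv mu a b Es)).
- move=> x hx; rewrite fineK//.
  apply: (effpot_le_support V A B M v0 AB (lexx _) cV Vb mu hmin mu1); last by rewrite /A /B; lra.
  by rewrite Es /= in_itv.
- apply: negligibleS (effpot_ge_ae V A B M v0 AB (lexx _) cV Vb mu hmin mu1) => x /= [hx H].
  by split; [rewrite /A /B; lra|move: H; rewrite fineK].
- move=> x d' d'0 h1 h2.
  have := convex_diff2 (fun x => V x - rho * x ^+ 2) x d' cW.
  rewrite /W /shifted_field /diff2 !ifT; [lra| rewrite /A /B; lra..].
- exact: d0.
- exact: ac.
- exact: cb.
Qed.

Lemma poincare_inequality (phi f g : R -> R) :
  (forall x : R, is_derive x 1 phi (f x)) -> (forall x : R, is_derive x 1 f (g x)) ->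
  (forall x, {for x, continuous g}) ->
  (poincare_lower_bound rho a b phi <= \int[mu]_x (f x ^+ 2)%:E)%E.
Proof.
move=> df dg cg.
have cf : continuous f.
  by move=> x; apply: differentiable_continuous; apply/derivable1_diffP; have [] := dg x.
have mu0 := support_itv mu a b Es.
have [C C0 lip] := sqr_lipschitz f g a b dg cg.
have cf2 : continuous (fun x => f x ^+ 2) by move=> x; exact: (csqr f x (cf x)).
have := integral_semicircle_le mu a b rho ab rho0 mu0 euler_lagrange_diff4
  (fun x => f x ^+ 2) C C0 cf2 (fun x => sqr_ge0 _) lip.
have mf2 : measurable_fun [set: R] (fun x => f x ^+ 2) by apply: continuous_measurable; exact: cf2.
rewrite -(integral_supp mu a b mu0 (fun x => (f x ^+ 2)%:E)); last 2 first.
- exact/measurable_EFinP.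
- by move=> x; rewrite lee_fin sqr_ge0.
apply: le_trans.
pose m : R := (a + b) / 2; pose r : R := (b - a) / 2.
have r0 : 0 < r by rewrite divr_gt0 ?subr_gt0.
have am : a = m - r by rewrite /m /r; field.
have bm : b = m + r by rewrite /m /r; field.
have pi0 : 0 < pi :> R := pi_gt0 R.
have k0 : 0 <= rho / (2 * pi ^+ 2) by rewrite divr_ge0 ?(ltW rho0)// mulr_ge0// sqr_ge0.
have H := poincare_upper m r phi f r0 df cf; rewrite -am -bm in H.
apply: (le_trans (lee_wpmul2l _ H)); first by rewrite lee_fin.
rewrite -ge0_integralZl//.
- rewrite le_eqVlt; apply/orP; left; apply/eqP; apply: eq_integral => x _.
  rewrite -EFinM; congr (_%:E); rewrite -/m -/r; move: (pi : R) pi0 => p p0.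
  by field; rewrite gt_eqF.
- apply: measurable_funTS; apply/measurable_EFinP; apply: measurable_funM => //.
  by apply: measurable_funM => //; apply: continuous_measurable; exact: cchi.
- move=> x _; rewrite lee_fin mulr_ge0//; first by rewrite mulr_ge0// ltW.
  by rewrite mulr_ge0 ?sqr_ge0 ?chi_ge0.
Qed.
End euler_lagrange.

(** * Displacements for quadratic fields *)

(** The image measure, used only through its integrals. *)
Lemma image_prob (R : realType) (mu : probability (measurableTypeR R) R) (T : R -> R) :
  measurable_fun [set: measurableTypeR R] (T : measurableTypeR R -> measurableTypeR R) ->
  exists nu : probability (measurableTypeR R) R, forall f : R -> \bar R,
    measurable_fun [set: measurableTypeR R] f -> (forall x, 0 <= f x)%E ->
    (\int[nu]_x f x = \int[mu]_x f (T x))%E.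
Proof.
move=> mT.
pose X : {mfun measurableTypeR R >-> measurableTypeR R} := @mfun_Sub _ _ (measurableTypeR R) (measurableTypeR R) T (mem_set mT).
by exists (distribution mu X) => f mf f0; rewrite ge0_integral_distribution.
Qed.

(** [ln (1 + u) >= u / (1 + u) >= u - 2 u^2]. *)
Lemma ln1D_ge (R : realType) (u : R) : - (1 / 2) <= u -> u - 2 * u ^+ 2 <= ln (1 + u).
Proof.
move=> hu; have u1 : 0 < 1 + u by lra.
have : ln ((1 + u)^-1) <= - (u / (1 + u)).
  have e : (1 + u)^-1 = 1 + - (u / (1 + u)) by field; lra.
  rewrite [X in ln X]e.
  apply: le_ln1Dx; rewrite ltrN2 ltr_pdivrMr//; lra.
rewrite lnV ?posrE// lerN2; apply: le_trans.
rewrite -subr_ge0.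
have -> : u / (1 + u) - (u - 2 * u ^+ 2) = u ^+ 2 * (1 + 2 * u) / (1 + u) by field; lra.
by rewrite divr_ge0 ?(ltW u1)// mulr_ge0 ?sqr_ge0//; lra.
Qed.

Section displacement.
Context {R : realType}.
Variables (rho alpha beta : R) (mu : probability (measurableTypeR R) R) (a b : R).
Let V (x : R) : R := rho * (x - alpha) ^+ 2 + beta.
Hypotheses (rho0 : 0 < rho) (hmin : energy_minimizer V mu).
Hypotheses (ab : a <= b) (mu0 : mu (~` `[a, b]%classic) = 0%E).
Variables (z H : R).
Hypotheses (H0 : 0 < H) (zD : forall x, a <= x <= b -> z - x != 0 /\ `|(z - x)^-1| <= H).

Let D := `[a, b]%classic : set (measurableTypeR R).
Let mD : measurable D. Proof. exact: measurable_itv. Qed.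

Let h (x : R) : R := if a <= x <= b then (z - x)^-1 else 0.

Let mh : measurable_fun [set: R] h.
Proof.
apply: measurable_fun_ifT => //.
  by apply: measurable_and; apply: measurable_fun_ler.
have -> : (fun x : R => (z - x)^-1) = (fun x => (z - x) * ((z - x) ^+ 2)^-1).
  apply/funext => x; have [->|x0] := eqVneq (z - x) 0; first by rewrite invr0 mul0r.
  by rewrite expr2 invfM mulrA mulfV// mul1r.
apply: measurable_funM; first exact: measurable_funB.
apply: invr_ge0_measurable => [|x]; last exact: sqr_ge0.
by apply: measurable_funX; exact: measurable_funB.
Qed.

Let hH x : `|h x| <= H.
Proof. by rewrite /h; case: ifP => [/zD[]//|_]; rewrite normr0 ltW. Qed.

Let G := \int[mu]_(x in D) h x.

Let integrable_bounded (f : R -> R) (C : R) : measurable_fun [set: R] f ->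
  (forall x, `|f x| <= C) -> mu.-integrable D (EFin \o f).
Proof.
move=> mf fC; apply: measurable_bounded_integrable => //.
- by rewrite (le_lt_trans (probability_le1 _ _)) ?ltry.
- exact: measurable_funTS.
- exists C; split; first exact: num_real.
  by move=> w hw y _; apply: (le_trans (fC y)); exact: ltW.
Qed.

Let ih : mu.-integrable D (EFin \o h).
Proof. exact: integrable_bounded mh hH. Qed.

Let integral_affine c k : (\int[mu]_(x in D) (c + k * h x)%:E = (c + k * G)%:E)%E.
Proof.
have i1 : mu.-integrable D (EFin \o (fun x => k * h x)).
  by have := integrableZl mD k ih; apply: eq_integrable.
have i2 : mu.-integrable D (EFin \o (cst c)) by exact: finite_measure_integrable_cst.
have i3 : mu.-integrable D (EFin \o (fun x => cst c x + k * h x)).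
  by have := integrableD mD i2 i1; apply: eq_integrable.
rewrite -(fineK (integrable_fin_num mD i3)); congr (_%:E).
rewrite -/(Rintegral _ _ _) RintegralD// RintegralZl// Rintegral_cst//.
by rewrite [X in _ * X + _](congr1 fine (muD mu a b mu0)) mulr1.
Qed.

(** The displacement [T x = x + t / (z - x)] satisfies
    [T x - T y = (x - y) (1 + t h x h y)] with [h x = 1 / (z - x)], so the
    interaction changes by at most [- t h x h y + 2 (t h x h y)^2] and its
    double integral factorizes into [G^2]. The field changes by
    [2 rho t (x - alpha) h x] to first order, and
    [(x - alpha) h x = (z - alpha) h x - 1]. *)
Lemma displacement_step t : `|t| * H <= 1 -> `|t| * H ^+ 2 <= 1 / 2 ->
  0 <= t * (2 * rho * ((z - alpha) * G - 1) - G ^+ 2)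
       + t ^+ 2 * (rho * H ^+ 2 + 2 * H ^+ 4).
Proof.
move=> tH tH2; pose A : R := a - 1; pose B : R := b + 1; pose M : R := ln (B - A).
have ab' := ab; have H0' := H0; have rho0' := rho0.
have cV : continuous V.
  by move=> x; have c : {for x, continuous V} by rewrite /V; cont.
have [v0 Vb] := continuous_bounded_itv V A B cV.
have mV : measurable_fun [set: R] V by exact: continuous_measurable.
have AB : A < B by rewrite /A /B; lra.
have mu1 : mu (~` `[A, B]%classic) = 0%E.
  have DAB (x : R) : a <= x <= b -> A <= x <= B by rewrite /A /B; lra.
  apply: (concentratedS mu _ _ mD (measurable_itv _)) mu0 => x.
  by rewrite /= !in_itv; exact: DAB.
pose T (x : R) : R := x + t * h x.
have mT : measurable_fun [set: R] T by apply: measurable_funD => //; exact: measurable_funM.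
have [nu nuE] := image_prob R mu T mT.
have th x : `|t * h x| <= 1.
  by rewrite normrM (le_trans _ tH)// ler_wpM2l.
have TAB x : a <= x <= b -> A <= T x <= B.
  by move=> hx; have := th x; rewrite /T /A /B ler_norml; lra.
have nu1 : nu (~` `[A, B]%classic) = 0%E.
  have m1S : measurable_fun [set: R] (\1_(~` `[A, B]%classic) : R -> R).
    by apply: measurable_indic; apply: measurableC; exact: measurable_itv.
  rewrite prob_indic; last exact: measurableC.
  rewrite nuE; [|exact/measurable_EFinP|by move=> x; rewrite lee_fin].
  rewrite (integral_supp mu a b mu0 (fun x => (\1_(~` `[A, B]%classic) (T x))%:E)).
  - rewrite integral0_eq// => x; rewrite /= in_itv/= => hx.
    by rewrite indicE memNset// => hh; apply: hh; rewrite /= in_itv/=; exact: TAB.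
  - by apply/measurable_EFinP; exact: (measurableT_comp m1S mT).
  - by move=> x; rewrite lee_fin.
have := minimizer_total_energy V A B M v0 AB (lexx _) mV Vb mu nu hmin mu1 nu1.
have := total_energy_lty V A B M v0 AB (lexx _) cV Vb mu hmin mu1.
pose W := shifted_field V A B v0.
have W0 x : 0 <= W x by exact: shifted_field_ge0.
have W1 x : `|W x| <= v0 + v0 by rewrite ger0_norm//; exact: shifted_field_le.
have mW : measurable_fun [set: R] W by exact: measurable_shifted_field.
have mWT : measurable_fun [set: R] (fun x => W (T x)) by exact: (measurableT_comp mW).
pose g (x y : R) : \bar R := logker M (x - y).
have mg2 (f1 f2 : R -> R) : measurable_fun [set: measurableTypeR R] f1 -> measurable_fun [set: measurableTypeR R] f2 ->
    measurable_fun setT (fun p : measurableTypeR R * measurableTypeR R => g (f1 p.1) (f2 p.2)).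
  move=> m1 m2; apply: measurable_logker2; first exact: (measurableT_comp m1).
  exact: (measurableT_comp m2).
have g0 x y : (0 <= g x y)%E by exact: logker_ge0.
have mid : measurable_fun [set: measurableTypeR R] (fun x : R => x) by exact: measurable_id.
have mg1 (f1 f2 : R -> R) x : measurable_fun [set: measurableTypeR R] f1 -> measurable_fun [set: measurableTypeR R] f2 ->
    measurable_fun [set: measurableTypeR R] (fun y => g (f1 x) (f2 y)).
  move=> m1 m2; apply: (measurableT_comp (measurable_logker M)); exact: measurable_funB.
have mI (f1 f2 : R -> R) : measurable_fun [set: measurableTypeR R] f1 -> measurable_fun [set: measurableTypeR R] f2 ->
    measurable_fun [set: measurableTypeR R] (fun x => \int[mu]_y g (f1 x) (f2 y))%E.
  move=> m1 m2; apply: (measurable_fun_fubini_tonelli_F (fun p : measurableTypeR R * measurableTypeR R => g (f1 p.1) (f2 p.2))) => //.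
  exact: mg2.
have EJ (f1 : R -> R) : measurable_fun [set: measurableTypeR R] f1 ->
    (\int[mu]_x \int[mu]_y g (f1 x) (f1 y) = \int[mu]_(x in D) \int[mu]_(y in D) g (f1 x) (f1 y))%E.
  move=> m1; rewrite (integral_supp mu a b mu0) //; last 2 first.
  - exact: mI.
  - by move=> x; apply: integral_ge0.
  apply: eq_integral => x _; rewrite (integral_supp mu a b mu0)//.
  exact: mg1.
have -> : total_energy V A B M v0 mu = (\int[mu]_(x in D) (W x)%:E + \int[mu]_(x in D) \int[mu]_(y in D) g x y)%E.
  rewrite /total_energy -(EJ id)//; congr (_ + _)%E; rewrite (integral_supp mu a b mu0)//.
  exact/measurable_EFinP.
have -> : total_energy V A B M v0 nu = (\int[mu]_(x in D) (W (T x))%:E + \int[mu]_(x in D) \int[mu]_(y in D) g (T x) (T y))%E.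
  rewrite /total_energy -(EJ T)//; congr (_ + _)%E.
    rewrite (nuE (fun x => (W x)%:E)); [|exact/measurable_EFinP|by move=> x; rewrite lee_fin].
    rewrite (integral_supp mu a b mu0 (fun x => (W (T x))%:E))//; first exact/measurable_EFinP.
    by move=> x; rewrite lee_fin.
  rewrite (nuE (pot M nu)); [|exact: measurable_pot|by move=> x; exact: pot_ge0].
  apply: eq_integral => x _; rewrite /pot (nuE (fun y => logker M (T x - y)))//.
  - apply: (measurableT_comp (measurable_logker M)); exact: measurable_funB.
  - by move=> y; exact: logker_ge0.
have iW := integrable_bounded W _ mW W1.
have iWT := integrable_bounded (fun x => W (T x)) _ mWT (fun x => W1 (T x)).
set I := (\int[mu]_(x in D) \int[mu]_(y in D) g x y)%E.
set I' := (\int[mu]_(x in D) \int[mu]_(y in D) g (T x) (T y))%E.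
have I0 : (0 <= I)%E by apply: integral_ge0 => x _; apply: integral_ge0.
have I0' : (0 <= I')%E by apply: integral_ge0 => x _; apply: integral_ge0.
rewrite -(fineK (integrable_fin_num mD iW)) -(fineK (integrable_fin_num mD iWT)).
rewrite -!/(Rintegral _ _ _).
have potV : \int[mu]_(x in D) W (T x) <= \int[mu]_(x in D) W x
    + (rho * t ^+ 2 * H ^+ 2 - 2 * rho * t + 2 * rho * t * (z - alpha) * G).
  pose c := rho * t ^+ 2 * H ^+ 2 - 2 * rho * t; pose k := 2 * rho * t * (z - alpha).
  have iA := integrable_bounded (fun x => c + k * h x) (`|c| + `|k| * H).
  have {}iA : mu.-integrable D (EFin \o (fun x => c + k * h x)).
    apply: iA; first by apply: measurable_funD => //; exact: measurable_funM.
    move=> x; rewrite (le_trans (ler_normD _ _))// lerD2l normrM ler_wpM2l//.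
  have iS : mu.-integrable D (EFin \o (fun x => W x + (c + k * h x))).
    by have := integrableD mD iW iA; apply: eq_integrable.
  have <- : \int[mu]_(x in D) (c + k * h x) = c + k * G by rewrite /Rintegral integral_affine.
  rewrite -RintegralD//; apply: le_Rintegral => // x; rewrite /D /= in_itv/= => hx.
  rewrite /W /shifted_field (TAB x hx) ifT; last by rewrite /A /B; lra.
  have [zx0 _] := zD x hx.
  have e : h x * (z - x) = 1 by rewrite /h hx mulVf.
  have h2 : rho * t ^+ 2 * h x ^+ 2 <= rho * t ^+ 2 * H ^+ 2.
    rewrite ler_wpM2l//; first by rewrite mulr_ge0 ?sqr_ge0// ltW.
    by rewrite -[h x ^+ 2]real_normK ?num_real// lerXn2r ?nnegrE// ltW.
  have e2 : 2 * rho * t * (h x * (z - x)) = 2 * rho * t by rewrite e mulr1.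
  rewrite /V /T /c /k; lra.
have logV : (I' + (t * G ^+ 2 + `|t| * H ^+ 2)%:E
    <= I + (2 * t ^+ 2 * H ^+ 4 + `|t| * H ^+ 2)%:E)%E.
  pose K := 2 * t ^+ 2 * H ^+ 4 + `|t| * H ^+ 2.
  pose s := `|t| * H ^+ 2.
  have s0 : 0 <= s by rewrite mulr_ge0 ?sqr_ge0.
  have H40 : 0 <= H ^+ 4 by rewrite exprn_ge0// ltW.
  have K0 : 0 <= K by rewrite addr_ge0// mulr_ge0// mulr_ge0// sqr_ge0.
  have hh x y : `|t * h x * h y| <= s.
    rewrite -mulrA normrM /s ler_wpM2l// normrM expr2 ler_pM//; exact: hH.
  have u0 x y : 0 <= s + t * h x * h y by have := hh x y; rewrite ler_norml; lra.
  have pt x y : a <= x <= b -> a <= y <= b ->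
      (g (T x) (T y) + (s + t * h x * h y)%:E <= g x y + K%:E)%E.
    move=> hx hy; rewrite /g /logker !subr_eq0.
    have [->|xy] := eqVneq x y; first by rewrite eqxx /= leey.
    set u := t * h x * h y.
    have hu : - (1 / 2) <= u by have := hh x y; rewrite -/u /s ler_norml; lra.
    have Txy : T x - T y = (x - y) * (1 + u).
      have [zx _] := zD x hx; have [zy _] := zD y hy.
      by rewrite /T /u /h hx hy; field; rewrite zx zy.
    have u1 : 0 < 1 + u by lra.
    have xy0 : x - y != 0 by rewrite subr_eq0.
    have n0 : T x != T y by rewrite -subr_eq0 Txy mulf_neq0// gt_eqF.
    have bd v w : A <= v <= B -> A <= w <= B -> v != w -> 0 <= M - ln `|v - w|.
      move=> hv' hw vw; rewrite subr_ge0 ler_ln ?posrE ?normr_gt0 ?subr_eq0 ?subr_gt0//.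
      by rewrite ler_norml; lra.
    have hxA : A <= x <= B by rewrite /A /B; lra.
    have hyA : A <= y <= B by rewrite /A /B; lra.
    have b1 := bd _ _ (TAB x hx) (TAB y hy) n0; have b2 := bd _ _ hxA hyA xy.
    rewrite (negbTE n0) (max_idPr b1) (max_idPr b2) -!EFinD lee_fin.
    rewrite Txy normrM (gtr0_norm u1) lnM ?posrE ?normr_gt0//.
    have l1 := ln1D_ge R u hu.
    have u2 : u ^+ 2 <= t ^+ 2 * H ^+ 4.
      have -> : t ^+ 2 * H ^+ 4 = s ^+ 2 by rewrite /s exprMn real_normK ?num_real//; ring.
      by rewrite -[u ^+ 2]real_normK ?num_real// lerXn2r ?nnegrE//; exact: hh.
    rewrite /K -/s; lra.
  have mgi x : measurable_fun D (fun y => g x y) by apply: measurable_funTS; exact: (mg1 (fun=> x) id x).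
  have mgT x : measurable_fun D (fun y => g (T x) (T y)) by apply: measurable_funTS; exact: mg1.
  have mu2 x : measurable_fun D (fun y => (s + t * h x * h y)%:E).
    by apply: measurable_funTS; apply/measurable_EFinP; apply: measurable_funD => //; exact: measurable_funM.
  have D1 (k : R) : (\int[mu]_(x in D) k%:E = k%:E)%E.
    by rewrite integral_cst// [X in (_ * X)%E](muD mu a b mu0) mule1.
  have intD (f1 f2 : R -> \bar R) : measurable_fun D f1 -> measurable_fun D f2 ->
      (forall x, 0 <= f1 x)%E -> (forall x, 0 <= f2 x)%E ->
      (\int[mu]_(x in D) (f1 x + f2 x) = \int[mu]_(x in D) f1 x + \int[mu]_(x in D) f2 x)%E.
    by move=> m1 m2 p1 p2; rewrite ge0_integralD.
  have iy x : a <= x <= b -> (\int[mu]_(y in D) g (T x) (T y) + (s + (t * G) * h x)%:E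
      <= \int[mu]_(y in D) g x y + K%:E)%E.
    move=> hx.
    have -> : s + t * G * h x = s + (t * h x) * G by ring.
    have e1 := intD _ (cst K%:E) (mgi x) (measurable_cst _) (g0 x) (fun _ => K0).
    have e2 := intD _ _ (mgT x) (mu2 x) (fun y => g0 (T x) (T y)) (u0 x).
    rewrite -(D1 K) -integral_affine -e1 -e2.
    apply: ge0_le_integral_pointwise => y; rewrite /D /= in_itv/= => hy; last exact: pt.
    by rewrite adde_ge0// lee_fin.
  have mQf (f1 : R -> R) : measurable_fun [set: measurableTypeR R] f1 ->
      measurable_fun D (fun x => \int[mu]_(y in D) g (f1 x) (f1 y))%E.
    move=> m1; have := measurable_funTS (D := D) (mI f1 f1 m1 m1).
    apply: eq_measurable_fun => x _; rewrite (integral_supp mu a b mu0)//; exact: mg1.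
  have mQ := mQf id mid; have mQT := mQf T mT.
  have u3 x : 0 <= s + (t * G) * h x.
    have -> : s + t * G * h x = s + (t * h x) * G by ring.
    rewrite -lee_fin -integral_affine; apply: integral_ge0 => y _.
    by rewrite lee_fin.
  have -> : t * G ^+ 2 + `|t| * H ^+ 2 = s + (t * G) * G by rewrite /s; ring.
  have m3 : measurable_fun D (fun x => (s + t * G * h x)%:E).
    by apply: measurable_funTS; apply/measurable_EFinP; apply: measurable_funD => //; exact: measurable_funM.
  have p1 x : (0 <= \int[mu]_(y in D) g x y)%E by exact: integral_ge0.
  have p2 x : (0 <= \int[mu]_(y in D) g (T x) (T y))%E by exact: integral_ge0.
  have e1 := intD _ (cst K%:E) mQ (measurable_cst _) p1 (fun _ => K0).
  have e2 := intD _ _ mQT m3 p2 u3.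
  rewrite -integral_affine -/K -(D1 K) /I /I' -e1 -e2.
  apply: ge0_le_integral_pointwise => x; rewrite /D /= in_itv/= => hx; last exact: iy.
  by rewrite adde_ge0 ?lee_fin//; apply: integral_ge0.
move: I I' I0 I0' logV => [i| |] [i'| |] //= _ _; rewrite -?EFinD ?lee_fin; lra.
Qed.

(** Both signs of [t] in [displacement_step]; [tau] is a step for which its
    two smallness conditions hold. *)
Lemma displacement_quadratic : 2 * rho * ((z - alpha) * G - 1) = G ^+ 2.
Proof.
have H0' := H0; have H2 : 0 <= H ^+ 2 := sqr_ge0 H.
pose tau : R := (1 + H + 2 * H ^+ 2)^-1.
have d0 : 0 < 1 + H + 2 * H ^+ 2 by lra.
have t0 : 0 < tau by rewrite invr_gt0.
have tH : tau * H <= 1 by rewrite mulrC ler_pdivrMr//; lra.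
have tH2 : tau * H ^+ 2 <= 1 / 2 by rewrite mulrC ler_pdivrMr//; lra.
set L := 2 * rho * _; pose Q : R := rho * H ^+ 2 + 2 * H ^+ 4.
have step s t : s ^+ 2 = 1 -> 0 < t <= 1 -> 0 <= t * (s * tau * (L - G ^+ 2)) + t ^+ 2 * (tau ^+ 2 * Q).
  move=> s2 /andP[t0' t1].
  have sn : `|s| = 1.
    by apply/eqP; rewrite -(@eqrXn2 _ 2) ?normr_ge0 ?ler01// real_normK ?num_real// s2 expr1n.
  have st : `|s * t * tau| <= tau.
    by rewrite !normrM sn mul1r (gtr0_norm t0) (gtr0_norm t0') ler_piMl// ltW.
  have := displacement_step (s * t * tau).
  have -> : (s * t * tau) ^+ 2 = t ^+ 2 * tau ^+ 2 by rewrite !exprMn s2 mul1r.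
  have -> : t * (s * tau * (L - G ^+ 2)) + t ^+ 2 * (tau ^+ 2 * Q)
    = s * t * tau * (L - G ^+ 2) + t ^+ 2 * tau ^+ 2 * Q by ring.
  apply.
    by apply: le_trans tH; rewrite ler_wpM2r// ltW.
  by apply: le_trans tH2; rewrite ler_wpM2r.
have h1 : 0 <= 1 * tau * (L - G ^+ 2).
  by apply: (linear_coef_ge0 _ (tau ^+ 2 * Q)) => t; apply: step; rewrite expr1n.
have h2 : 0 <= - 1 * tau * (L - G ^+ 2).
  by apply: (linear_coef_ge0 _ (tau ^+ 2 * Q)) => t; apply: step; rewrite sqrrN expr1n.
rewrite mul1r pmulr_rge0// in h1; rewrite mulN1r mulNr oppr_ge0 pmulr_rle0// in h2.
by lra.
Qed.

(** The discriminant of the quadratic equation satisfied by [G]. *)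
Lemma displacement_gap : 2 <= rho * (z - alpha) ^+ 2.
Proof.
have q := displacement_quadratic; have r0 := rho0.
have : 0 <= (G - rho * (z - alpha)) ^+ 2 by exact: sqr_ge0.
have -> : (G - rho * (z - alpha)) ^+ 2 = rho * (rho * (z - alpha) ^+ 2 - 2).
  rewrite (_ : _ ^+ 2 = G ^+ 2 - 2 * rho * (z - alpha) * G + rho ^+ 2 * (z - alpha) ^+ 2); last by ring.
  by rewrite -q; ring.
by rewrite pmulr_rge0//; lra.
Qed.

(** [G >= 0] for [z] to the right of the support, and then
    [(z - alpha) G >= 1] by the quadratic equation. *)
Lemma displacement_right : b < z -> alpha < z.
Proof.
move=> bz; have q := displacement_quadratic; have r0 := rho0.
have G0 : 0 <= G.
  apply: Rintegral_ge0 => x; rewrite /D /= in_itv/= => hx.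
  by rewrite /h hx invr_ge0; lra.
have : 0 <= 2 * rho * ((z - alpha) * G - 1) by rewrite q sqr_ge0.
rewrite pmulr_rge0; last by rewrite mulr_gt0.
move=> h1; rewrite ltNge; apply/negP => za.
have : (z - alpha) * G <= 0 by rewrite mulr_le0_ge0//; lra.
by lra.
Qed.

Lemma displacement_left : z < a -> z < alpha.
Proof.
move=> za; have q := displacement_quadratic; have r0 := rho0.
have G0 : G <= 0.
  have <- : \int[mu]_(x in D) (0 * h x) = 0 by rewrite RintegralZl// mul0r.
  apply: le_Rintegral => //.
    by have := integrableZl mD 0 ih; apply: eq_integrable.
  move=> x; rewrite /D /= in_itv/= => hx.
  by rewrite mul0r /h hx invr_le0; lra.
have : 0 <= 2 * rho * ((z - alpha) * G - 1) by rewrite q sqr_ge0.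
rewrite pmulr_rge0; last by rewrite mulr_gt0.
move=> h1; rewrite ltNge; apply/negP => az.
have : (z - alpha) * G <= 0 by rewrite mulr_ge0_le0//; lra.
by lra.
Qed.
End displacement.

Section quadratic_support.
Context {R : realType}.
Variables (rho alpha beta : R) (mu : probability (measurableTypeR R) R) (a b : R).
Hypotheses (rho0 : 0 < rho) (hmin : energy_minimizer (fun x : R => rho * (x - alpha) ^+ 2 + beta) mu).
Hypotheses (ab : a <= b) (mu0 : mu (~` `[a, b]%classic) = 0%E).

Lemma outside_inv (z : R) : (z < a) || (b < z) ->
  exists2 H : R, 0 < H & forall x, a <= x <= b -> z - x != 0 /\ `|(z - x)^-1| <= H.
Proof.
case/orP => hz.
  have az : 0 < a - z by rewrite subr_gt0.
  exists (a - z)^-1; first by rewrite invr_gt0.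
  move=> x hx; have zx : z - x < 0 by lra.
  split; first by rewrite lt_eqF.
  by rewrite normfV ltr0_norm// lef_pV2 ?posrE; lra.
have bz : 0 < z - b by rewrite subr_gt0.
exists (z - b)^-1; first by rewrite invr_gt0.
move=> x hx; have zx : 0 < z - x by lra.
split; first by rewrite gt_eqF.
by rewrite normfV gtr0_norm// lef_pV2 ?posrE; lra.
Qed.

(** Every [z] to the right of [b] lies at distance at least [s] to the right
    of [alpha], hence so does [b]; the same on the left. If [b] did not, a
    point [z] slightly to the right of both [b] and [alpha] would contradict
    [displacement_gap]. *)
Lemma quadratic_support_radius : 8 <= rho * (b - a) ^+ 2.
Proof.
have r0 := rho0; have ab' := ab.
pose s : R := Num.sqrt (2 / rho).
have s2 : s ^+ 2 = 2 / rho by rewrite sqr_sqrtr// divr_ge0// ltW.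
have s0 : 0 < s by rewrite sqrtr_gt0 divr_gt0.
have far (w : R) : 2 <= rho * w ^+ 2 -> 0 < w -> s <= w.
  move=> hw w0; have : s ^+ 2 <= w ^+ 2 by rewrite s2 ler_pdivrMr//; lra.
  by rewrite ler_pXn2r ?nnegrE ?(ltW s0) ?(ltW w0).
have hb : s <= b - alpha.
  rewrite leNgt; apply/negP => hlt.
  pose z := Num.max b alpha + (s - Num.max 0 (b - alpha)) / 2.
  have m1 : b - alpha <= Num.max 0 (b - alpha) by rewrite le_max lexx orbT.
  have m2 : 0 <= Num.max 0 (b - alpha) by rewrite le_max lexx.
  have m3 : Num.max 0 (b - alpha) < s by rewrite gt_max s0 hlt.
  have m4 : Num.max b alpha = alpha + Num.max 0 (b - alpha).
    by rewrite addr_maxr addr0 addrC subrK maxC.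
  have m5 : b <= Num.max b alpha by rewrite le_max lexx.
  have bz : b < z by rewrite /z; lra.
  have [H H0 zD] := outside_inv z (introT orP (or_intror bz)).
  have g := displacement_gap rho alpha beta mu a b rho0 hmin ab mu0 z H H0 zD.
  have sg := displacement_right rho alpha beta mu a b rho0 hmin ab mu0 z H H0 zD bz.
  have := far (z - alpha) g; rewrite subr_gt0 => /(_ sg).
  by rewrite /z m4; lra.
have ha : s <= alpha - a.
  rewrite leNgt; apply/negP => hlt.
  pose w := Num.max 0 (alpha - a).
  have m1 : alpha - a <= w by rewrite le_max lexx orbT.
  have m2 : 0 <= w by rewrite le_max lexx.
  have m3 : w < s by rewrite gt_max s0 hlt.
  pose z := alpha - w - (s - w) / 2.
  have za : z < a by rewrite /z; lra.
  have [H H0 zD] := outside_inv z (introT orP (or_introl za)).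
  have g := displacement_gap rho alpha beta mu a b rho0 hmin ab mu0 z H H0 zD.
  have sg := displacement_left rho alpha beta mu a b rho0 hmin ab mu0 z H H0 zD za.
  have := far (alpha - z); rewrite -sqrrN opprB subr_gt0 => /(_ g sg).
  by rewrite /z; lra.
have : (2 * s) ^+ 2 <= (b - a) ^+ 2 by rewrite lerXn2r ?nnegrE; lra.
rewrite exprMn s2 => h; have : rho * (2 ^+ 2 * (2 / rho)) <= rho * (b - a) ^+ 2 by rewrite ler_pM2l.
by have -> : rho * (2 ^+ 2 * (2 / rho)) = 8 by field; lra.
Qed.
End quadratic_support.

(** * Equality for affine functions *)

Section affine.
Context {R : realType}.
Local Notation leb := (@lebesgue_measure R).

Let K (m r x y : R) : R := (r ^+ 2 - (x - m) * (y - m)) / (chi m r x * chi m r y).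

Let measurable_inv_chi m r : measurable_fun [set: R] (fun x => (chi m r x)^-1).
Proof.
apply: invr_ge0_measurable; last by move=> x; exact: chi_ge0.
by apply: continuous_measurable; exact: cchi.
Qed.

Let measurable_K m r y : measurable_fun [set: R] (fun x => K m r x y).
Proof.
have -> : (fun x => K m r x y) = fun x => (r ^+ 2 - (x - m) * (y - m)) * ((chi m r x)^-1 * (chi m r y)^-1).
  by apply/funext => x; rewrite /K invfM.
apply: measurable_funM.
  by apply: measurable_funB => //; apply: measurable_funM => //; exact: measurable_funB.
by apply: measurable_funM => //; exact: measurable_inv_chi.
Qed.

(** The antiderivative is [(r^2 asn x + (y - m) chi x) / chi y]. On the
    boundary of the square both sides are [0], because [chi] is [0] there. *)
Lemma integral_K (m r y : R) : 0 < r -> m - r <= y <= m + r ->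
  (\int[leb]_(x in `[(m - r)%R, (m + r)%R]) (K m r x y)%:E = (r ^+ 2 * pi / chi m r y)%:E)%E.
Proof.
move=> r0 hy; rewrite integral_itv_bndoo; last first.
  by apply: measurable_funTS; apply/measurable_EFinP; exact: measurable_K.
have [hy'|hy'] := boolP (m - r < y < m + r); last first.
  have y0 : chi m r y = 0.
    by rewrite chi_out ?(ltW r0)// leNgt ltr_norml; apply: contra hy'; lra.
  rewrite y0 invr0 mulr0 integral0_eq// => x _.
  by rewrite /K y0 mulr0 invr0 mulr0.
have y0 := chi_gt0 _ _ _ hy'.
pose F (x : R) : R := (r ^+ 2 * asn m r x + (y - m) * chi m r x) / chi m r y.
have -> : r ^+ 2 * pi / chi m r y = F (m + r) - F (m - r).
  by rewrite /F asn_right// asn_left// chi_right chi_left; move: (pi : R) => p; field; rewrite gt_eqF.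
apply: (ge0_FTC2_except R [::] (fun x => K m r x y) F).
- lra.
- exact: measurable_K.
- move=> x hx; rewrite /K divr_ge0 ?mulr_ge0 ?chi_ge0//; exact/ltW/num0_gt0.
- move=> x _; have c1 := casn m r x r0; have c2 := cchi m r x.
  by rewrite /F; cont.
- move=> x hx _; have c2 := cchi m r x; have x0 := chi_gt0 _ _ _ hx.
  by rewrite /K; cont; rewrite mulf_neq0// gt_eqF.
- move=> x hx _; have d1 := dasn _ _ _ r0 hx; have d2 := dchi _ _ _ hx.
  have x0 := chi_gt0 _ _ _ hx.
  dstart; first by rewrite /F; der.
  by rewrite /K /=; field; rewrite !gt_eqF.
Qed.

(** The difference quotient is [c2] off the diagonal, a null set. *)
Lemma poincare_lower_bound_affine (phi : R -> R) (rho m r c1 c2 : R) : 0 < r -> 0 < rho ->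
  (forall x, phi x = c1 + c2 * x) ->
  poincare_lower_bound rho (m - r) (m + r) phi
  = (c2 ^+ 2 * (rho * r ^+ 2 / 2))%:E.
Proof.
move=> r0 rho0 phiE; rewrite /poincare_lower_bound.
have pi0 : 0 < pi :> R := pi_gt0 R.
have inner y : m - r <= y <= m + r ->
    (\int[leb]_(x in `[(m - r)%R, (m + r)%R])
      (poincare_integrand (m - r) (m + r) phi x y)%:E
    = (c2 ^+ 2 * (r ^+ 2 * pi) / chi m r y)%:E)%E.
  move=> hy.
  have E x : poincare_integrand (m - r) (m + r) phi x y
      = if x == y then 0 else c2 ^+ 2 * K m r x y.
    rewrite poincare_integrandE; case: eqVneq => [->|xy].
      by rewrite subrr mul0r expr0n/= mul0r.
    congr (_ ^+ 2 * _); rewrite !phiE (_ : c1 + c2 * x - _ = c2 * (x - y)); last by ring.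
    by rewrite mulfK// subr_eq0.
  have mI : measurable (`[(m - r), (m + r)]%classic : set (measurableTypeR R)) by exact: measurable_itv.
  transitivity (\int[leb]_(x in `[(m - r)%R, (m + r)%R]) ((c2 ^+ 2)%:E * (K m r x y)%:E))%E.
    have Z : leb.-negligible [set y].
      exists [set y]; split => //; exact: lebesgue_measure_set1.
    have mK := measurable_K m r y.
    apply: ae_eq_integral => //.
    - rewrite (_ : (fun x => _) = (fun x => (if x == y then 0 else c2 ^+ 2 * K m r x y)%:E)); last first.
        by apply/funext => x; rewrite E.
      apply: measurable_funTS; apply/measurable_EFinP; apply: measurable_fun_ifT => //.
        exact: measurable_fun_eqr.
      exact: measurable_funM.
    - by apply: measurable_funTS; apply/measurable_EFinP; exact: measurable_funM.
    - apply: negligibleS Z => x /=; apply: contra_notP => /eqP xy _.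
      by rewrite E (negbTE xy) EFinM.
  rewrite ge0_integralZl//; last 3 first.
  - by apply: measurable_funTS; apply/measurable_EFinP; exact: measurable_K.
  - move=> x; rewrite /= in_itv/= => hx; rewrite lee_fin.
    have [hx'|hx'] := boolP (m - r < x < m + r); last first.
      by rewrite /K chi_out ?mul0r ?invr0 ?mulr0 ?(ltW r0)// leNgt ltr_norml; apply: contra hx'; lra.
    have [hy'|hy'] := boolP (m - r < y < m + r); last first.
      by rewrite /K [chi m r y]chi_out ?mulr0 ?invr0 ?mulr0 ?(ltW r0)// leNgt ltr_norml; apply: contra hy'; lra.
    by rewrite /K divr_ge0 ?mulr_ge0 ?chi_ge0//; exact/ltW/num0_gt0.
  - by rewrite lee_fin sqr_ge0.
  by rewrite integral_K// -EFinM !mulrA.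
rewrite (_ : (\int[leb]_(y in _) _ = \int[leb]_(y in `[(m - r)%R, (m + r)%R])
    (c2 ^+ 2 * (r ^+ 2 * pi) / chi m r y)%:E)%E); last first.
  by apply: eq_integral => y /set_mem; rewrite /= in_itv/=; exact: inner.
have mi := measurable_inv_chi m r.
rewrite integral_itv_bndoo; last first.
  by apply: measurable_funTS; apply/measurable_EFinP; exact: measurable_funM.
pose F (x : R) : R := c2 ^+ 2 * (r ^+ 2 * pi) * asn m r x.
have -> : (\int[leb]_(y in `](m - r)%R, (m + r)%R[) (c2 ^+ 2 * (r ^+ 2 * pi) / chi m r y)%:E
    = (F (m + r) - F (m - r))%:E)%E.
  apply: (ge0_FTC2_except R [::] (fun x => c2 ^+ 2 * (r ^+ 2 * pi) / chi m r x) F).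
  - lra.
  - exact: measurable_funM.
  - move=> x _; rewrite mulr_ge0 ?invr_ge0 ?chi_ge0// mulr_ge0 ?sqr_ge0//.
    by rewrite mulr_ge0 ?sqr_ge0// ltW.
  - by move=> x _; have c1' := casn m r x r0; rewrite /F; cont.
  - by move=> x hx _; have c2' := cchi m r x; cont; rewrite gt_eqF// chi_gt0.
  - move=> x hx _; have d1 := dasn _ _ _ r0 hx.
    by dstart; [rewrite /F; der|rewrite /=; move: (pi : R) => p; ring].
rewrite -EFinM; congr (_%:E); rewrite /F asn_right// asn_left//.
by move: (pi : R) pi0 => p p0; field; rewrite gt_eqF.
Qed.

End affine.

Lemma poincare_lower_bound_degenerate (R : realType) (rho a b : R) (phi : R -> R) :
  b <= a -> poincare_lower_bound rho a b phi = 0%E.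
Proof.
move=> ba; rewrite /poincare_lower_bound integral_itv_bndoo; last first.
  by rewrite set_itv_ge ?bnd_simp -?leNgt//; exact: measurable_fun_set0.
by rewrite set_itv_ge ?bnd_simp -?leNgt// integral_set0 mule0.
Qed.

(** A measure carried by a point has infinite energy, whereas the minimizer
    has finite energy. *)
Lemma quadratic_support_nondegenerate (R : realType) (rho alpha beta a b : R)
    (mu : probability (measurableTypeR R) R) :
  energy_minimizer (fun x : R => rho * (x - alpha) ^+ 2 + beta) mu ->
  mu (~` `[a, b]%classic) = 0%E -> a < b.
Proof.
move=> hmin mu0; rewrite ltNge; apply/negP => ba.
pose V (x : R) : R := rho * (x - alpha) ^+ 2 + beta.
pose A : R := a - 1; pose B : R := a + 1.
have cV : continuous V.
  by move=> x; have c : {for x, continuous V} by rewrite /V; cont.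
have [v0 Vb] := continuous_bounded_itv V A B cV.
have AB : A < B by rewrite /A /B; lra.
have ma : measurable ([set a] : set (measurableTypeR R)) by exact: measurable_set1.
have mua : mu (~` [set a]) = 0%E.
  apply: (concentratedS mu _ _ (measurable_itv _) ma _ mu0) => x.
  by rewrite /= in_itv/= => hx; apply/eqP; rewrite eq_le; lra.
have mu1 : mu (~` `[A, B]%classic) = 0%E.
  apply: (concentratedS mu _ _ ma (measurable_itv _) _ mua) => x /= ->.
  by rewrite /A /B in_itv/=; lra.
have := total_energy_lty V A B (ln (B - A)) v0 AB (lexx _) cV Vb mu hmin mu1.
have one : mu [set a] = 1%E.
  have := @probability_setC _ _ _ mu _ ma; rewrite mua => h.
  have : mu [set a] \is a fin_num by exact: fin_num_measure.
  move: h; case: (mu [set a]) => //= r h _; congr (_%:E).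
  by case: h => h; lra.
have atom (f : R -> \bar R) : measurable_fun [set: measurableTypeR R] f ->
    (forall x, 0 <= f x)%E -> f a = +oo%E -> (\int[mu]_x f x = +oo)%E.
  move=> mf f0 fa; apply/eqP; rewrite eq_le leey/=.
  apply: (@le_trans _ _ (\int[mu]_(x in [set a]) f x)%E); last first.
    by apply: ge0_subset_integral.
  rewrite (_ : (\int[mu]_(x in [set a]) f x = \int[mu]_(x in [set a]) cst +oo x)%E).
    by rewrite integral_cst// [X in (_ * X)%E]one mule1.
  by apply: eq_integral => x /set_mem/= ->.
rewrite /total_energy (atom (pot (ln (B - A)) mu)).
- by rewrite addey// -ltNye (lt_le_trans (ltNyr 0))//; apply: integral_ge0 => x _; rewrite lee_fin; exact: shifted_field_ge0.
- exact: measurable_pot.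
- by move=> x; exact: pot_ge0.
- apply: atom.
  + apply: (measurableT_comp (measurable_logker _)); exact: measurable_funB.
  + by move=> x; exact: logker_ge0.
  + by rewrite /logker subrr eqxx.
Qed.

Theorem theorem8 (R : realType) :
  (forall (V : R -> R) (rho : R) (mu : probability (measurableTypeR R) R)
      (a b : R) (phi : R -> R),
    0 < rho ->
    convex_function [set: R^o] (fun x : R^o => V x - rho * x ^+ 2) ->
    equilibrium_measure V mu ->
    measure_support mu = `[a, b]%classic ->
    smooth phi ->
    (poincare_lower_bound rho a b phi <= \int[mu]_x ((derive1 phi x) ^+ 2)%:E)%E)
  /\
  (forall (rho alpha beta c1 c2 : R) (mu : probability (measurableTypeR R) R)
      (a b : R),
    0 < rho ->
    equilibrium_measure (fun x : R => rho * (x - alpha) ^+ 2 + beta) mu ->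
    measure_support mu = `[a, b]%classic ->
    let phi := fun x : R => c1 + c2 * x in
    (\int[mu]_x ((derive1 phi x) ^+ 2)%:E = poincare_lower_bound rho a b phi)%E).
Proof.
split.
  move=> V rho mu a b phi rho0 cW [hmin _] Es sm.
  have [ba|ab] := leP b a.
    rewrite poincare_lower_bound_degenerate//; apply: integral_ge0 => x _.
    by rewrite lee_fin sqr_ge0.
  have cW' (x y t : R) : 0 <= t <= 1 ->
      V (t * x + (1 - t) * y) - rho * (t * x + (1 - t) * y) ^+ 2
      <= t * (V x - rho * x ^+ 2) + (1 - t) * (V y - rho * y ^+ 2).
    exact: (convex_functionP (fun x => V x - rho * x ^+ 2) x y t cW).
  have d n (x : R) : is_derive x 1 (derive1n n phi) (derive1n n.+1 phi x).
    by rewrite derive1nS derive1E; apply: derivableP; exact: sm.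
  apply: (poincare_inequality V rho mu a b rho0 ab cW' hmin Es _ _ _ (d 0) (d 1)) => x.
  by apply: differentiable_continuous; apply/derivable1_diffP; exact: (sm 2).
move=> rho alpha beta c1 c2 mu a b rho0 [hmin _] Es phi.
have mu0 := support_itv mu a b Es.
have ab := quadratic_support_nondegenerate R rho alpha beta a b mu hmin mu0.
pose m : R := (a + b) / 2; pose r : R := (b - a) / 2.
have r0 : 0 < r by rewrite divr_gt0 ?subr_gt0.
have am : a = m - r by rewrite /m /r; field.
have bm : b = m + r by rewrite /m /r; field.
have bound (psi : R -> R) (k1 k2 : R) : (forall x, psi x = k1 + k2 * x) ->
    poincare_lower_bound rho a b psi = (k2 ^+ 2 * (rho * r ^+ 2 / 2))%:E.
  by move=> h; rewrite {1}am bm; exact: poincare_lower_bound_affine.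
have cW (x y t : R) : 0 <= t <= 1 ->
    (rho * (t * x + (1 - t) * y - alpha) ^+ 2 + beta) - rho * (t * x + (1 - t) * y) ^+ 2
    <= t * ((rho * (x - alpha) ^+ 2 + beta) - rho * x ^+ 2)
       + (1 - t) * ((rho * (y - alpha) ^+ 2 + beta) - rho * y ^+ 2).
  by move=> _; lra.
have c1mu (k : R) : (\int[mu]_x k%:E = k%:E)%E.
  by rewrite integral_cst// [X in (_ * X)%E]probability_setT mule1.
have upper : rho * r ^+ 2 / 2 <= 1.
  have := poincare_inequality _ rho mu a b rho0 ab cW hmin Es (fun x => x) (fun=> 1) (fun=> 0)
    (fun x => did x) (fun x => dcst 1 x) (fun x => ccst 0 x).
  rewrite (bound _ 0 1); last by move=> x; ring.
  by rewrite c1mu lee_fin expr1n mul1r.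
have lower := quadratic_support_radius rho alpha beta mu a b rho0 hmin (ltW ab) mu0.
have rE : rho * r ^+ 2 / 2 = 1.
  have e : rho * r ^+ 2 / 2 = rho * (b - a) ^+ 2 / 8 by rewrite /r; field.
  by apply/eqP; rewrite eq_le upper e; lra.
rewrite (bound phi c1 c2)// rE mulr1 -c1mu; apply: eq_integral => x _.
congr (_ ^+ 2)%:E; have d : is_derive x 1 phi c2.
  by dstart; [rewrite /phi; der|rewrite /=; ring].
by rewrite derive1E; have [_ ->] := d.
Qed.
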